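(* Let $(\alpha_n)_{n\in\mathbb{N}}$ be a sequence of real numbers such that $\alpha_n\notin \mathbb{S}_n=\{-n,-(n-1),\ldots,-2,-1\}$ for every $n\in\mathbb{N}$ and $$\lim_{n\to\infty}\frac{\alpha_n}{n}=-1 .$$ Suppose that for some $r\in[0,+\infty]$ (with the convention $e^{-\infty}=0$) $$\lim_{n\to\infty}\left[\operatorname{dist}(\alpha_n,\mathbb{S}_n)\right]^{1/n}=e^{-r}.$$ Let $\nu_n$ be the normalized zero counting measure of the rescaled Laguerre polynomial $z\mapsto L_n^{(\alpha_n)}(nz)$. Then $\nu_n\to\mu_r$ in the weak-* sense as $n\to\infty$, where for $0\le r<+\infty$ the measure $\mu_r$ is the measure on the curve $$\Gamma_r=\left\{z\in\mathbb{C} : \left|ze^{1-z}\right|=e^{-r},\ |z|\le 1\right\}$$ given by $$d\mu_r(z)=\frac{1}{2\pi i}\,\frac{1-z}{z}\,dz,\qquad z\in\Gamma_r,$$ and for $r=+\infty$ the limit measure is $\mu_\infty=\delta_0$, the Dirac mass at $z=0$.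
   Context: For $n\in\mathbb{N}$ and $\alpha\in\mathbb{C}$, the (generalized) Laguerre polynomial is $$L_n^{(\alpha)}(z)=\sum_{k=0}^n\binom{n+\alpha}{n-k}\frac{(-z)^k}{k!},$$ where $\binom{a}{j}=a(a-1)\cdots(a-j+1)/j!$; it has degree exactly $n$ for every $\alpha\in\mathbb{C}$. For $\alpha\in\mathbb{R}$, $\operatorname{dist}(\alpha,\mathbb{S}_n)=\min_{1\le j\le n}|\alpha+j|$. For a polynomial $p$ of degree $n\ge1$, its normalized (unit) zero counting measure is $\frac1n\sum_{p(\zeta)=0}\delta_\zeta$, where zeros are counted with multiplicity. For $0\le r<+\infty$ the set $\Gamma_r$ is a closed curve around the origin ($\Gamma_0$ is the Szegő curve), oriented counterclockwise; with this orientation, the a priori complex measure $\frac{1}{2\pi i}\frac{1-z}{z}\,dz$ on $\Gamma_r$ is a positive measure of total mass $1$. *)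

(* Defs.v *)
From HB Require Import structures.
From mathcomp Require Import all_boot all_order all_algebra.
From mathcomp Require Import complex.
From mathcomp Require Import all_classical all_reals all_analysis.

Set Implicit Arguments.
Unset Strict Implicit.
Unset Printing Implicit Defensive.
Import Order.TTheory GRing.Theory Num.Theory.
Import numFieldNormedType.Exports.
Local Open Scope classical_set_scope.
Local Open Scope ring_scope.
Local Open Scope complex_scope.

(* R[i] gets the topology of its modulus.  The copy stops short of             *)
(* NormedModule, whose scaling over R[i] would compete with the scaling over R *)
(* that R[i] already has.                                                      *)
HB.instance Definition _ (R : realType) :=
  PseudoMetricNormedZmod.copy R[i] R[i]^o.

Definition borelC (R : realType) := g_sigma_algebraType (@open R[i]).

Section Laguerre.
Variable K : fieldType.

Definition gbinom (a : K) (j : nat) : K :=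
  (\prod_(i < j) (a - i%:R)) / (j`!)%:R.

Definition laguerre (n : nat) (a : K) : {poly K} :=
  \sum_(k < n.+1) (gbinom (n%:R + a) (n - k) / (k`!)%:R) *: (- 'X) ^+ k.

End Laguerre.

Section Definitions.
Variable R : realType.

(* The default |a + 1| of the iterated minimum is itself one of the terms when *)
(* n >= 1, so this is the distance from a to {-n, ..., -1}; the value at n = 0 *)
(* is irrelevant.                                                              *)
Definition distS (n : nat) (a : R) : R :=
  \big[Num.min/`|a + 1|]_(1 <= j < n.+1) `|a + j%:R|.

(* A listing of the roots of p with multiplicity, p = c * \prod ('X - z);      *)
(* meaningful for p != 0.                                                      *)
Definition zeros (p : {poly R[i]}) : seq R[i] :=
  sval (closed_field_poly_normal p).

Definition zero_measure (p : {poly R[i]}) : {measure set (borelC R) -> \bar R} :=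
  mscale ((size (zeros p))%:R^-1)%:nng
    (msum (fun j => \d_((zeros p)`_j : borelC R)) (size (zeros p))).

(* Testing against bounded continuous functions, against C_0 or against        *)
(* compactly supported ones is the same here: all the measures involved have   *)
(* mass 1, except for a zero counting measure of a constant polynomial.        *)
Definition weak_star_cvg (nu : nat -> {measure set (borelC R) -> \bar R})
    (mu : {measure set (borelC R) -> \bar R}) : Prop :=
  forall f : R[i] -> R, continuous f -> (exists M : R, forall z, `|f z| <= M) ->
    \int[nu n]_z f z @[n --> \oo] --> \int[mu]_z f z.

Definition cexp (z : R[i]) : R[i] :=
  (expR (complex.Re z))%:C * (cos (complex.Im z) +i* sin (complex.Im z)).

Definition Gamma (r : R) : set R[i] :=
  [set z | `|z * cexp (1 - z)| = (expR (- r))%:C /\ `|z| <= 1].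

Definition two_pi_i : R[i] := 0 +i* (2 * pi).

(* Paths are functions R -> R[i] considered on [0, 1] only. *)
Definition velocity (g : R -> R[i]) (t : R) : R[i] :=
  derive1 (fun s => complex.Re (g s)) t +i* derive1 (fun s => complex.Im (g s)) t.

(* The exceptional points of E and the end points may be corners; the bound on *)
(* the velocity makes the line integrals below converge.                       *)
Definition piecewise_C1 (g : R -> R[i]) : Prop :=
  {within `[0, 1], continuous g} /\
  exists (E : seq R) (M : R), forall t : R, t \in `]0, 1[ -> t \notin E ->
    [/\ derivable (fun s => complex.Re (g s)) t 1,
        derivable (fun s => complex.Im (g s)) t 1,
        {for t, continuous (velocity g)} &
        `|velocity g t| <= M%:C].

Definition line_integral (g : R -> R[i]) (F : R[i] -> R[i]) : R[i] :=
  let G t := F (g t) * velocity g t in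
  (\int[lebesgue_measure]_(t in `[0, 1]) complex.Re (G t)) +i*
  (\int[lebesgue_measure]_(t in `[0, 1]) complex.Im (G t)).

(* g parametrizes the simple closed curve C, which goes around the origin, in  *)
(* the counterclockwise direction: the index of 0 is +1.                       *)
Definition ccw_parametrization (g : R -> R[i]) (C : set R[i]) : Prop :=
  [/\ piecewise_C1 g,
      {in `[0, 1[ &, injective g},
      g 0 = g 1,
      g @` `[0, 1] = C &
      line_integral g (fun z => z^-1) = two_pi_i].

(* For finite r, the values of mu on Borel sets are the line integrals of      *)
(* their indicator functions against the complex density, so mu is uniquely    *)
(* determined; the choice of g is immaterial.                                  *)
Definition is_mu (r : \bar R) (mu : set (borelC R) -> \bar R) : Prop :=
  match r with
  | s%:E => exists2 g : R -> R[i], ccw_parametrization g (Gamma s) &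
      forall A : set (borelC R), measurable A ->
        (fine (mu A))%:C =
        line_integral g
          (fun z => (\1_(A : set R[i]) z : R)%:C * (two_pi_i^-1 * ((1 - z) / z)))
  | +oo%E => forall A : set (borelC R), measurable A ->
      mu A = \d_(0 : borelC R) A
  | -oo%E => False
  end.

End Definitions.

(* Main.v *)
Require Import Defs.
From HB Require Import structures.
From mathcomp Require Import all_boot all_order all_algebra.
From mathcomp Require Import complex.
From mathcomp Require Import all_classical all_reals all_analysis.
From mathcomp Require Import measurable_realfun zify ring lra.
Import Order.TTheory GRing.Theory Num.Theory.
Import numFieldNormedType.Exports.
Local Open Scope classical_set_scope.
Local Open Scope ring_scope.
Local Open Scope complex_scope.

Set Implicit Arguments.
Unset Strict Implicit.
Unset Printing Implicit Defensive.

(* Let a = n + alpha_n = o(n) and phi z = z exp (1 - z), and let z run over the *)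
(* zeros of the rescaled polynomial.  In the variable u = 1 / z, the product Q  *)
(* of the factors 1 - z u has the coefficients binom(a, q) n!/(n-q)! (-1/n)^q.  *)
(* Comparison with truncated exponentials shows |Q| <= exp (o(n)) where |u| < 1 *)
(* or |phi (1 / u)| > e^-r, and Jensen's inequality in polynomial images of the *)
(* disc shows that only o(n) zeros stay in the exterior of Gamma_r.  For r = oo *)
(* this already means that the zeros tend to 0.  For finite r, the product of   *)
(* the moduli |z| is read off the constant coefficient, and the sum of the z is *)
(* o(n); hence the mean of log |phi z| + r is at least - o(1), and only o(n)    *)
(* zeros stay away from Gamma_r.  The Laguerre differential equation shows that *)
(* all power sums of the z are o(n), so the means of phi(z)^k, k >= 1, tend to  *)
(* 0 and, by Weyl's criterion, phi(z) equidistributes on a circle.  Under phi,  *)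
(* which is injective on Gamma_r, this is the measure mu_r.                     *)

(** The quantity that links the zeros z with the distance of alpha_n to the integers is log |phi z|.

    Exterior of the curve. By [lagzeros_prod] the product of the 1 - z u is [lagq]. Its coefficients
    are those of a reversed exponential sum [trexp], which has size about |phi (1 / u)|^(-n) for |u|
    >= 1 ([trexp_ge1]), times numbers that reduce to moments of beta distributions; such moments do
    not increase a bound that is uniform over dilations ([beta_multiplier]). When a is close to an
    integer L, the coefficients beyond degree L carry the factor a - L, about exp (- r n), and this
    compensates the size of [trexp] ([lagq_near]). Thus [lagq] is exp (o(n)) on [outer r]
    ([lagq_subexp]). Since [outer r] is open and star-shaped about 0, each of its points is covered
    by a polynomial image of the disc, in which Jensen's inequality counts zeros ([reachable_count],
    [sparse_outer]).

    Interior of the curve. The mean of log |phi z| is that of log |z| + 1 - Re z. The constant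
    coefficient bounds the mean of log |z| below by - 1 - r - o(1) ([lagzeros_prod_ge]), and the
    mean of z is o(1). As log |phi z| rarely exceeds - r, it is rarely much below - r either
    ([sparse_inner]), and the zeros accumulate on the curve ([sparse_off_curve]).

    Distribution along the curve. The differential equation yields a recurrence for the power sums
    ([lagzeros_sums]) whose first term is n + alpha_n = o(n); so the means of z^m, m >= 1, vanish in
    the limit ([lagzeros_means]), and with them those of phi(z)^k, k >= 1, because phi vanishes at 0
    ([vanish_phi]). As phi is injective on the closed unit disc ([phi_inj]), a test function on the
    curve is a continuous function of phi z, approximated by the real part of a polynomial in phi z
    ([circle_approx]); the mean of the latter tends to its value at 0 ([mean_limit]).

    The measure mu_r has the same description: the logarithmic derivative of phi is (1 - z) / z, so
    mu_r is the normalized increment of arg phi along the curve ([curve_measure_line]), and its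
    integrals are limits of averages over points with equally spaced images under phi
    ([curve_measure_riemann]). For r = oo, [sparse_outer_all] leaves only o(n) zeros outside any
    disc about 0. *)

(** * Complex modulus and exponential *)

Section Modulus.
Variable R : realType.
Implicit Types z w : R[i].

Definition absc z : R := complex.Re `|z|.

Lemma absc_norm z : `|z| = (absc z)%:C.
Proof. by rewrite /absc normc_def. Qed.

Lemma absc_def z : absc z = Num.sqrt (complex.Re z ^+ 2 + complex.Im z ^+ 2).
Proof. by rewrite /absc normc_def. Qed.

Lemma absc_ge0 z : 0 <= absc z.
Proof. by rewrite absc_def sqrtr_ge0. Qed.

Lemma absc_sqr z : absc z ^+ 2 = complex.Re z ^+ 2 + complex.Im z ^+ 2.
Proof. by rewrite absc_def sqr_sqrtr // addr_ge0 // sqr_ge0. Qed.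

Lemma absc0 : absc 0 = 0. Proof. by rewrite /absc normr0. Qed.

Lemma absc1 : absc 1 = 1. Proof. by rewrite /absc normr1. Qed.

Lemma absc_eq0 z : (absc z == 0) = (z == 0).
Proof.
rewrite -[RHS]normr_eq0 absc_norm.
by apply/eqP/eqP => [->//|[]].
Qed.

Lemma absc_gt0 z : (0 < absc z) = (z != 0).
Proof. by rewrite lt_def absc_ge0 andbT absc_eq0. Qed.

Lemma abscM z w : absc (z * w) = absc z * absc w.
Proof.
by apply: complexI; rewrite -absc_norm normrM !absc_norm rmorphM.
Qed.

Lemma abscX z n : absc (z ^+ n) = absc z ^+ n.
Proof.
by apply: complexI; rewrite -absc_norm normrX !absc_norm rmorphXn.
Qed.

Lemma abscV z : absc z^-1 = (absc z)^-1.
Proof.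
by apply: complexI; rewrite -absc_norm normfV !absc_norm fmorphV.
Qed.

Lemma absc_div z w : absc (z / w) = absc z / absc w.
Proof. by rewrite abscM abscV. Qed.

Lemma abscN z : absc (- z) = absc z.
Proof. by rewrite /absc normrN. Qed.

Lemma absc_distC z w : absc (z - w) = absc (w - z).
Proof. by rewrite -abscN opprB. Qed.

Lemma absc_prod I (s : seq I) (F : I -> R[i]) :
  absc (\prod_(i <- s) F i) = \prod_(i <- s) absc (F i).
Proof. by elim/big_rec2: _ => [|i y x _ <-]; rewrite ?absc1 ?abscM. Qed.

Lemma absc_triangle z w : absc (z + w) <= absc z + absc w.
Proof.
by rewrite -lecR rmorphD /= -!absc_norm; exact: ler_normD.
Qed.

Lemma absc_triangleB z w : absc (z - w) <= absc z + absc w.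
Proof. by rewrite -(abscN w) absc_triangle. Qed.

Lemma absc_triangle_sub z w : absc z - absc w <= absc (z - w).
Proof.
by rewrite lerBlDr; apply: le_trans (absc_triangle _ _); rewrite subrK.
Qed.

Lemma absc_triangle_add z w : absc z - absc w <= absc (z + w).
Proof. by have := absc_triangle_sub z (- w); rewrite opprK abscN. Qed.

Lemma absc_dist_triangle v z w : absc (z - w) <= absc (z - v) + absc (v - w).
Proof. by have := absc_triangle (z - v) (v - w); rewrite addrA subrK. Qed.

Lemma absc_sum I (s : seq I) (P : pred I) (F : I -> R[i]) :
  absc (\sum_(i <- s | P i) F i) <= \sum_(i <- s | P i) absc (F i).
Proof.
elim/big_rec2: _ => [|i y x _ le]; first by rewrite absc0.
by apply: le_trans (absc_triangle _ _) _; rewrite lerD2l.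
Qed.

Lemma absc_real (x : R) : absc x%:C = `|x|.
Proof. by rewrite absc_def /= expr0n addr0 sqrtr_sqr. Qed.

Lemma absc_nat n : absc n%:R = n%:R.
Proof. by rewrite /absc normr_nat -(rmorph_nat (real_complex R)). Qed.

Lemma Re_le_absc z : `|complex.Re z| <= absc z.
Proof.
rewrite absc_def -sqrtr_sqr ler_wsqrtr // lerDl; exact: sqr_ge0.
Qed.

Lemma Im_le_absc z : `|complex.Im z| <= absc z.
Proof.
rewrite absc_def -sqrtr_sqr ler_wsqrtr // lerDr; exact: sqr_ge0.
Qed.

Lemma Re_leif_absc z : complex.Re z <= absc z.
Proof. exact: le_trans (ler_norm _) (Re_le_absc z). Qed.

Lemma absc_le_ReIm z : absc z <= `|complex.Re z| + `|complex.Im z|.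
Proof.
have h0 : 0 <= `|complex.Re z| + `|complex.Im z| by rewrite addr_ge0.
rewrite -[leRHS]ger0_norm // -sqrtr_sqr absc_def ler_wsqrtr //.
rewrite -[complex.Re z ^+ 2]real_normK ?num_real //.
rewrite -[complex.Im z ^+ 2]real_normK ?num_real //.
have h1 := normr_ge0 (complex.Re z); have h2 := normr_ge0 (complex.Im z).
nra.
Qed.

Lemma absc_conj z : absc z^*%C = absc z.
Proof. by rewrite /absc normcJ. Qed.

Lemma mul_conjc z : z * z^*%C = (absc z ^+ 2)%:C.
Proof. by rewrite -sqr_normc absc_norm rmorphXn. Qed.

Lemma ReD z w : complex.Re (z + w) = complex.Re z + complex.Re w.
Proof. by case: z; case: w. Qed.

Lemma ReB z w : complex.Re (z - w) = complex.Re z - complex.Re w.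
Proof. by case: z; case: w. Qed.

Lemma ReN z : complex.Re (- z) = - complex.Re z.
Proof. by case: z. Qed.

Lemma ImB z w : complex.Im (z - w) = complex.Im z - complex.Im w.
Proof. by case: z; case: w. Qed.

Lemma Re_sum I (s : seq I) (P : pred I) (F : I -> R[i]) :
  complex.Re (\sum_(i <- s | P i) F i) = \sum_(i <- s | P i) complex.Re (F i).
Proof. by elim/big_rec2: _ => [//|i y x _ <-]; rewrite ReD. Qed.

Lemma Re_realM (x : R) z : complex.Re (x%:C * z) = x * complex.Re z.
Proof. by case: z => a b /=; rewrite mul0r subr0. Qed.

Lemma Im_realM (x : R) z : complex.Im (x%:C * z) = x * complex.Im z.
Proof. by case: z => a b /=; rewrite mul0r addr0. Qed.

Lemma absc_cexp z : absc (cexp z) = expR (complex.Re z).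
Proof.
rewrite /cexp abscM absc_real ger0_norm ?expR_ge0 // absc_def /=.
by rewrite cos2Dsin2 sqrtr1 mulr1.
Qed.

Lemma cexpD z w : cexp (z + w) = cexp z * cexp w.
Proof.
case: z => a b; case: w => c d.
rewrite /cexp /= cosD sinD expRD /=; apply/eqP.
by rewrite eq_complex /=; apply/andP; split; apply/eqP; ring.
Qed.

Lemma cexp0 : cexp (0 : R[i]) = 1.
Proof.
rewrite /cexp /= expR0 cos0 sin0.
by apply/eqP; rewrite eq_complex /= !mulr0 !mulr1 subr0 addr0 !eqxx.
Qed.

Lemma cexp_neq0 z : cexp z != 0.
Proof. by rewrite -absc_gt0 absc_cexp expR_gt0. Qed.

Lemma cexpX z n : cexp z ^+ n = cexp (n%:R * z).
Proof.
elim: n => [|n IH]; first by rewrite expr0 mul0r cexp0.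
by rewrite exprS IH -cexpD -natr1 mulrDl mul1r addrC.
Qed.

Definition cis (t : R) : R[i] := cos t +i* sin t.

Lemma absc_cis t : absc (cis t) = 1.
Proof. by rewrite absc_def /= cos2Dsin2 sqrtr1. Qed.

Lemma cisD s t : cis (s + t) = cis s * cis t.
Proof.
rewrite /cis cosD sinD; apply/eqP; rewrite eq_complex /=.
by apply/andP; split; apply/eqP; ring.
Qed.

Lemma cis0 : cis 0 = 1.
Proof. by rewrite /cis cos0 sin0. Qed.

Lemma cisX t n : cis t ^+ n = cis (n%:R * t).
Proof.
elim: n => [|n IH]; first by rewrite expr0 mul0r cis0.
by rewrite exprS IH -cisD -natr1 mulrDl mul1r addrC.
Qed.

Lemma cis_2pi : cis (2 * pi) = 1.
Proof. by rewrite /cis mulr_natl cos2pi sin2pi. Qed.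

End Modulus.
(** * Counting zeros by Jensen's inequality *)

Section CircleMean.
Variable R : realType.
Local Notation C := R[i].

Lemma cis_neq1 (t : R) : 0 < t -> t < 2 * pi -> cis t != 1.
Proof.
move=> t0 t2; apply/eqP => /(congr1 (@complex.Re R)) /= ct.
have : 0 < sin (t / 2) by apply: sin_gt0_pi; rewrite ?divr_gt0 // ltr_pdivrMr // mulrC.
have := cosD (t / 2) (t / 2); rewrite -splitr ct => h.
have := cos2Dsin2 (t / 2); nra.
Qed.

Lemma sum_unity_roots (M j : nat) : (0 < M)%N ->
  \sum_(m < M) (cis (2 * pi / M%:R) ^+ m) ^+ j
  = (if (M %| j)%N then M%:R else 0) :> C.
Proof.
move=> M0; set w := cis _.
have MR : M%:R != 0 :> R by rewrite pnatr_eq0 -lt0n.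
have wM : w ^+ M = 1 by rewrite cisX mulrC divfK // cis_2pi.
have wj : w ^+ j = w ^+ (j %% M).
  by rewrite {1}(divn_eq j M) exprD mulnC exprM wM expr1n mul1r.
under eq_bigr do rewrite -exprM mulnC exprM.
case: ifPn => [/dvdnP[k ->]|ndv].
  under eq_bigr do rewrite mulnC exprM wM !expr1n.
  by rewrite sumr_const card_ord.
have x1 : w ^+ j != 1.
  rewrite wj cisX; apply: cis_neq1.
    by rewrite mulr_gt0 ?ltr0n ?lt0n // divr_gt0 ?ltr0n // mulr_gt0 // pi_gt0.
  rewrite mulrCA -[ltRHS]mulr1 ltr_pM2l ?mulr_gt0 ?pi_gt0 // ltr_pdivrMr ?ltr0n //.
  by rewrite mul1r ltr_nat ltn_pmod.
apply: (@mulfI _ (w ^+ j - 1)); first by rewrite subr_eq0.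
by rewrite -subrX1 -exprM mulnC exprM wM expr1n subrr mulr0.
Qed.

(** Discrete Cauchy coefficient formula. The exponent M - k stands for - k, since the nodes are M-th
    roots of unity. *)
Lemma coef_unity_roots (G : {poly C}) (M k : nat) :
  (size G <= M)%N -> (k < M)%N ->
  \sum_(m < M) G.[cis (2 * pi / M%:R) ^+ m] * (cis (2 * pi / M%:R) ^+ m) ^+ (M - k)
  = M%:R * G`_k.
Proof.
move=> sG kM; have M0 : (0 < M)%N by exact: leq_ltn_trans kM.
under eq_bigr => m _ do rewrite (horner_coef_wide _ sG) mulr_suml.
rewrite exchange_big /=.
under eq_bigr => i _.
  under eq_bigr => m _ do rewrite -mulrA -exprD.
  rewrite -mulr_sumr sum_unity_roots //; over.
rewrite (bigD1 (Ordinal kM)) //= subnKC ?(ltnW kM) // dvdnn mulrC big1 ?addr0 //.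
move=> i ik; case: ifPn => //; last by rewrite mulr0.
move=> /dvdnP[c]; have := ltn_ord i.
(* Here i + (M - k) = c M with i < M and 0 < M - k <= M: the values c = 0 and c >= 2 are impossible,
   and c = 1 means i = k. *)
case: c => [|[|c]] iM.
- by move=> h; exfalso; lia.
- by move=> h; case/eqP: ik; apply/val_inj => /=; lia.
- by rewrite !mulSn => h; exfalso; lia.
Qed.

(** Cauchy's estimate, read off the discrete formula with at least as many nodes as G has
    coefficients. *)
Lemma coef_le_circle (G : {poly C}) (S : R) (k : nat) :
  (forall w, absc w = 1 -> absc G.[w] <= S) -> absc G`_k <= S.
Proof.
move=> hG; have S0 : 0 <= S by apply: le_trans (hG 1 (absc1 _)); exact: absc_ge0.
pose M := maxn (size G) k.+1.
have kM : (k < M)%N by exact: leq_maxr.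
have M0 : 0 < M%:R :> R by rewrite ltr0n (leq_ltn_trans _ kM).
have /(congr1 (@absc R)) := coef_unity_roots (leq_maxl (size G) k.+1) kM.
rewrite abscM absc_nat => e; rewrite -(ler_pM2l M0) -e.
apply: le_trans (absc_sum _ _ _) _.
have -> : M%:R * S = \sum_(m < M) S by rewrite sumr_const card_ord mulr_natl.
apply: ler_sum => m _.
have cw : absc (cis (2 * pi / M%:R) ^+ m : C) = 1 by rewrite abscX absc_cis expr1n.
by rewrite abscM abscX cw expr1n mulr1; exact: hG.
Qed.

(** The Blaschke trick: v - w and 1 - conj(w) v have the same modulus on the unit circle, and
    exchanging one for the other changes the modulus at 0 from 1 to 1 / |w|. *)
Lemma reflect_root (q : {poly C}) (w : C) : q.[0] = 1 -> root q w ->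
  exists2 q' : {poly C}, forall v, absc v = 1 -> absc q'.[v] = absc q.[v] &
    absc q'.[0] = (absc w)^-1.
Proof.
move=> q0 /factor_theorem[h qE].
have hw : h.[0] * - w = 1 by rewrite -q0 qE hornerM hornerXsubC sub0r.
have w0 : w != 0 by apply/eqP => w0; move: hw; rewrite w0 oppr0 mulr0 => /esym/eqP; rewrite oner_eq0.
exists (h * (1 - w^*%C *: 'X)) => [v v1|]; last first.
  have hw1 : absc h.[0] * absc w = 1 by rewrite -(abscN w) -abscM hw absc1.
  apply: (mulIf (x := absc w)); first by rewrite absc_eq0.
  rewrite mulVf ?absc_eq0 // hornerM hornerD hornerN hornerZ hornerX hornerC.
  by rewrite mulr0 subr0 mulr1.
rewrite qE !hornerM !abscM hornerXsubC hornerD hornerN hornerZ hornerX hornerC; congr (_ * _).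
have vv : v * v^*%C = 1 by rewrite mul_conjc v1 expr1n.
have -> : 1 - w^*%C * v = v * (v - w)^*%C by rewrite rmorphB mulrBr vv mulrC.
by rewrite abscM absc_conj v1 mul1r.
Qed.

(** Jensen's inequality without logarithms. Reflecting one root in each factor selected by [J] keeps
    the modulus on the circle and makes the value at 0 at least tau^(-count); Cauchy's estimate for
    the constant coefficient concludes. *)
Lemma jensen_count (T : eqType) (s : seq T) (q : T -> {poly C}) (J : pred T)
    (tau M : R) : 0 < tau ->
  (forall x, x \in s -> (q x).[0] = 1) ->
  (forall x, x \in s -> J x -> exists2 w, root (q x) w & absc w <= tau) ->
  (forall w, absc w = 1 -> absc (\prod_(x <- s) q x).[w] <= M) ->
  tau^-1 ^+ count J s <= M.
Proof.
move=> tau0 q0 qr qM.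
have [Q' QE Q0] : exists2 Q' : {poly C},
    forall v, absc v = 1 -> absc Q'.[v] = absc (\prod_(x <- s) q x).[v] &
    tau^-1 ^+ count J s <= absc Q'.[0].
  elim: s q0 qr {qM} => [|x s IH] q0 qr.
    by exists 1 => [v|]; rewrite ?big_nil ?hornerE //= absc1.
  have [|y ys|Q' QE Q0] := IH.
  - by move=> y ys; apply: q0; rewrite inE ys orbT.
  - by apply: qr; rewrite inE ys orbT.
  have /= [Jx|Jx] := boolP (J x).
    have [w wr wt] := qr x (mem_head _ _) Jx.
    have [q' qE' q'0] := reflect_root (q0 x (mem_head _ _)) wr.
    exists (q' * Q') => [v v1|].
      by rewrite big_cons !hornerM !abscM qE' // QE.
    rewrite hornerM abscM q'0 add1n exprS ler_pM ?exprn_ge0 ?invr_ge0 ?(ltW tau0) //.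
    rewrite lef_pV2 ?posrE // absc_gt0; apply/eqP => w0.
    by move: wr; rewrite w0 /root q0 ?mem_head // oner_eq0.
  exists (q x * Q') => [v v1|]; first by rewrite big_cons !hornerM !abscM QE.
  by rewrite hornerM abscM q0 ?mem_head // absc1 mul1r add0n.
apply: le_trans Q0 _; rewrite horner_coef0; apply: coef_le_circle => w w1.
by rewrite QE // qM.
Qed.

End CircleMean.

(** * Continuity in the plane and polynomial images of the disc *)

Section Plane.
Variable R : realType.
Local Notation C := R[i].

(** Heine-Borel for balls whose radius varies with the centre, from compactness of a square in its
    near-covering form. *)
Lemma finite_cover_disc (eta : C -> R) (B : R) : (forall c, 0 < eta c) ->
  exists s : seq C, forall z, absc z <= B ->
    exists2 c, c \in s & absc (z - c) < eta c.
Proof.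
move=> eta0.
have cK : compact ((`[- B, B] `*` `[- B, B])%classic : set (R * R)%type).
  by apply: compact_setX; exact: segment_compact.
(* Finite lists directed by inclusion: eventually along [F] means for every list that contains a
   certain finite one. *)
pose F : set_system (seq C) :=
  [set X | exists s0 : seq C, forall s : seq C, {subset s0 <= s} -> X s].
have FF : Filter F.
  split; first by exists [::].
    move=> X Y [s1 h1] [s2 h2]; exists (s1 ++ s2) => s sub; split.
      by apply: h1 => x xs; apply: sub; rewrite mem_cat xs.
    by apply: h2 => x xs; apply: sub; rewrite mem_cat xs orbT.
  by move=> X Y XY [s1 h1]; exists s1 => s /h1 /XY.
pose P (s : seq C) (x : R * R) := exists2 c, c \in s & absc (x.1 +i* x.2 - c) < eta c.
have /(_ _ F P FF)[|s0 hs0] := (compact_near_coveringP _).1 cK.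
  move=> x _; exists (ball x (eta (x.1 +i* x.2) / 2), [set s : seq C | x.1 +i* x.2 \in s]).
    split; first by apply: nbhsx_ballx; rewrite divr_gt0.
    by exists [:: x.1 +i* x.2] => s sub; apply: sub; rewrite mem_head.
  move=> [y s] /= [[b1 b2] xs]; exists (x.1 +i* x.2) => //.
  apply: le_lt_trans (absc_le_ReIm _) _; rewrite ReB ImB /= [ltRHS]splitr.
  by apply: ltrD; rewrite distrC; [exact: b1|exact: b2].
exists s0 => z zB.
have [//|| c cs hc] := hs0 s0 _ (complex.Re z, complex.Im z).
  split; rewrite /= in_itv /= -ler_norml.
    exact: le_trans (Re_le_absc z) zB.
  exact: le_trans (Im_le_absc z) zB.
by exists c => //; case: z zB hc.
Qed.

(** Continuity with real radii: the distance behind the topology of [R[i]] has its values in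
    [R[i]]. *)
Definition ccont_at (F : C -> C) (c : C) := forall e, 0 < e ->
  exists2 d, 0 < d & forall z, absc (z - c) < d -> absc (F z - F c) < e.

Lemma eq_ccont (F G : C -> C) (c : C) : F =1 G -> ccont_at F c -> ccont_at G c.
Proof. by move=> /funext ->. Qed.

Lemma ccont_cst (k c : C) : ccont_at (fun=> k) c.
Proof. by move=> e e0; exists 1 => // z _; rewrite subrr absc0. Qed.

Lemma ccont_id (c : C) : ccont_at id c.
Proof. by move=> e e0; exists e. Qed.

Lemma ccontD (F G : C -> C) (c : C) :
  ccont_at F c -> ccont_at G c -> ccont_at (fun z => F z + G z) c.
Proof.
move=> hF hG e e0; have e2 : 0 < e / 2 by rewrite divr_gt0.
have [d d0 hd] := hF _ e2; have [d' d'0 hd'] := hG _ e2.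
exists (Num.min d d'); first by rewrite lt_min d0.
move=> z; rewrite lt_min => /andP[zd zd'].
rewrite opprD addrACA [ltRHS]splitr; apply: le_lt_trans (absc_triangle _ _) _.
by apply: ltrD; [exact: hd|exact: hd'].
Qed.

Lemma ccontM (F G : C -> C) (c : C) :
  ccont_at F c -> ccont_at G c -> ccont_at (fun z => F z * G z) c.
Proof.
move=> hF hG e e0.
pose k := absc (F c) + absc (G c) + 1.
have k0 : 0 < k by rewrite ltr_wpDl // addr_ge0 ?absc_ge0.
pose m := Num.min 1 (e / (2 * k)).
have m0 : 0 < m by rewrite lt_min ltr01 divr_gt0 // mulr_gt0.
have [d d0 hd] := hF _ m0; have [d' d'0 hd'] := hG _ m0.
exists (Num.min d d'); first by rewrite lt_min d0.
move=> z; rewrite lt_min => /andP[/hd zd /hd' zd'].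
have -> : F z * G z - F c * G c =
  (F z - F c) * (G z - G c) + (F c * (G z - G c) + (F z - F c) * G c) by ring.
apply: le_lt_trans (absc_triangle _ _) _.
apply: le_lt_trans (lerD (lexx _) (absc_triangle _ _)) _; rewrite !abscM.
have m1 : m <= 1 by rewrite ge_min lexx.
have me : m * (2 * k) <= e by rewrite -ler_pdivlMr ?mulr_gt0 // ge_min lexx orbT.
move: (absc_ge0 (F c)) (absc_ge0 (G c)) (absc_ge0 (F z - F c)) (absc_ge0 (G z - G c)).
move: zd zd' me k0; rewrite /k.
set x := absc (F z - F c); set y := absc (G z - G c).
set a := absc (F c); set b := absc (G c) => xm ym me k0 a0 b0 x0 y0.
apply: (@le_lt_trans _ _ (m * (a + b + 1))); last nra.
have : x * y <= m * 1 by apply: ler_pM => //; [exact: ltW|lra].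
nra.
Qed.

Lemma ccont_comp (F G : C -> C) (c : C) :
  ccont_at F (G c) -> ccont_at G c -> ccont_at (fun z => F (G z)) c.
Proof.
move=> hF hG e /hF[d d0 hd]; have [d' d'0 hd'] := hG _ d0.
by exists d' => // z /hd' /hd.
Qed.

Lemma ccont_horner (p : {poly C}) (c : C) : ccont_at (horner p) c.
Proof.
elim/poly_ind: p => [|p a IH].
  by apply: (eq_ccont (fun z => esym (horner0 z))); exact: ccont_cst.
apply: (eq_ccont (fun z => esym (hornerMXaddC p a z))).
by apply: ccontD; [apply: ccontM => //; exact: ccont_id|exact: ccont_cst].
Qed.

Lemma ccont_inv (c : C) : c != 0 -> ccont_at GRing.inv c.
Proof.
move=> c0 e e0; have ac : 0 < absc c by rewrite absc_gt0.
exists (Num.min (absc c / 2) (e * absc c ^+ 2 / 2)).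
  by rewrite lt_min divr_gt0 //= divr_gt0 // mulr_gt0 // exprn_gt0.
move=> z; rewrite lt_min => /andP[z1 z2].
have az : absc c / 2 < absc z.
  by have := absc_triangle_sub c (c - z); rewrite subKr absc_distC; lra.
have az0 : 0 < absc z by apply: lt_trans az; rewrite divr_gt0.
have z0 : z != 0 by rewrite -absc_gt0.
have -> : z^-1 - c^-1 = (c - z) / (z * c) by field; rewrite z0 c0.
rewrite absc_div abscM ltr_pdivrMr ?mulr_gt0 // absc_distC.
apply: lt_trans z2 _.
have : 0 < (absc z - absc c / 2) * (e * absc c) by rewrite mulr_gt0 ?subr_gt0 ?mulr_gt0.
lra.
Qed.

Lemma exprn_lt_eps (x e : R) : 0 <= x < 1 -> 0 < e -> exists N, x ^+ N < e.
Proof.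
move=> /andP[x0 x1] e0.
have /cvgrPdist_lt /(_ _ e0) [N _ /(_ N (leqnn N)) /=] :
    x ^+ n @[n --> \oo] --> (0 : R) by apply: cvg_expr; rewrite ger0_norm.
by rewrite sub0r normrN ger0_norm ?exprn_ge0 //; exists N.
Qed.

Lemma expr_lin_le (x : R) n : 0 <= x <= 1 -> 1 - n%:R * x <= (1 - x) ^+ n.
Proof.
move=> /andP[x0 x1]; elim: n => [|n IH]; first by rewrite mul0r subr0 expr0.
rewrite exprS -natr1 -[leLHS]mul1r.
have := ler_wpM2l (_ : 0 <= 1 - x) IH; rewrite subr_ge0 => /(_ x1).
apply: le_trans; have : 0 <= n%:R :> R by []; nra.
Qed.

(* The point c is the value at sig < 1 of a polynomial map of the unit disc    *)
(* into S; Jensen's inequality transported by p bounds the number of zeros     *)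
(* near c of a polynomial that is bounded on S.                                *)
Definition reachable (S : C -> Prop) (c : C) := exists (p : {poly C}) (sig mu : R),
  [/\ p.[0] = 0, (1 < size p)%N, 0 <= sig < 1, p.[sig%:C] = c &
      0 < mu /\ forall w v, absc w <= 1 -> absc (v - p.[w]) < mu -> S v].

Lemma absc_add1_sqr (w : C) :
  absc (1 + w) ^+ 2 + absc (w - 1) ^+ 2 = 2 + 2 * absc w ^+ 2.
Proof. by rewrite !absc_sqr; case: w => a b /=; rewrite subr0; ring. Qed.

(* The perturbation w * ((1 + w) / 2) ^ N is concentrated near w = 1, so that  *)
(* it moves the end point of the image of p without moving the rest of it.     *)
Lemma reachable_step (S : C -> Prop) (c h : C) (d : R) :
  reachable S c -> (forall v, absc (v - c) < d -> S v) -> absc h < d / 4 ->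
  reachable S (c + h).
Proof.
move=> Sc cS hd; have [->|h0] := eqVneq h 0; first by rewrite addr0.
case: Sc => p [sig [mu [p0 sp /andP[s0 s1] ps [mu0 pS]]]].
have ah0 : 0 < absc h by rewrite absc_gt0.
have d0 : 0 < d by lra.
(* The number [k] separates two regimes. Within distance k of sig, p stays within d / 4 of c; where
   |w - 1| >= k / 2, the factor |(1 + w) / 2| is at most th < 1. *)
have [k' k'0 hk'] := ccont_horner p sig%:C (e := d / 4) ltac:(lra).
pose k := Num.min k' 1.
have k0 : 0 < k by rewrite lt_min k'0 /=.
have kk' : k <= k' by rewrite ge_min lexx.
have k1 : k <= 1 by rewrite ge_min lexx orbT.
pose th := Num.sqrt (1 - k ^+ 2 / 16).
have th2 : th ^+ 2 = 1 - k ^+ 2 / 16 by rewrite sqr_sqrtr //; nra.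
have th0 : 0 <= th by exact: sqrtr_ge0.
have th1 : th < 1 by nra.
have [N0 hN0] := exprn_lt_eps (e := mu / (2 * d)) (introT andP (conj th0 th1))
  ltac:(by rewrite divr_gt0 // mulr_gt0).
(* The summand [size p] makes the degree N + 1 of the perturbation exceed that of p, so that the sum
   is not constant. *)
pose N := (N0 + size p)%N.
have hN : th ^+ N * (2 * d) < mu.
  rewrite -ltr_pdivlMr ?mulr_gt0 //; apply: le_lt_trans hN0.
  rewrite exprD -[leRHS]mulr1 ler_wpM2l ?exprn_ge0 // exprn_ile1 //.
  exact: ltW.
(* The new evaluation point is s' = 1 - t. The three bounds on t give sig < s', then s'^(N + 1) >= 1
   / 2 by Bernoulli, and then that l is close to sig. *)
pose t := Num.min ((1 - sig) / 2) (Num.min ((2 * N.+1%:R)^-1) (k / 8)).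
have t0 : 0 < t.
  by rewrite !lt_min !divr_gt0 ?subr_gt0 // invr_gt0 mulr_gt0.
have t1 : t <= (1 - sig) / 2 by rewrite ge_min lexx.
have t2 : N.+1%:R * t <= 1 / 2.
  have : t <= (2 * N.+1%:R)^-1 by rewrite !ge_min lexx orbT.
  rewrite invfM => /(ler_wpM2l (ler0n R N.+1)) /le_trans; apply.
  by rewrite mulrCA divff ?pnatr_eq0 // mulr1 div1r.
have t3 : t <= k / 8 by rewrite !ge_min lexx !orbT.
pose s' := 1 - t.
have s'h : 1 / 2 <= s' by rewrite /s'; lra.
have ss' : sig < s' by rewrite /s'; lra.
have s'1 : s' < 1 by rewrite /s'; lra.
have s'0 : 0 < s' by lra.
pose b : {poly C} := 'X * ((1 / 2)%:C *: (1 + 'X)) ^+ N.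
have bE w : b.[w] = w * ((1 / 2)%:C * (1 + w)) ^+ N.
  by rewrite /b hornerM horner_exp hornerZ hornerD !hornerE.
pose bs := s' * (1 / 2 * (1 + s')) ^+ N.
have bsE : b.[s'%:C] = bs%:C.
  by rewrite bE /bs !(rmorphM, rmorphXn, rmorphD, rmorph1).
have bsh : 1 / 2 <= bs.
  have : 1 / 2 <= s' ^+ N.+1.
    apply: le_trans (expr_lin_le _ (_ : 0 <= t <= 1)); last by apply/andP; split; lra.
    lra.
  move/le_trans; apply; rewrite exprS /bs ler_wpM2l ?(ltW s'0) //.
  by apply: lerXn2r; rewrite ?nnegrE; lra.
have bs0 : bs%:C != 0 :> C by rewrite -absc_gt0 absc_real gtr0_norm //; lra.
pose a := h / bs%:C.
have aa : absc a < d / 2.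
  rewrite /a absc_div absc_real gtr0_norm; last lra.
  by rewrite ltr_pdivrMr; nra.
have a0 : a != 0 by rewrite mulf_neq0 // invr_neq0.
(* The contraction by l moves the point over c from sig to s'; the factor [a] makes the perturbation
   equal to h there. *)
pose l := sig / s'.
have l0 : 0 <= l by rewrite divr_ge0 // ltW.
have l1 : l <= 1 by rewrite ler_pdivrMr // mul1r ltW.
have sb : size b = N.+2.
  rewrite /b mulrC size_mulX; last first.
    rewrite expf_neq0 // scaler_eq0 negb_or addrC.
    rewrite -['X + 1]/('X + 1%:P) -size_poly_eq0 size_XaddC andbT.
    by rewrite -absc_gt0 absc_real gtr0_norm; lra.
  congr _.+1; rewrite exprZn size_scale; last first.
    by rewrite expf_neq0 // -absc_gt0 absc_real gtr0_norm; lra.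
  by rewrite addrC -[X in 'X + X]opprK -polyCN size_exp_XsubC.
exists (p \Po (l%:C *: 'X) + a *: b), s', (Num.min (mu / 2) (d / 4)); split.
- by rewrite hornerD hornerZ horner_comp hornerZ hornerX mulr0 p0 bE mul0r mulr0 addr0.
- have sl : (size (l%:C *: 'X : {poly C}) <= 2)%N.
    by apply: leq_trans (size_scale_leq _ _) _; rewrite size_polyX.
  have sq : (size (p \Po (l%:C *: 'X)) <= size p)%N.
    apply: leq_trans (size_comp_poly_leq _ _) _.
    rewrite -[leqRHS](@ltn_predK 1) // ltnS -[leqRHS]muln1.
    by rewrite (leq_mul (leqnn _)) // -subn1 leq_subLR.
  have sab : size (a *: b) = N.+2 by rewrite size_scale.
  by rewrite addrC size_polyDl sab // ltnS (leq_trans sq) // /N leqW // leq_addl.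
- by rewrite s'1 ltW.
- rewrite hornerD hornerZ horner_comp hornerZ hornerX bsE divfK //.
  by rewrite -rmorphM divfK ?gt_eqF // ps.
split; first by rewrite lt_min !divr_gt0.
move=> w v w1; rewrite lt_min hornerD hornerZ horner_comp hornerZ hornerX => /andP[v1 v2].
have lw : absc (l%:C * w) <= 1.
  rewrite abscM absc_real ger0_norm //.
  by have := absc_ge0 w; nra.
have hE : v - p.[l%:C * w] = (v - (p.[l%:C * w] + a * b.[w])) + a * b.[w] by ring.
have bw : absc b.[w] <= absc (((1 / 2)%:C * (1 + w)) ^+ N).
  rewrite bE abscM -[leRHS]mul1r ler_wpM2r ?absc_ge0 //.
have hw : absc ((1 / 2)%:C * (1 + w)) ^+ 2 = (2 + 2 * absc w ^+ 2 - absc (w - 1) ^+ 2) / 4.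
  rewrite -absc_add1_sqr abscM absc_real ger0_norm; last lra.
  by field.
have := absc_ge0 ((1 / 2)%:C * (1 + w)).
have := absc_ge0 w.
rewrite abscX in bw; move: bw hw.
set X := absc ((1 / 2)%:C * (1 + w)) => bw hw w0 X0.
have := absc_ge0 (w - 1) => w10.
(* Near w = 1 the distances d / 4, d / 4 and d / 2 add up to stay in the ball about c. Elsewhere the
   perturbation is below mu / 2 and the margin of p absorbs it. *)
have [wk|wk] := ltP (absc (w - 1)) (k / 2).
  apply: cS.
  have -> : v - c = (v - p.[l%:C * w]) + (p.[l%:C * w] - c) by ring.
  have b1 : absc b.[w] <= 1.
    apply: le_trans bw _; rewrite exprn_ile1 //; nra.
  have : absc (p.[l%:C * w] - c) < d / 4.
    rewrite -ps; apply: hk'; apply: lt_le_trans kk'.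
    have -> : l%:C * w - sig%:C = l%:C * (w - 1) + (l - sig)%:C by rewrite rmorphB; ring.
    apply: le_lt_trans (absc_triangle _ _) _; rewrite abscM !absc_real ger0_norm //.
    rewrite ger0_norm; last by rewrite subr_ge0 ler_pdivlMr //; nra.
    have : l - sig <= k / 4.
      have -> : l - sig = l * t by rewrite /l /s'; field; rewrite -/s' gt_eqF.
      nra.
    nra.
  move=> hp; apply: le_lt_trans (absc_triangle _ _) _; rewrite hE.
  move: (absc_triangle (v - (p.[l%:C * w] + a * b.[w])) (a * b.[w])).
  rewrite abscM; have := absc_ge0 a; have := absc_ge0 b.[w] => B0 A0.
  have := ler_pM A0 B0 (lexx _) b1; move: v2 aa hp; clear; rewrite mulr1; lra.
apply: (pS (l%:C * w)) => //; rewrite hE.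
apply: le_lt_trans (absc_triangle _ _) _; rewrite abscM.
have Xth : X <= th by rewrite -(@ler_pXn2r _ 2) ?nnegrE // hw th2; nra.
have : absc b.[w] <= th ^+ N by apply: le_trans bw _; apply: lerXn2r.
move: (absc_ge0 a) (absc_ge0 b.[w]) => A0 B0 Bth.
have : absc a * absc b.[w] <= d * th ^+ N by apply: ler_pM => //; move: aa d0; clear; lra.
by move: hN v1; clear; lra.
Qed.

End Plane.

(** * Sets that contain only o(n) zeros *)

Section Sparse.
Variable R : realType.
Local Notation C := R[i].

Lemma reachable0 (S : C -> Prop) (d : R) : 0 < d ->
  (forall v, absc v < d -> S v) -> reachable S 0.
Proof.
move=> d0 dS; exists ((d / 2)%:C *: 'X), 0, (d / 2).
have d20 : (d / 2)%:C != 0 :> C by rewrite -absc_gt0 absc_real gtr0_norm divr_gt0.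
split; rewrite ?hornerZ ?hornerX ?mulr0 ?lexx ?ltr01 //.
  by rewrite size_scale // size_polyX.
split; first by rewrite divr_gt0.
move=> w v w1; rewrite hornerZ hornerX => vw; apply: dS.
rewrite -[v](subrK ((d / 2)%:C * w)); apply: le_lt_trans (absc_triangle _ _) _.
rewrite abscM absc_real gtr0_norm; last by rewrite divr_gt0.
have := absc_ge0 w; nra.
Qed.

(** With a uniform margin d, the segment from 0 to c is walked in steps shorter than d / 4, each by
    [reachable_step]. *)
Lemma reachable_segment_margin (S : C -> Prop) (c : C) (d : R) : 0 < d ->
  (forall (t : R) v, 0 <= t <= 1 -> absc (v - t%:C * c) < d -> S v) ->
  reachable S c.
Proof.
move=> d0 dS.
pose n := (Num.trunc (absc c / (d / 4))).+1.
have n0 : 0 < n%:R :> R by rewrite ltr0n.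
have nc : absc c / n%:R < d / 4.
  rewrite ltr_pdivrMr // mulrC -ltr_pdivrMr; last by rewrite divr_gt0.
  exact: truncnS_gt.
suff H k : (k <= n)%N -> reachable S ((k%:R / n%:R)%:C * c).
  by have := H n (leqnn _); rewrite divff ?gt_eqF // mul1r.
elim: k => [|k IH] kn.
  rewrite mul0r mul0r; apply: (reachable0 d0) => v vd.
  by apply: (dS 0); rewrite ?lexx ?ler01 // mul0r subr0.
have -> : (k.+1%:R / n%:R)%:C * c = (k%:R / n%:R)%:C * c + (n%:R^-1)%:C * c.
  by rewrite -mulrDl -rmorphD -[k.+1%:R]natr1 mulrDl mul1r.
apply: (reachable_step (d := d)) => [|v|]; first exact/IH/ltnW.
  apply: dS; rewrite divr_ge0 ?ler0n //= ler_pdivrMr // mul1r ler_nat.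
  exact: ltnW.
by rewrite abscM absc_real gtr0_norm ?invr_gt0 // mulrC.
Qed.

(** Compactness of the segment turns the pointwise margins into a uniform one. *)
Lemma reachable_segment (S : C -> Prop) (c : C) :
  (forall t : R, 0 <= t <= 1 ->
    exists2 d, 0 < d & forall v, absc (v - t%:C * c) < d -> S v) ->
  reachable S c.
Proof.
move=> hS.
(* The cover is by complex centres z; clamping Re z to [0, 1] assigns to each a parameter of the
   segment without increasing distances to such parameters. *)
pose cl (x : R) : R := if x <= 0 then 0 else if x <= 1 then x else 1.
have cl01 x : 0 <= cl x <= 1.
  by rewrite /cl; case: (leP x 0) => ?; [|case: (leP x 1) => ?];
    apply/andP; split; lra.
have cl_dist t x : 0 <= t <= 1 -> `|t - cl x| <= `|t - x|.
  move=> /andP[t0 t1]; rewrite /cl; case: (leP x 0) => ?; [|case: (leP x 1) => ?].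
  - by rewrite !ger0_norm; lra.
  - by [].
  - by rewrite !ler0_norm; lra.
have /choice[d hd] (z : C) : exists d, 0 < d /\
    forall v, absc (v - (cl (complex.Re z))%:C * c) < d -> S v.
  by have [d ? ?] := hS _ (cl01 (complex.Re z)); exists d.
have k0 : 0 < 2 * (absc c + 1) by rewrite mulr_gt0 // ltr_wpDl ?absc_ge0.
have [|s hs] := @finite_cover_disc _ (fun z => d z / (2 * (absc c + 1))) 1.
  by move=> z; rewrite divr_gt0 // (hd z).1.
pose m := \big[Num.min/1]_(z <- s) d z.
have m0 : 0 < m by rewrite /m; elim/big_ind: _ => // [x y|z _]; rewrite ?lt_min ?(hd z).1 // => -> ->.
apply: (reachable_segment_margin (d := m / 2)); first by rewrite divr_gt0.
move=> t v t01 vm.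
have [|z zs tz] := hs t%:C.
  by rewrite absc_real ger0_norm; case/andP: t01.
have mz : m <= d z by rewrite /m; apply: ge_bigmin_seq.
apply: (hd z).2.
have -> : v - (cl (complex.Re z))%:C * c =
  (v - t%:C * c) + (t - cl (complex.Re z))%:C * c by rewrite rmorphB; ring.
apply: le_lt_trans (absc_triangle _ _) _; rewrite abscM absc_real.
have h1 : `|t - cl (complex.Re z)| <= absc (t%:C - z).
  by apply: le_trans (cl_dist _ _ t01) _; have := Re_le_absc (t%:C - z); rewrite ReB.
have h2 : absc (t%:C - z) * (2 * (absc c + 1)) < d z by rewrite -ltr_pdivlMr.
have := absc_ge0 c; have := absc_ge0 (t%:C - z).
have := normr_ge0 (t - cl (complex.Re z)).
have : `|t - cl (complex.Re z)| * absc c <= absc (t%:C - z) * absc c.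
  by rewrite ler_wpM2r ?absc_ge0.
lra.
Qed.

(** |P(s)| is the modulus of the leading coefficient times the distances from s to the roots. Read
    backwards: a small value at s forces a root near s. *)
Lemma far_roots (P : {poly C}) (s : C) (rho : R) : 0 <= rho ->
  (forall w, root P w -> rho <= absc (s - w)) ->
  absc (lead_coef P) * rho ^+ (size P).-1 <= absc P.[s].
Proof.
move=> rho0; have [->|P0] := eqVneq P 0.
  by rewrite lead_coef0 absc0 mul0r absc_ge0.
have [r Pr] := closed_field_poly_normal P.
have -> : (size P).-1 = size r.
  by rewrite {1}Pr size_scale ?lead_coef_eq0 // size_prod_XsubC.
move=> h; rewrite [in leRHS]Pr hornerZ abscM ler_wpM2l ?absc_ge0 //.
rewrite horner_prod absc_prod.
have {}h w : w \in r -> rho <= absc (s - w).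
  move=> wr; apply: h; rewrite Pr rootE hornerZ horner_prod.
  by rewrite (big_rem w) //= hornerXsubC subrr mul0r mulr0.
elim: (r) h => [|w r' IH] h; first by rewrite big_nil expr0.
rewrite big_cons /= exprS hornerXsubC ler_pM ?exprn_ge0 ?h ?mem_head //.
by apply: IH => v vr; apply: h; rewrite inE vr orbT.
Qed.

(** If 1 / z is close to c = p(sig), then p - 1 / z is small at sig, so by [far_roots] it has a root
    in the disc of radius tau = (1 + sig) / 2 < 1. This is a root of 1 - z p, which is 1 at 0, and
    the product of these polynomials is bounded on the unit circle because p maps it into S:
    [jensen_count] applies. *)
Lemma reachable_count (S : C -> Prop) (c : C) : reachable S c ->
  exists eta tau : R, [/\ 0 < eta, 0 < tau < 1 &
    forall (s : seq C) (M : R),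
      (forall u, S u -> absc (\prod_(z <- s) (1 - z * u)) <= M) ->
      tau^-1 ^+ count (fun z => (z != 0) && (absc (z^-1 - c) < eta)) s <= M].
Proof.
move=> [p [sig [mu [p0 sp /andP[s0 s1] ps [mu0 pS]]]]].
pose rho := (1 - sig) / 2; have rho0 : 0 < rho by rewrite /rho; lra.
have pN0 : p != 0 by rewrite -size_poly_gt0 ltnW.
exists (absc (lead_coef p) * rho ^+ (size p).-1), ((1 + sig) / 2); split.
- by rewrite mulr_gt0 ?exprn_gt0 // absc_gt0 lead_coef_eq0.
- by apply/andP; split; lra.
move=> s M hM.
apply: (@jensen_count _ _ s (fun z => 1 - z *: p)); first lra.
- by move=> z _; rewrite hornerD hornerN hornerZ p0 mulr0 subr0 hornerC.
- move=> z _ /andP[z0 zc].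
  have sz : (size (- z^-1%:P) < size p)%N.
    by rewrite size_polyN size_polyC invr_eq0 z0.
  have /existsNP[w /not_implyP[wr /negP]] :
      ~ (forall w, root (p - z^-1%:P) w -> rho <= absc (sig%:C - w)).
    move=> /(far_roots (ltW rho0)).
    rewrite size_polyDl // lead_coefDl // hornerD hornerN hornerC ps.
    by rewrite absc_distC leNgt zc.
  rewrite -ltNge => wrho; exists w.
    move: wr; rewrite /root !(hornerD, hornerN, hornerZ, hornerC).
    by rewrite subr_eq0 => /eqP ->; rewrite mulfV // subrr.
  have := absc_triangle_add w (sig%:C - w); rewrite [w + _]addrC subrK absc_real ger0_norm //.
  by move: wrho; rewrite /rho; lra.
move=> w w1; rewrite horner_prod.
under eq_bigr do rewrite hornerD hornerN hornerZ hornerC.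
by apply/hM/(pS w); rewrite ?w1 // subrr absc0.
Qed.

Definition sparse (zs : nat -> seq C) (A : C -> Prop) := forall e : R, 0 < e ->
  \forall n \near \oo, (count (fun z => `[< A z >]) (zs n))%:R <= e * n%:R.

Lemma sparse_sub zs (A B : C -> Prop) :
  (forall z, A z -> B z) -> sparse zs B -> sparse zs A.
Proof.
move=> AB hB e /hB; apply: filterS => n; apply: le_trans.
by rewrite ler_nat; apply: sub_count => z /asboolP /AB ?; apply/asboolP.
Qed.

Lemma sparse_sub_near zs (A B : C -> Prop) :
  (\forall n \near \oo, forall z, z \in zs n -> A z -> B z) ->
  sparse zs B -> sparse zs A.
Proof.
move=> AB hB e /hB; apply: filterS2 AB => n AB; apply: le_trans.
rewrite ler_nat (@eq_in_count _ _ (fun z => `[< A z /\ B z >])).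
  by apply: sub_count => z /asboolP[_ ?]; apply/asboolP.
by move=> z zn; apply/asboolP/asboolP => [Az|[]//]; split=> //; exact: AB.
Qed.

Lemma sparseU zs (A B : C -> Prop) :
  sparse zs A -> sparse zs B -> sparse zs (fun z => A z \/ B z).
Proof.
move=> hA hB e e0; have e2 : 0 < e / 2 by rewrite divr_gt0.
apply: filterS2 (hA _ e2) (hB _ e2) => n h1 h2.
rewrite [e]splitr mulrDl; apply: le_trans (lerD h1 h2).
rewrite -natrD ler_nat; rewrite -count_predUI.
apply: leq_trans (leq_addr _ _); apply: sub_count => z /asboolP[h|h].
  by apply/orP; left; apply/asboolP.
by apply/orP; right; apply/asboolP.
Qed.

Lemma sparse0 zs : sparse zs (fun=> False).
Proof.
move=> e e0; near=> n; rewrite (@eq_count _ _ pred0) ?count_pred0.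
  by rewrite mulr_ge0 // ltW.
by move=> z /=; apply/asboolP.
Unshelve. all: by end_near. Qed.

Lemma sparse_bigU zs (s : seq C) (A : C -> C -> Prop) :
  (forall c, c \in s -> sparse zs (A c)) ->
  sparse zs (fun z => exists2 c, c \in s & A c z).
Proof.
elim: s => [|c s IH] h.
  by apply: (sparse_sub _ (sparse0 zs)) => z [].
apply: (@sparse_sub _ _ (fun z => A c z \/ exists2 c, c \in s & A c z)).
  move=> z [c']; rewrite inE => /orP[/eqP ->|cs Az]; first by left.
  by right; exists c'.
apply: sparseU; first by apply: h; rewrite mem_head.
by apply: IH => c' cs; apply: h; rewrite inE cs orbT.
Qed.

Definition subexp_on (S : C -> Prop) (zs : nat -> seq C) := forall d : R, 0 < d ->
  \forall n \near \oo, forall u, S u ->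
    absc (\prod_(z <- zs n) (1 - z * u)) <= expR (d * n%:R).

(** With the growth rate e ln (1 / tau), the inequality tau^(-count) <= exp (e ln (1 / tau) n) says
    count <= e n. *)
Lemma sparse_near_reachable (S : C -> Prop) (zs : nat -> seq C) (c : C) :
  subexp_on S zs -> reachable S c ->
  exists2 eta : R, 0 < eta & sparse zs (fun z => z != 0 /\ absc (z^-1 - c) < eta).
Proof.
move=> hS /reachable_count[eta [tau [eta0 /andP[tau0 tau1] hc]]].
exists eta => // e e0.
have lt0 : 0 < ln tau^-1 by rewrite ln_gt0 // invf_gt1.
have [] := hS _ (mulr_gt0 e0 lt0) => N _ HN; exists N => // n /HN {}HN.
have := hc _ _ HN.
have -> : tau^-1 = expR (ln tau^-1) by rewrite lnK // posrE invr_gt0.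
rewrite -expRM_natr ler_expR expRK mulrC -mulrA [_ * n%:R]mulrC mulrA ler_pM2r //.
apply: le_trans; rewrite ler_nat; apply: sub_count => z /asboolP[z0 zc].
by rewrite /= z0 zc.
Qed.

(** K is bounded and its complement is open; finitely many neighbourhoods, each free of K or
    containing few inverses of zeros, cover it. *)
Lemma sparse_compact (S K : C -> Prop) (zs : nat -> seq C) (B : R) :
  subexp_on S zs ->
  (forall u, K u -> absc u <= B) ->
  (forall c, ~ K c -> exists2 d, 0 < d & forall v, absc (v - c) < d -> ~ K v) ->
  (forall c, K c -> reachable S c) ->
  sparse zs (fun z => z != 0 /\ K z^-1).
Proof.
move=> hS KB Kc KS.
have /choice[eta heta] (c : C) : exists eta, 0 < eta /\
    sparse zs (fun z => (z != 0 /\ absc (z^-1 - c) < eta) /\ K z^-1).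
  have [/KS h|/Kc[d d0 hd]] := pselect (K c).
    have [eta eta0 h'] := sparse_near_reachable hS h; exists eta; split => //.
    by apply: sparse_sub h' => z [].
  exists d; split => //; apply: (sparse_sub _ (sparse0 zs)) => z [[_ zd]].
  exact: hd.
have [s hs] := @finite_cover_disc _ eta B (fun c => (heta c).1).
apply: sparse_sub (sparse_bigU (fun c (_ : c \in s) => (heta c).2)) => z [z0 Kz].
by have [c cs cz] := hs _ (KB _ Kz); exists c.
Qed.

End Sparse.

(** * The map phi and the exterior domain *)

Section Domain.
Variable R : realType.
Local Notation C := R[i].

Lemma mvt_eq (f df : R -> R) (a b : R) : a <= b ->
  (forall x, a <= x <= b -> is_derive x 1 f (df x)) ->
  exists2 c, a <= c <= b & f b - f a = df c * (b - a).
Proof.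
move=> ab fd; have [||c cab E] := @MVT_segment _ f df a b ab.
- move=> x; rewrite in_itv /= => /andP[/ltW ax /ltW xb].
  by apply: fd; rewrite ax.
- apply: derivable_within_continuous => x xab.
  have := fd x; rewrite in_itv /= in xab => /(_ xab) h.
  exact: ex_derive.
by exists c.
Qed.

Lemma sin_le_id (t : R) : `|sin t| <= `|t|.
Proof.
wlog t0 : t / 0 <= t.
  move=> H; have [/H//|/ltW t0] := leP 0 t.
  by have := H (- t); rewrite oppr_ge0 sinN !normrN => /(_ t0).
have [c _ E] := mvt_eq t0 (fun x _ => is_derive_sin x).
move: E; rewrite sin0 !subr0 => ->; rewrite normrM.
by rewrite -[leRHS]mul1r ler_wpM2r // cos_max.
Qed.

Lemma cos_ge_quad (t : R) : 1 - t ^+ 2 / 2 <= cos t.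
Proof.
have h := sin_le_id (t / 2).
have : sin (t / 2) ^+ 2 <= (t / 2) ^+ 2.
  by rewrite -(real_normK (num_real (sin _))) -(real_normK (num_real (t / 2))) lerXn2r ?nnegrE.
have := cosD (t / 2) (t / 2); rewrite -splitr => ->.
have := cos2Dsin2 (t / 2); nra.
Qed.

Lemma sin_sub_id (t : R) : `|t| <= 1 -> `|sin t - t| <= t ^+ 2.
Proof.
wlog t0 : t / 0 <= t.
  move=> H; have [/H//|/ltW t0 t1] := leP 0 t.
  by have := H (- t); rewrite oppr_ge0 sinN -opprD !normrN sqrrN => /(_ t0 t1).
rewrite (ger0_norm t0) => t1.
have [c /andP[c0 ct]] := mvt_eq t0 (fun x _ => is_derive_sin x).
rewrite sin0 !subr0 => ->; have := cos_ge_quad c; have := cos_le1 c => h1 h2.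
have -> : cos c * t - t = - ((1 - cos c) * t) by ring.
rewrite normrN ger0_norm; last by rewrite mulr_ge0 // subr_ge0.
have : c ^+ 2 <= t ^+ 2 by rewrite lerXn2r ?nnegrE.
nra.
Qed.

(** Squaring exp (- x / 2) >= 1 - x / 2 gives exp x (1 - x / 2)^2 <= 1, while (1 + x + 2 x^2) (1 - x
    / 2)^2 >= 1 for x <= 1. *)
Lemma expR_sub_quad (x : R) : x <= 1 -> 0 <= expR x - 1 - x <= 2 * x ^+ 2.
Proof.
move=> x1; apply/andP; split; first by have := expR_ge1Dx x; lra.
have := expR_ge1Dx (- x / 2).
have E : expR (- x / 2) ^+ 2 * expR x = 1.
  by rewrite -expRM_natr -expRD -[RHS]expR0; congr expR; field.
move=> h; suff : expR x * (1 - x / 2) ^+ 2 <= 1.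
  have := expR_gt0 x; move: (expR x) => y y0 h1.
  have : 1 <= (1 + x + 2 * x ^+ 2) * (1 - x / 2) ^+ 2.
    have : 0 <= x ^+ 2 * ((1 - x) * (5 / 2 - x)).
      by rewrite mulr_ge0 ?sqr_ge0 // mulr_ge0; lra.
    lra.
  have : 0 < (1 - x / 2) ^+ 2 by rewrite exprn_gt0 //; lra.
  move: ((1 - x / 2) ^+ 2) h1 => w h1 w0 h2.
  have : y * w <= (1 + x + 2 * x ^+ 2) * w by lra.
  rewrite ler_pM2r //; lra.
rewrite -[leRHS]E mulrC ler_pM2r ?expR_gt0 // lerXn2r ?nnegrE ?expR_ge0 //; lra.
Qed.

Lemma cexp_sub_quad (h : C) : absc h <= 1 -> absc (cexp h - 1 - h) <= 5 * absc h ^+ 2.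
Proof.
rewrite absc_sqr => h1; apply: le_trans (absc_le_ReIm _) _.
move: (Im_le_absc h) (Re_le_absc h).
case: h h1 => x y /= h1 /le_trans/(_ h1) y1 /le_trans/(_ h1) x1.
have /andP[e1 e2] : 0 <= expR x - 1 - x <= 2 * x ^+ 2.
  by apply: expR_sub_quad; apply: le_trans x1; exact: ler_norm.
have s1 := sin_sub_id y1; have s2 := sin_le_id y.
have c1 := cos_ge_quad y; have c2 := cos_le1 y.
have xx : x ^+ 2 = `|x| ^+ 2 by rewrite real_normK ?num_real.
have yy : y ^+ 2 = `|y| ^+ 2 by rewrite real_normK ?num_real.
have x0 := normr_ge0 x; have y0 := normr_ge0 y.
have xn := ler_norm x.
have ex : expR x <= 4 by nra.
have e0 := expR_ge0 x.
have -> : expR x * cos y - 0 * sin y - 1 - x = (expR x - 1 - x) - expR x * (1 - cos y) by ring.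
have -> : expR x * sin y + 0 * cos y - 0 - y = (expR x - 1) * sin y + (sin y - y) by ring.
have n1 : `|expR x - 1 - x - expR x * (1 - cos y)| <= 2 * x ^+ 2 + 4 * (y ^+ 2 / 2).
  apply: le_trans (ler_normB _ _) _; apply: lerD; first by rewrite ger0_norm.
  rewrite normrM (ger0_norm e0) ler_pM ?normr_ge0 //.
  by rewrite ger0_norm; lra.
have n2 : `|expR x - 1| <= 3 * `|x|.
  have -> : expR x - 1 = (expR x - 1 - x) + x by ring.
  apply: le_trans (ler_normD _ _) _; rewrite ger0_norm //; nra.
have n3 : `|(expR x - 1) * sin y + (sin y - y)| <= 3 * `|x| * `|y| + y ^+ 2.
  apply: le_trans (ler_normD _ _) _; apply: lerD => //.
  by rewrite normrM ler_pM.
apply: le_trans (lerD n1 n3) _.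
rewrite xx yy; nra.
Qed.

Lemma ccont_cexp (c : C) : ccont_at (@cexp R) c.
Proof.
move=> e e0; have k0 : 0 < absc (cexp c) by rewrite absc_cexp expR_gt0.
exists (Num.min 1 (e / (6 * absc (cexp c)))).
  by rewrite lt_min ltr01 divr_gt0 // mulr_gt0.
move=> z; rewrite lt_min ltr_pdivlMr ?mulr_gt0 // => /andP[z1 ze].
have -> : cexp z - cexp c = cexp c * (cexp (z - c) - 1).
  by rewrite mulrBr mulr1 -cexpD [c + _]addrC subrK.
have := cexp_sub_quad (ltW z1); rewrite abscM.
have : absc (cexp (z - c) - 1) <= absc (cexp (z - c) - 1 - (z - c)) + absc (z - c).
  by rewrite -[in leLHS](subrK (z - c) (cexp (z - c) - 1)) absc_triangle.
have := absc_ge0 (z - c); nra.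
Qed.

Definition phi (z : C) : C := z * cexp (1 - z).

Lemma absc_phi z : absc (phi z) = absc z * expR (1 - complex.Re z).
Proof. by rewrite abscM absc_cexp ReB. Qed.

Lemma ccont_phi (c : C) : ccont_at phi c.
Proof.
apply: ccontM; first exact: ccont_id.
apply: ccont_comp; first exact: ccont_cexp.
apply: ccontD; first exact: ccont_cst.
apply: (eq_ccont (fun z => mulN1r z)).
by apply: ccontM; [exact: ccont_cst|exact: ccont_id].
Qed.

Lemma ccont_absc_real (F : C -> C) c : ccont_at F c ->
  forall e, 0 < e -> exists2 d, 0 < d &
  forall z, absc (z - c) < d -> `|absc (F z) - absc (F c)| < e.
Proof.
move=> h e /h[d d0 hd]; exists d => // z /hd; apply: le_lt_trans.
rewrite ler_norml absc_triangle_sub andbT lerNl opprB absc_distC.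
exact: absc_triangle_sub.
Qed.

(* The domain of the variable u = 1 / z outside the curve Gamma r; the second  *)
(* alternative is only meant for nonzero u, which holds when absc u >= 1.      *)
Definition outer (r : R) (u : C) : Prop :=
  absc u < 1 \/ expR (- r) < absc (phi u^-1).

(** Along a ray, the derivative of log |phi (l z)| in l is 1 / l - Re z, which is nonnegative as
    long as l z stays in the unit disc. *)
Lemma absc_phi_ray (z : C) (l : R) : 1 <= l -> l * absc z <= 1 ->
  absc (phi z) <= absc (phi (l%:C * z)).
Proof.
move=> l1 lz; have l0 : 0 < l by lra.
rewrite !absc_phi Re_realM abscM absc_real gtr0_norm // [l * _]mulrC -mulrA.
rewrite ler_wpM2l ?absc_ge0 //.
suff : expR ((l - 1) * complex.Re z) <= l.
  move=> /(ler_wpM2r (expR_ge0 (1 - l * complex.Re z))); rewrite -expRD mulrC.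
  by apply: le_trans; rewrite ler_expR; lra.
have := expR_ge1Dx (- ((l - 1) * complex.Re z)).
rewrite expRN; have := expR_gt0 ((l - 1) * complex.Re z).
move: (expR _) => y y0 h.
have := Re_leif_absc z => hz.
have h1 : l^-1 <= y^-1.
  apply: le_trans h; rewrite -(ler_pM2l l0) divff ?gt_eqF //.
  have : 0 <= (l - 1) * (1 - l * complex.Re z).
    by rewrite mulr_ge0 ?subr_ge0 // (le_trans _ lz) // ler_pM2l.
  lra.
by move: h1; rewrite lef_pV2 ?posrE.
Qed.

Lemma outer_open (r : R) (c : C) : outer r c ->
  exists2 d, 0 < d & forall v, absc (v - c) < d -> outer r v.
Proof.
have [c1 _|c1 [|h]] := ltP (absc c) 1; last 2 first.
- by rewrite ltNge c1.
- have c0 : c != 0 by rewrite -absc_gt0; lra.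
  have [|d d0 hd] := ccont_absc_real (ccont_comp (@ccont_phi _) (ccont_inv c0))
    (e := absc (phi c^-1) - expR (- r)); first by rewrite subr_gt0.
  exists d => // v /hd; rewrite ltr_distl => /andP[h1 _]; right; lra.
exists (1 - absc c); first by rewrite subr_gt0.
move=> v vc; left; rewrite -[v](subrK c); apply: le_lt_trans (absc_triangle _ _) _.
lra.
Qed.

(** Shrinking u moves 1 / u outwards along its ray, so [absc_phi_ray] applies until |u| < 1. *)
Lemma outer_star (r : R) (c : C) (t : R) : outer r c -> 0 <= t <= 1 ->
  outer r (t%:C * c).
Proof.
move=> oc /andP[t0 t1].
have at' : absc (t%:C * c) = t * absc c by rewrite abscM absc_real ger0_norm.
have [h|h] := ltP (absc (t%:C * c)) 1; first by left.
right; case: oc => [c1|].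
  by exfalso; have := absc_ge0 c; move: h; rewrite at'; nra.
move=> /lt_le_trans; apply.
have tp : 0 < t by rewrite lt_def t0 andbT; apply/eqP => tz; move: h; rewrite at' tz; lra.
rewrite invfM -fmorphV; apply: absc_phi_ray; first by rewrite invf_ge1.
by rewrite abscV -invfM -at' invf_le1 // at'; lra.
Qed.

Lemma outer_reachable (r : R) (c : C) : outer r c -> reachable (outer r) c.
Proof.
by move=> oc; apply: reachable_segment => t t01; exact/outer_open/outer_star.
Qed.

Lemma sparse_outer (r : R) (zs : nat -> seq C) (d : R) : 0 <= r ->
  subexp_on (outer r) zs -> 0 < d ->
  sparse zs (fun z => z != 0 /\
    (1 + d <= absc z \/ expR (- r + d) <= absc (phi z))).
Proof.
move=> r0 hS d0.
(* The exceptional zeros in the variable u = 1 / z, as a compact set. Its radius comes from |phi z|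
   <= |z| e^2 on the unit disc, so that |phi z| >= exp (- r + d) bounds 1 / |z| by exp (r + 2). *)
pose K (u : C) := absc u <= expR (r + 2) /\
  (absc u <= (1 + d)^-1 \/ expR (- r + d) <= absc (phi u^-1)).
have d1 : 0 < 1 + d by lra.
have B1 : 1 <= expR (r + 2) by have := expR_ge1Dx (r + 2); lra.
apply: (@sparse_sub _ _ _ (fun z => z != 0 /\ K z^-1)).
  move=> z [z0 h]; split => //; rewrite /K invrK abscV; split; last first.
    case: h => [h|]; last by right.
    by left; rewrite lef_pV2 // posrE // absc_gt0.
  have az : 0 < absc z by rewrite absc_gt0.
  case: h => h.
    apply: le_trans B1; rewrite invf_le1 //; lra.
  have [z1|z1] := leP 1 (absc z); first by apply: le_trans B1; rewrite invf_le1.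
  rewrite -[expR _]invrK lef_pV2 ?posrE ?invr_gt0 ?expR_gt0 // -expRN.
  move: h; rewrite absc_phi -[leRHS]mulr1.
  have E : 1 = expR (1 - complex.Re z) * expR (- (1 - complex.Re z)) :> R by rewrite -expRD subrr expR0.
  rewrite -(ler_pM2r (expR_gt0 (- (1 - complex.Re z)))) mulr1 -mulrA -E mulr1 -expRD.
  apply: le_trans; rewrite ler_expR.
  have := Re_le_absc z; rewrite ler_norml => /andP[]; lra.
apply: (sparse_compact hS (B := expR (r + 2))).
- by move=> u [].
- move=> c; have [cB Kc|cB _] := leP (absc c) (expR (r + 2)); last first.
    exists (absc c - expR (r + 2)); first by rewrite subr_gt0.
    move=> v vc [vB _]; have := absc_triangle_sub c v; rewrite absc_distC; lra.
  have c1 : (1 + d)^-1 < absc c by rewrite ltNge; apply/negP => h; apply: Kc; split => //; left.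
  have c2 : absc (phi c^-1) < expR (- r + d).
    by rewrite ltNge; apply/negP => h; apply: Kc; split => //; right.
  have c0 : c != 0 by rewrite -absc_gt0; apply: lt_trans c1; rewrite invr_gt0.
  have [|e e0 he] := ccont_absc_real (ccont_comp (@ccont_phi _) (ccont_inv c0))
    (e := expR (- r + d) - absc (phi c^-1)); first by rewrite subr_gt0.
  exists (Num.min e (absc c - (1 + d)^-1)); first by rewrite lt_min e0 subr_gt0.
  move=> v; rewrite lt_min => /andP[/he]; rewrite ltr_distl => /andP[_ h1] h2 [_ [|]].
    by have := absc_triangle_sub c v; rewrite absc_distC; lra.
  lra.
move=> c [_ h]; apply: outer_reachable; case: h => h.
  by left; apply: le_lt_trans h _; rewrite invf_lt1 //; lra.
by right; apply: lt_le_trans h; rewrite ltr_expR; lra.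
Qed.

(** On d <= |z| <= 2 one has |phi z| >= d / e, and this exceeds exp (- s + 1) for s large; the zeros
    with |z| >= 2 fall under the other alternative of [sparse_outer]. *)
Lemma sparse_outer_all (zs : nat -> seq C) (d : R) :
  (forall s, 0 <= s -> subexp_on (outer s) zs) -> 0 < d ->
  sparse zs (fun z => d <= absc z).
Proof.
move=> hS d0.
have [s s0 hs] : exists2 s : R, 0 <= s & expR (- s + 1) <= d * expR (-1).
  exists (Num.max 0 (2 - ln d)); first by rewrite le_max lexx.
  rewrite -[d in leRHS]lnK ?posrE // -expRD ler_expR.
  have : 2 - ln d <= Num.max 0 (2 - ln d) by rewrite le_max lexx orbT.
  by move: (Num.max _ _) => m; lra.
apply: sparse_sub (sparse_outer s0 (hS _ s0) ltr01) => z dz.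
have az : 0 < absc z by lra.
split; first by rewrite -absc_gt0.
have [z1|z1] := leP (1 + 1) (absc z); [by left|right].
rewrite absc_phi; apply: le_trans hs _; apply: ler_pM; rewrite ?expR_ge0 ?(ltW d0) //.
by rewrite ler_expR; have := Re_leif_absc z; lra.
Qed.

End Domain.
(** * Beta multipliers and truncated exponentials *)

Section Rising.
Variable R : realType.
Local Notation C := R[i].
Implicit Types A B : R.

Definition rising A k : R := \prod_(i < k) (A + i%:R).

Lemma rising0 A : rising A 0 = 1. Proof. by rewrite /rising big_ord0. Qed.

Lemma risingS A k : rising A k.+1 = rising A k * (A + k%:R).
Proof. by rewrite /rising big_ord_recr. Qed.

Lemma rising_rec A k : rising A k.+1 = A * rising (A + 1) k.
Proof.
rewrite /rising big_ord_recl addr0; congr (_ * _); apply: eq_bigr => i _.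
by rewrite /= /bump /= natrD addrA.
Qed.

Lemma rising_ge0 A k : 0 <= A -> 0 <= rising A k.
Proof. by move=> A0; apply: prodr_ge0 => i _; rewrite addr_ge0. Qed.

Lemma rising_gt0 A k : 0 < A -> 0 < rising A k.
Proof. by move=> A0; apply: prodr_gt0 => i _; rewrite ltr_wpDr. Qed.

Lemma risingD A j k : rising A (j + k) = rising A j * rising (A + j%:R) k.
Proof.
elim: k => [|k IH]; first by rewrite addn0 rising0 mulr1.
by rewrite addnS !risingS IH natrD addrA mulrA.
Qed.

(** The coefficient of x^k in (1 - x)^(- A). *)
Definition risingf A k : R := rising A k / k`!%:R.

Lemma natrf_neq0 k : k`!%:R != 0 :> R.
Proof. by rewrite pnatr_eq0 -lt0n fact_gt0. Qed.

Lemma risingf0 A : risingf A 0 = 1.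
Proof. by rewrite /risingf rising0 fact0 divr1. Qed.

Lemma risingfS A k : k.+1%:R * risingf A k.+1 = (A + k%:R) * risingf A k.
Proof.
rewrite /risingf risingS factS natrM; field.
by rewrite natrf_neq0 /= addrC natr1 pnatr_eq0.
Qed.

Lemma risingf_shift A k : k.+1%:R * risingf A k.+1 = A * risingf (A + 1) k.
Proof.
rewrite /risingf rising_rec factS natrM; field.
by rewrite natrf_neq0 /= addrC natr1 pnatr_eq0.
Qed.

(** Chu-Vandermonde, the coefficient identity of (1 - x)^(- A) (1 - x)^(- B) = (1 - x)^(- A - B).
    The induction multiplies by N + 1 and splits it as i + (N + 1 - i) under the sum, which is
    differentiation of the product. *)
Lemma risingf_vandermonde A B N :
  \sum_(i < N.+1) risingf A i * risingf B (N - i) = risingf (A + B) N.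
Proof.
elim: N => [|N IH].
  by rewrite big_ord1 subn0 !risingf0 mulr1.
have N0 : N.+1%:R != 0 :> R by rewrite pnatr_eq0.
apply: (mulfI N0); rewrite risingfS -IH mulr_sumr.
transitivity (\sum_(i < N.+2) (i%:R * risingf A i) * risingf B (N.+1 - i) +
    \sum_(i < N.+2) risingf A i * ((N.+1 - i)%:R * risingf B (N.+1 - i))).
  rewrite -big_split /=; apply: eq_bigr => i _.
  have -> : N.+1%:R = i%:R + (N.+1 - i)%:R :> R.
    by rewrite -natrD subnKC // -ltnS.
  ring.
rewrite big_ord_recl mul0r mul0r add0r [X in _ + X]big_ord_recr /= subnn mul0r mulr0 addr0.
rewrite -big_split mulr_sumr /=; apply: eq_bigr => i _.
have iN : (i <= N)%N by rewrite -ltnS.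
rewrite /bump /= add1n subSS subSn // !risingfS.
have -> : N%:R = i%:R + (N - i)%:R :> R by rewrite -natrD subnKC.
by ring.
Qed.

(** Unnormalized factorial moments of the beta-binomial distribution. By [risingf_shift] each factor
    of the falling factorial raises A by one and lowers N by one. *)
Lemma risingf_moment A B N k : (k <= N)%N ->
  \sum_(i < N.+1) risingf A i * risingf B (N - i) * (i ^_ k)%:R =
  rising A k * risingf (A + k%:R + B) (N - k).
Proof.
elim: k N A => [|k IH] N A kN.
  rewrite rising0 mul1r addr0 subn0 -risingf_vandermonde.
  by apply: eq_bigr => i _; rewrite ffactn0 mulr1.
case: N kN => // N kN; rewrite big_ord_recl ffact0n mulr0 add0r.
rewrite rising_rec -mulrA subSS.
have -> : A + k.+1%:R + B = A + 1 + k%:R + B by rewrite -natr1; ring.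
rewrite -IH // mulr_sumr; apply: eq_bigr => i _.
rewrite lift0 subSS ffactSS natrM.
have := risingf_shift A i.
move: (risingf A i.+1) (risingf B (N - i)) => x y E.
have -> : x * y * (i.+1%:R * (i ^_ k)%:R) = (i.+1%:R * x) * y * (i ^_ k)%:R by ring.
by rewrite E !mulrA.
Qed.

(** The factors are exchanged one at a time: (i - k) / (N - k) differs from i / N by at most k / (N
    - k). *)
Lemma ffact_ratio (i N k : nat) : (i <= N)%N -> (k < N)%N ->
  `|(i ^_ k)%:R / (N ^_ k)%:R - (i%:R / N%:R) ^+ k| <= (k ^ 2)%:R / (N - k)%:R :> R.
Proof.
move=> iN; elim: k => [|k IH] kN.
  by rewrite !ffactn0 divr1 expr0 subrr normr0 divr_ge0.
have {}IH := IH (ltnW kN).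
have Nk : 0 < (N - k)%:R :> R by rewrite ltr0n subn_gt0 ltnW.
have Nk1 : 0 < (N - k.+1)%:R :> R by rewrite ltr0n subn_gt0.
have N0 : 0 < N%:R :> R by rewrite ltr0n (leq_ltn_trans _ kN).
rewrite !ffactnSr [((i ^_ k) * _)%:R]natrM [((N ^_ k) * _)%:R]natrM exprSr.
set a := (i ^_ k)%:R / (N ^_ k)%:R in IH *; set b := (i%:R / N%:R) ^+ k in IH *.
have -> : (i ^_ k)%:R * (i - k)%:R / ((N ^_ k)%:R * (N - k)%:R) = a * ((i - k)%:R / (N - k)%:R).
  by rewrite /a invfM; ring.
have a1 : `|(i - k)%:R / (N - k)%:R| <= 1 :> R.
  by rewrite ger0_norm ?divr_ge0 // ler_pdivrMr // mul1r ler_nat leq_sub2r.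
have b1 : `|b| <= 1.
  rewrite ger0_norm ?exprn_ge0 ?divr_ge0 // exprn_ile1 ?divr_ge0 //.
  by rewrite ler_pdivrMr // mul1r ler_nat.
have d1 : `|(i - k)%:R / (N - k)%:R - i%:R / N%:R| <= k%:R / (N - k)%:R :> R.
  have [ki|ki] := leqP k i.
    rewrite !natrB //; last exact: ltnW (ltnW kN).
    rewrite natrB in Nk; last exact: ltnW (ltnW kN).
    have -> : (i%:R - k%:R) / (N%:R - k%:R) - i%:R / N%:R =
        - (k%:R / (N%:R - k%:R) * (1 - i%:R / N%:R)) :> R.
      by field; rewrite !gt_eqF.
    rewrite normrN normrM ger0_norm ?divr_ge0 ?(ltW Nk) //.
    rewrite -[leRHS]mulr1 ler_wpM2l ?divr_ge0 ?(ltW Nk) // ger0_norm.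
      by rewrite gerBl divr_ge0.
    by rewrite subr_ge0 ler_pdivrMr // mul1r ler_nat.
  have -> : (i - k)%N = 0%N by apply/eqP; rewrite subn_eq0 ltnW.
  rewrite mul0r sub0r normrN ger0_norm ?divr_ge0 //.
  by apply: ler_pM; rewrite ?ler_nat ?(ltnW ki) // lef_pV2 ?posrE // ler_nat leq_subr.
have -> : a * ((i - k)%:R / (N - k)%:R) - b * (i%:R / N%:R) =
  (a - b) * ((i - k)%:R / (N - k)%:R) + b * ((i - k)%:R / (N - k)%:R - i%:R / N%:R).
  by ring.
apply: le_trans (ler_normD _ _) _; rewrite ![`|_ * _|]normrM.
apply: (@le_trans _ _ ((k ^ 2)%:R / (N - k)%:R + k%:R / (N - k)%:R)).
  apply: lerD.
    by rewrite -[leRHS]mulr1 -normrM; apply: ler_pM.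
  by rewrite -[leRHS]mul1r; apply: ler_pM.
rewrite -mulrDl -natrD; apply: ler_pM; rewrite ?invr_ge0 //.
  by rewrite ler_nat; lia.
by rewrite lef_pV2 ?posrE // ler_nat; lia.
Qed.

(* The numbers rising A k / rising (A + B) k are the moments of the beta       *)
(* distribution; here they appear as limits of the factorial moments of the    *)
(* beta-binomial distributions.                                                *)
Lemma beta_multiplier A B (K : nat) (y : nat -> C) (S : R) : 0 < A -> 0 <= B ->
  (forall s : R, 0 <= s <= 1 -> absc (\sum_(k < K) y k * (s ^+ k)%:C) <= S) ->
  absc (\sum_(k < K) (rising A k / rising (A + B) k)%:C * y k) <= S.
Proof.
move=> A0 B0 hS; have AB0 : 0 < A + B by lra.
pose Y : R := \sum_(k < K) absc (y k).
have Y0 : 0 <= Y by apply: sumr_ge0 => k _; exact: absc_ge0.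
apply/ler_addgt0Pr => e e0.
(* Chosen so that the error K^2 / (N - K) from [ffact_ratio], weighted by Y, is at most e. *)
pose N := (K + (Num.trunc ((K ^ 2)%:R * Y / e)).+1)%N.
have KN : (K < N)%N by rewrite /N -[ltnLHS]addn0 ltn_add2l.
have NK : (K ^ 2)%:R * Y <= e * (N - K)%:R.
  by rewrite -ler_pdivrMl // mulrC /N addKn ltW // truncnS_gt.
have N0 : 0 < N%:R :> R by rewrite ltr0n (leq_ltn_trans _ KN).
pose P := risingf (A + B) N.
have P0 : 0 < P by rewrite divr_gt0 ?rising_gt0 // ltr0n fact_gt0.
(* Beta-binomial probabilities on {0, ..., N}. Their normalized factorial moments equal the
   multipliers exactly ([wk]), so the sum is a convex combination of nearly the values of the
   hypothesis at s = i / N. *)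
pose w (i : 'I_N.+1) := risingf A i * risingf B (N - i) / P.
have w0 i : 0 <= w i.
  by rewrite divr_ge0 ?(ltW P0) // mulr_ge0 // divr_ge0 ?rising_ge0 // ltW.
have w1 : \sum_i w i = 1 by rewrite -mulr_suml risingf_vandermonde divff ?gt_eqF.
have wk (k : 'I_K) : \sum_(i < N.+1) w i * ((i ^_ k)%:R / (N ^_ k)%:R) = rising A k / rising (A + B) k.
  have kN : (k <= N)%N by apply: ltnW; apply: ltn_trans KN.
  transitivity ((\sum_(i < N.+1) risingf A i * risingf B (N - i) * (i ^_ k)%:R) / (P * (N ^_ k)%:R)).
    by rewrite mulr_suml; apply: eq_bigr => i _; rewrite invfM mulrACA.
  rewrite risingf_moment // /P /risingf -addrA [k%:R + B]addrC addrA.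
  have -> : rising (A + B) N = rising (A + B) k * rising (A + B + k%:R) (N - k).
    by rewrite -risingD subnKC.
  rewrite -(ffact_fact kN) natrM.
  have h1 : rising (A + B) k != 0 by rewrite gt_eqF // rising_gt0.
  have h2 : rising (A + B + k%:R) (N - k) != 0 by rewrite gt_eqF // rising_gt0 // ltr_wpDr.
  have h3 : (N - k)`!%:R != 0 :> R by exact: natrf_neq0.
  have h4 : (N ^_ k)%:R != 0 :> R by rewrite pnatr_eq0 -lt0n ffact_gt0.
  by field; rewrite h1 h2 h3 h4.
have -> : \sum_(k < K) (rising A k / rising (A + B) k)%:C * y k =
  \sum_(i < N.+1) (w i)%:C * (\sum_(k < K) ((i ^_ k)%:R / (N ^_ k)%:R)%:C * y k).
  under [RHS]eq_bigr do rewrite mulr_sumr.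
  rewrite exchange_big /=; apply: eq_bigr => k _.
  rewrite -wk rmorph_sum mulr_suml; apply: eq_bigr => i _.
  by rewrite mulrA rmorphM.
apply: le_trans (absc_sum _ _ _) _.
have -> : S + e = \sum_(i < N.+1) w i * (S + e) by rewrite -mulr_suml w1 mul1r.
apply: ler_sum => i _.
rewrite abscM absc_real ger0_norm // ler_wpM2l //.
have iN : (i <= N)%N by rewrite -ltnS.
rewrite [X in absc X](_ : _ = \sum_(k < K) y k * ((i%:R / N%:R : R) ^+ k)%:C +
  \sum_(k < K) ((i ^_ k)%:R / (N ^_ k)%:R - (i%:R / N%:R) ^+ k)%:C * y k); last first.
  by rewrite -big_split; apply: eq_bigr => k _ /=; rewrite rmorphB /=; ring.
apply: le_trans (absc_triangle _ _) _; apply: lerD.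
  by apply: hS; rewrite divr_ge0 //= ler_pdivrMr // mul1r ler_nat.
apply: le_trans (absc_sum _ _ _) _.
apply: (@le_trans _ _ ((K ^ 2)%:R / (N - K)%:R * Y)); last first.
  by rewrite mulrAC ler_pdivrMr // ltr0n subn_gt0.
rewrite mulr_sumr; apply: ler_sum => k _; rewrite abscM absc_real.
rewrite ler_wpM2r ?absc_ge0 //.
apply: le_trans (ffact_ratio iN (ltn_trans (ltn_ord k) KN)) _.
apply: ler_pM; rewrite ?invr_ge0 //.
  by rewrite ler_nat leq_sqr ltnW.
rewrite lef_pV2 ?posrE ?ltr0n ?subn_gt0 //; last exact: ltn_trans KN.
by rewrite ler_nat leq_sub2l // ltnW.
Qed.

End Rising.

(** * Truncated exponential sums *)

Section ExpSum.
Variable R : realType.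
Local Notation C := R[i].

(** An upper Stirling bound. The induction step is e m^(m + 1) <= (m + 1)^(m + 1), from 1 - 1 / (m +
    1) <= exp (- 1 / (m + 1)). *)
Lemma fact_exp_le (n : nat) : (0 < n)%N ->
  n`!%:R * expR n%:R <= expR 1 * n%:R * n%:R ^+ n :> R.
Proof.
elim: n => // -[_ _|n IH _]; first by rewrite (_ : 1`! = 1%N) // !mulr1n expr1n !mulr1 mul1r.
have {}IH := IH isT; set m := n.+1 in IH *.
have m0 : 0 < m%:R :> R by rewrite ltr0n.
have m1 : 0 < m.+1%:R :> R by rewrite ltr0n.
have hm : expR 1 * m%:R ^+ m.+1 <= m.+1%:R ^+ m.+1 :> R.
  have : (m%:R / m.+1%:R) ^+ m.+1 <= expR (- 1) :> R.
    have -> : m%:R / m.+1%:R = 1 + (- m.+1%:R^-1) :> R.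
      by rewrite -[m.+1%:R]natr1; field; rewrite natr1 gt_eqF.
    have -> : -1 = (- m.+1%:R^-1) * m.+1%:R :> R by rewrite mulNr mulVf ?gt_eqF.
    rewrite expRM_natr; apply: lerXn2r; rewrite ?nnegrE ?expR_ge0 ?expR_ge1Dx //.
    by rewrite subr_ge0 invf_le1 // ler1n.
  rewrite expr_div_n ler_pdivrMr ?exprn_gt0 // expRN => h.
  by rewrite -ler_pdivlMl ?expR_gt0.
have E : expR m.+1%:R = expR m%:R * expR 1 :> R by rewrite -expRD natr1.
rewrite factS natrM E.
have h1 : m.+1%:R * expR 1 * (m`!%:R * expR m%:R) <= m.+1%:R * expR 1 * (expR 1 * m%:R * m%:R ^+ m) :> R.
  by rewrite ler_wpM2l // mulr_ge0 ?expR_ge0.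
have h2 : m.+1%:R * expR 1 * (expR 1 * m%:R ^+ m.+1) <= m.+1%:R * expR 1 * m.+1%:R ^+ m.+1 :> R.
  by rewrite ler_wpM2l // mulr_ge0 ?expR_ge0.
rewrite exprS in h2.
by move: h1 h2; move: (m.+1%:R ^+ m.+1) => x; lra.
Qed.

(** Since r <= n, the term of degree n + J + 1 multiplied by n + 1 is at most n times the preceding
    term. The induction keeps n times the last term as a reserve. *)
Lemma exp_tail_le (n J : nat) (r : R) : 0 <= r <= n%:R ->
  \sum_(k < J) r ^+ (n.+1 + k) / (n.+1 + k)`!%:R <= n%:R * (r ^+ n / n`!%:R).
Proof.
move=> /andP[r0 rn].
suff : \sum_(k < J) r ^+ (n.+1 + k) / (n.+1 + k)`!%:R +
    n%:R * (r ^+ (n + J) / (n + J)`!%:R) <= n%:R * (r ^+ n / n`!%:R).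
  by apply: le_trans; rewrite lerDl mulr_ge0 // divr_ge0 // exprn_ge0.
elim: J => [|J IH]; first by rewrite big_ord0 add0r addn0.
apply: le_trans IH; rewrite big_ord_recr /= -addrA lerD2l.
rewrite addSn addnS exprS factS natrM invfM.
have nJ : 0 < (n + J).+1%:R :> R by [].
set a := r ^+ (n + J); set b := (n + J)`!%:R^-1.
have ab : 0 <= a * b by rewrite mulr_ge0 ?exprn_ge0 // invr_ge0.
have -> : r * a * ((n + J).+1%:R^-1 * b) + n%:R * (r * a * ((n + J).+1%:R^-1 * b)) =
  (r * (n%:R + 1) / (n + J).+1%:R) * (a * b) by ring.
rewrite ler_wpM2r // ler_pdivrMr //.
apply: ler_pM => //.
by rewrite natr1 ler_nat ltnS leq_addr.
Qed.

Lemma ffact_pow (M k : nat) : (0 < M)%N -> (k <= M)%N ->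
  (1 : R) - (k ^ 2)%:R / M%:R <= (M ^_ k)%:R / M%:R ^+ k <= (1 : R).
Proof.
move=> M0; have MR : 0 < M%:R :> R by rewrite ltr0n.
elim: k => [|k IH] kM.
  by rewrite mul0r subr0 ffactn0 expr0 divr1 lexx.
have /andP[h1 h2] := IH (ltnW kM).
rewrite ffactnSr natrM exprSr invfM mulrACA natrB; last exact: ltnW.
set a := (M ^_ k)%:R / M%:R ^+ k in h1 h2 *.
have a0 : 0 <= a by rewrite divr_ge0.
have kM1 : k%:R <= M%:R :> R by rewrite ler_nat ltnW.
rewrite mulrBl divff ?gt_eqF //.
have -> : (k.+1 ^ 2)%:R = (k ^ 2)%:R + 2 * k%:R + 1 :> R.
  by rewrite -natr1 !natrX -natr1; ring.
set x := k%:R / M%:R.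
have x0 : 0 <= x by rewrite divr_ge0.
have x1 : x <= 1 by rewrite ler_pdivrMr // mul1r.
have y0 : 0 <= M%:R^-1 :> R by rewrite invr_ge0.
have -> : ((k ^ 2)%:R + 2 * k%:R + 1) / M%:R = (k ^ 2)%:R / M%:R + 2 * x + M%:R^-1 :> R.
  by rewrite /x; ring.
by apply/andP; split; nra.
Qed.

Lemma absc_add1_exp (h : C) : absc (1 + h) ^+ 2 <= expR (2 * complex.Re h + absc h ^+ 2).
Proof.
apply: le_trans (expR_ge1Dx _); rewrite !absc_sqr; case: h => a b /=.
by rewrite add0r; lra.
Qed.

Lemma absc_expM_le (y : C) (M : nat) : (0 < M)%N ->
  absc ((1 + y / M%:R) ^+ M) <= expR (complex.Re y + absc y ^+ 2 / (2 * M%:R)).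
Proof.
move=> M0; have MR : 0 < M%:R :> R by rewrite ltr0n.
rewrite -(@ler_pXn2r _ 2) ?nnegrE ?absc_ge0 ?expR_ge0 //.
rewrite abscX -exprM mulnC exprM -expRM_natr.
have := absc_add1_exp (y / M%:R).
rewrite absc_div absc_nat.
have -> : complex.Re (y / M%:R) = complex.Re y / M%:R.
  by rewrite -(rmorph_nat (real_complex R)) -fmorphV mulrC Re_realM mulrC.
move/(lerXn2r M); rewrite !nnegrE exprn_ge0 ?absc_ge0 // expR_ge0 => /(_ isT isT).
move/le_trans; apply; rewrite -expRM_natr ler_expR.
by rewrite le_eqVlt; apply/orP; left; apply/eqP; field; rewrite gt_eqF.
Qed.

(** The sum is the exponential minus its tail. The exponential enters as (1 + y / M)^M with M large,
    whose modulus [absc_expM_le] controls by exp (Re y), and the tail is at most n times the term of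
    degree n. *)
Lemma expsum_le (y : C) (n : nat) : absc y <= n%:R ->
  absc (\sum_(k < n.+1) y ^+ k / k`!%:R) <=
  expR (complex.Re y) + n%:R * (absc y ^+ n / n`!%:R).
Proof.
move=> yn; apply/ler_addgt0Pr => e e0.
pose Y := \sum_(k < n.+1) absc y ^+ k / k`!%:R.
have Y0 : 0 <= Y by apply: sumr_ge0 => k _; rewrite divr_ge0 // exprn_ge0 ?absc_ge0.
pose E := expR (complex.Re y).
have E0 : 0 < E by exact: expR_gt0.
(* M = n + m makes the two errors, n^2 Y / M from the low coefficients and 3 E |y|^2 / M from the
   modulus of the power, add up to at most e. *)
pose m := (Num.trunc (((n ^ 2)%:R * Y + 3 * E * absc y ^+ 2) / e + absc y ^+ 2)).+1.
pose M := (n + m)%N.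
have M0 : (0 < M)%N by rewrite /M addnS.
have MR : 0 < M%:R :> R by rewrite ltr0n.
have [hM1 hM2] : ((n ^ 2)%:R * Y + 3 * E * absc y ^+ 2) / e <= M%:R /\ absc y ^+ 2 <= M%:R.
  have : ((n ^ 2)%:R * Y + 3 * E * absc y ^+ 2) / e + absc y ^+ 2 <= M%:R.
    by apply: le_trans (ltW (truncnS_gt _)) _; rewrite ler_nat leq_addl.
  have : 0 <= ((n ^ 2)%:R * Y + 3 * E * absc y ^+ 2) / e.
    by rewrite divr_ge0 ?(ltW e0) // addr_ge0 // mulr_ge0 ?exprn_ge0 ?absc_ge0 // mulr_ge0 // ltW.
  by have := sqr_ge0 (absc y); split; lra.
have {}hM1 : ((n ^ 2)%:R * Y + 3 * E * absc y ^+ 2) / M%:R <= e.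
  by rewrite ler_pdivrMr // [e * _]mulrC -ler_pdivrMr.
have exp_eq : (1 + y / M%:R) ^+ M =
    \sum_(k < M.+1) ((M ^_ k)%:R / M%:R ^+ k)%:C * (y ^+ k / k`!%:R).
  rewrite exprDn; apply: eq_bigr => k _.
  rewrite expr1n mul1r -mulr_natr -(bin_ffact M k) natrM.
  rewrite expr_div_n rmorphM rmorphM fmorphV rmorphXn !rmorph_nat.
  have h1 : k`!%:R != 0 :> C by rewrite pnatr_eq0 -lt0n fact_gt0.
  have h2 : M%:R != 0 :> C by rewrite pnatr_eq0 -lt0n.
  by field; rewrite h1 expf_neq0.
(* D is the defect of the coefficients of (1 + y / M)^M up to degree n, and T is its part beyond
   degree n. *)
pose D := \sum_(k < n.+1) (1 - (M ^_ k)%:R / M%:R ^+ k)%:C * (y ^+ k / k`!%:R).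
pose T := \sum_(k < m) ((M ^_ (n.+1 + k))%:R / M%:R ^+ (n.+1 + k))%:C *
  (y ^+ (n.+1 + k) / (n.+1 + k)`!%:R).
have -> : \sum_(k < n.+1) y ^+ k / k`!%:R = D + ((1 + y / M%:R) ^+ M - T).
  rewrite exp_eq -[M.+1]addSn big_split_ord /= addrK -big_split /=.
  by apply: eq_bigr => k _; rewrite -mulrDl -rmorphD subrK rmorph1 mul1r.
have D1 : absc D <= (n ^ 2)%:R / M%:R * Y.
  apply: le_trans (absc_sum _ _ _) _; rewrite mulr_sumr; apply: ler_sum => k _.
  have kM : (k <= M)%N by rewrite (leq_trans (_ : k <= n)%N) ?leq_addr // -ltnS.
  have /andP[h1 h2] := ffact_pow M0 kM.
  rewrite abscM absc_real absc_div abscX absc_nat.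
  rewrite ler_wpM2r ?divr_ge0 ?exprn_ge0 ?absc_ge0 //.
  rewrite ger0_norm ?subr_ge0 // lerBlDr -lerBlDl; apply: le_trans h1.
  rewrite lerB // ler_wpM2r ?invr_ge0 // ler_nat leq_sqr -ltnS //.
have T1 : absc T <= n%:R * (absc y ^+ n / n`!%:R).
  apply: le_trans (absc_sum _ _ _) _.
  apply: le_trans (exp_tail_le m (introT andP (conj (absc_ge0 y) yn))).
  apply: ler_sum => k _.
  have kM : (n.+1 + k <= M)%N by rewrite addSnnS leq_add2l.
  have /andP[h1 h2] := ffact_pow M0 kM.
  rewrite abscM absc_real absc_div abscX absc_nat -[leRHS]mul1r.
  rewrite ler_wpM2r ?divr_ge0 ?exprn_ge0 ?absc_ge0 //.
  by rewrite ger0_norm // divr_ge0 // exprn_ge0.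
have P1 : absc ((1 + y / M%:R) ^+ M) <= E + 3 * E * absc y ^+ 2 / M%:R.
  apply: le_trans (absc_expM_le y M0) _; rewrite expRD -/E.
  have -> : E + 3 * E * absc y ^+ 2 / M%:R = E * (1 + 3 * (absc y ^+ 2 / M%:R)) by ring.
  rewrite ler_wpM2l ?(ltW E0) //.
  have t0 : 0 <= absc y ^+ 2 / M%:R by rewrite divr_ge0 ?sqr_ge0.
  have t1 : absc y ^+ 2 / M%:R <= 1 by rewrite ler_pdivrMr // mul1r.
  have -> : absc y ^+ 2 / (2 * M%:R) = absc y ^+ 2 / M%:R / 2 by rewrite invfM; ring.
  move: (absc y ^+ 2 / M%:R) t0 t1 => t t0 t1.
  have /andP[_] : 0 <= expR (t / 2) - 1 - t / 2 <= 2 * (t / 2) ^+ 2.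
    by apply: expR_sub_quad; lra.
  nra.
apply: le_trans (absc_triangle _ _) _.
apply: le_trans (lerD (lexx _) (absc_triangleB _ _)) _.
move: hM1; rewrite mulrDl [_ * Y / _]mulrAC -/E => hM1.
lra.
Qed.

(** The reversed exponential sum: for v nonzero and n > 0 it equals n! (v / n)^n times the Taylor
    polynomial of exp of degree n at n / v. *)
Definition trexp (n : nat) (v : C) : C := \sum_(q < n.+1) (n ^_ q)%:R * (v / n%:R) ^+ q.

Lemma trexp_le1 (n : nat) (v : C) : absc v <= 1 -> absc (trexp n v) <= n.+1%:R.
Proof.
move=> v1; apply: le_trans (absc_sum _ _ _) _.
have -> : n.+1%:R = \sum_(q < n.+1) 1 :> R by rewrite sumr_const card_ord.
apply: ler_sum => q _; rewrite abscM abscX absc_div !absc_nat expr_div_n mulrCA.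
have [n0|n0] := posnP n.
  case: q => -[|q]; last by rewrite n0.
  by move=> q0; rewrite n0 /= ffactn0 expr0 divr1 mulr1.
have qn : (q <= n)%N by rewrite -ltnS.
have /andP[_ h] := ffact_pow n0 qn.
rewrite -[leRHS]mulr1 ler_pM ?exprn_ge0 ?absc_ge0 ?divr_ge0 //.
by rewrite exprn_ile1 ?absc_ge0.
Qed.

(** Apply [expsum_le] at y = n / v. Stirling turns n! (|v| / n)^n exp (Re y) into at most e n |phi
    (1 / v)|^(- n), and the tail contributes exactly n. *)
Lemma trexp_ge1 (n : nat) (v : C) : (0 < n)%N -> 1 <= absc v ->
  absc (trexp n v) <= expR 1 * n%:R * (absc (phi v^-1))^-1 ^+ n + n%:R.
Proof.
move=> n0 v1; have av : 0 < absc v by lra.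
have v0 : v != 0 by rewrite -absc_gt0.
have nR : 0 < n%:R :> R by rewrite ltr0n.
have nC : n%:R != 0 :> C by rewrite pnatr_eq0 -lt0n.
pose y := n%:R / v.
have yv : y * (v / n%:R) = 1 by rewrite /y; field; rewrite v0 nC.
have -> : trexp n v = n`!%:R * (v / n%:R) ^+ n * \sum_(k < n.+1) y ^+ k / k`!%:R.
  rewrite mulr_sumr (reindex_inj rev_ord_inj) /=; apply: eq_bigr => k _.
  have kn : (k <= n)%N by rewrite -ltnS.
  rewrite subSS -(ffact_fact kn) natrM.
  have -> : (v / n%:R) ^+ n = (v / n%:R) ^+ k * (v / n%:R) ^+ (n - k).
    by rewrite -exprD subnKC.
  have fk : (n - k)`!%:R != 0 :> C by rewrite pnatr_eq0 -lt0n fact_gt0.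
  transitivity ((n ^_ k)%:R * (v / n%:R) ^+ k * (y * (v / n%:R)) ^+ (n - k)).
    by rewrite yv expr1n mulr1.
  rewrite [(y * _) ^+ _]exprMn.
  move: (y ^+ (n - k)) ((v / n%:R) ^+ k) ((v / n%:R) ^+ (n - k)) ((n - k)`!%:R) fk => a b c f fk.
  by field.
have ay : absc y = n%:R / absc v by rewrite absc_div absc_nat.
have yn : absc y <= n%:R by rewrite ay ler_pdivrMr // ler_peMr.
have Re_y : complex.Re y = n%:R * complex.Re v^-1.
  by rewrite /y -(rmorph_nat (real_complex R)) Re_realM.
clearbody y.
have h := expsum_le yn.
have E S : absc (n`!%:R * (v / n%:R) ^+ n * S) = n`!%:R * (absc v / n%:R) ^+ n * absc S.
  by rewrite !abscM abscX absc_div !absc_nat.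
rewrite E.
have F0 : 0 <= n`!%:R * (absc v / n%:R) ^+ n.
  by rewrite mulr_ge0 // exprn_ge0 // divr_ge0 ?absc_ge0.
apply: le_trans (ler_wpM2l F0 h) _; rewrite mulrDr; apply: lerD; last first.
  rewrite ay le_eqVlt; apply/orP; left; apply/eqP.
  have AB : (absc v / n%:R) ^+ n * (n%:R / absc v) ^+ n = 1.
    rewrite -exprMn -[RHS](expr1n _ n); congr (_ ^+ _).
    by field; rewrite !gt_eqF.
  have fn : n`!%:R != 0 :> R by rewrite pnatr_eq0 -lt0n fact_gt0.
  transitivity ((absc v / n%:R) ^+ n * (n%:R / absc v) ^+ n * n%:R); last by rewrite AB mul1r.
  move: ((absc v / n%:R) ^+ n) ((n%:R / absc v) ^+ n) (n`!%:R) fn => c d f fn.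
  by field.
have -> : (absc (phi v^-1))^-1 ^+ n = absc v ^+ n * expR (complex.Re y) * expR (- n%:R).
  rewrite absc_phi invfM abscV invrK exprMn -expRN -expRM_natr -mulrA -expRD Re_y.
  by congr (_ * expR _); ring.
have := fact_exp_le n0; rewrite -ler_pdivlMr ?expR_gt0 // -expRN => hf.
have K0 : 0 <= (absc v / n%:R) ^+ n * expR (complex.Re y).
  by rewrite mulr_ge0 ?expR_ge0 // exprn_ge0 // divr_ge0 ?absc_ge0.
rewrite -[leLHS]mulrA; apply: le_trans (ler_wpM2r K0 hf) _.
rewrite le_eqVlt; apply/orP; left; apply/eqP; rewrite expr_div_n; field.
by rewrite expf_neq0 // gt_eqF.
Qed.

End ExpSum.
(** * Growth of the reversed Laguerre polynomials *)

Section LaguerreBound.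
Variable R : realType.
Local Notation C := R[i].

(** The product of the factors 1 - z u over the zeros z ([lagzeros_prod]), displayed as [trexp] with
    the multipliers risingf (- a) q = (- 1)^q binom(a, q). *)
Definition lagq (n : nat) (a : R) (u : C) : C :=
  \sum_(q < n.+1) (risingf (- a) q)%:C * ((n ^_ q)%:R * (u / n%:R) ^+ q).

Lemma risingf_pascal (A : R) k :
  risingf (A + 1) k.+1 = risingf A k.+1 + risingf (A + 1) k.
Proof.
have k0 : k.+1%:R != 0 :> R by rewrite pnatr_eq0.
apply: (mulfI k0); rewrite mulrDr risingfS risingf_shift -mulrDl -[k.+1%:R]natr1.
by congr (_ * _); ring.
Qed.

(** Double induction along Pascal's rule; for m > 0 these numbers are the binomial coefficients
    binom(m + q - 1, q). *)
Lemma risingf_le_pow2 (m q : nat) : risingf m%:R q <= 2 ^+ (m + q) :> R.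
Proof.
elim: m q => [|m IH] q.
  case: q => [|q]; first by rewrite risingf0 expr0.
  have -> : risingf 0 q.+1 = 0 :> R.
    apply: (mulfI (x := q.+1%:R)); first by rewrite pnatr_eq0.
    by rewrite risingf_shift mul0r mulr0.
  by rewrite exprn_ge0.
elim: q => [|q IHq]; first by rewrite risingf0 exprn_ege1 // ler1n.
rewrite -natr1 risingf_pascal natr1.
apply: le_trans (lerD (IH _) IHq) _.
by rewrite !addnS !addSn !exprS; move: (2 ^+ _) => x; lra.
Qed.

Lemma risingf_abs_le (c : R) (m q : nat) : `|c| <= m%:R -> `|risingf c q| <= 2 ^+ (m + q).
Proof.
move=> cm; apply: le_trans (risingf_le_pow2 m q).
rewrite /risingf normrM normfV (ger0_norm (ler0n R _)) ler_wpM2r ?invr_ge0 //.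
rewrite /rising normr_prod; apply: ler_prod => i _; rewrite normr_ge0 /=.
by apply: le_trans (ler_normD _ _) _; rewrite lerD // ger0_norm.
Qed.

Lemma ffact_term_le (n q : nat) (u : C) : (q <= n)%N ->
  absc ((n ^_ q)%:R * (u / n%:R) ^+ q) <= absc u ^+ q.
Proof.
move=> qn; rewrite abscM abscX absc_div !absc_nat expr_div_n mulrCA.
have [n0|n0] := posnP n.
  by move: qn; rewrite n0 leqn0 => /eqP ->; rewrite ffactn0 expr0 divr1 mulr1.
have /andP[_ h] := ffact_pow R n0 qn.
by rewrite -[leRHS]mulr1 ler_wpM2l // exprn_ge0 ?absc_ge0.
Qed.

Lemma trexp_outer (n : nat) (s : R) (v : C) : (0 < n)%N -> 0 <= s -> outer s v ->
  absc (trexp n v) <= 2 * n%:R + expR 1 * n%:R * expR (s * n%:R).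
Proof.
move=> n0 s0 ov; have n1 : 1 <= n%:R :> R by rewrite ler1n.
have [v1|v1] := leP (absc v) 1.
  apply: le_trans (trexp_le1 _ v1) _; rewrite -natr1.
  have : 0 <= expR 1 * n%:R * expR (s * n%:R) by rewrite !mulr_ge0 ?expR_ge0.
  lra.
apply: le_trans (trexp_ge1 n0 (ltW v1)) _; rewrite addrC; apply: lerD; first lra.
case: ov => [|h]; first by rewrite ltNge (ltW v1).
have p0 : 0 < absc (phi v^-1) by apply: lt_trans h; exact: expR_gt0.
rewrite ler_wpM2l ?mulr_ge0 ?expR_ge0 // expRM_natr; apply: lerXn2r.
- by rewrite nnegrE invr_ge0 absc_ge0.
- by rewrite nnegrE expR_ge0.
by rewrite -[expR s]invrK lef_pV2 ?posrE ?invr_gt0 ?expR_gt0 // -expRN ltW.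
Qed.

(** This provides the hypothesis of [beta_multiplier] for the part of [trexp] beyond degree L. If t
    |u| <= 1, the terms are bounded one by one. Otherwise t^(L + 1) times the sum is [trexp] at t u,
    which lies in the star-shaped domain, minus the L + 1 lowest terms; dividing by t^(L + 1) is
    harmless since t B >= 1. *)
Lemma outer_scale_trexp (n L : nat) (s B : R) (u : C) :
  (0 < n)%N -> (L < n)%N -> 0 <= s -> outer s u -> absc u <= B -> 1 <= B ->
  forall t : R, 0 <= t <= 1 ->
  absc (\sum_(k < n - L)
    ((n ^_ (L.+1 + k))%:R * (u / n%:R) ^+ (L.+1 + k)) * (t ^+ k)%:C) <=
  B ^+ L.+1 * (3 * n%:R + expR 1 * n%:R * expR (s * n%:R)).
Proof.
move=> n0 Ln s0 ou uB B1 t /andP[t0 t1].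
have u0 := absc_ge0 u; have B0 : 0 <= B by lra.
set G := \sum_(k < _) _.
have nLn : (L.+1 + (n - L))%N = n.+1 by rewrite addSn subnKC // ltnW.
have hq (k : 'I_(n - L)) : (L.+1 + k <= n)%N by rewrite -ltnS -nLn ltn_add2l.
have E0 : 0 <= expR 1 * n%:R * expR (s * n%:R) by rewrite !mulr_ge0 ?expR_ge0.
have BL : absc u ^+ L.+1 <= B ^+ L.+1 by apply: lerXn2r; rewrite ?nnegrE.
have BL0 : 0 <= B ^+ L.+1 by rewrite exprn_ge0.
have [tu|tu] := leP (t * absc u) 1.
  apply: (@le_trans _ _ (B ^+ L.+1 * n%:R)); last first.
    by rewrite ler_wpM2l //; have := ler0n R n; lra.
  apply: le_trans (absc_sum _ _ _) _.
  apply: (@le_trans _ _ (\sum_(k < n - L) B ^+ L.+1)); last first.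
    by rewrite sumr_const card_ord -[leLHS]mulr_natr ler_wpM2l // ler_nat leq_subr.
  apply: ler_sum => k _; rewrite abscM absc_real ger0_norm ?exprn_ge0 //.
  apply: le_trans (ler_wpM2r (exprn_ge0 _ t0) (ffact_term_le u (hq k))) _.
  rewrite exprD -mulrA -exprMn -[leRHS]mulr1; apply: ler_pM; rewrite ?exprn_ge0 ?mulr_ge0 //.
  by rewrite exprn_ile1 ?mulr_ge0 // mulrC.
have tp : 0 < t by rewrite lt_def t0 andbT; apply/eqP => tz; move: tu; rewrite tz; lra.
have X := trexp_outer n0 s0 (outer_star ou (introT andP (conj t0 t1))).
have : absc (t%:C ^+ L.+1 * G) <= (L.+1)%:R * (t * absc u) ^+ L.+1 +
    (2 * n%:R + expR 1 * n%:R * expR (s * n%:R)).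
  have -> : t%:C ^+ L.+1 * G = trexp n (t%:C * u) -
      \sum_(q < L.+1) (n ^_ q)%:R * (t%:C * u / n%:R) ^+ q.
    rewrite /trexp -nLn big_split_ord /= [X in X - _]addrC addrK mulr_sumr.
    apply: eq_bigr => k _; rewrite -[t%:C * u / _]mulrA [(t%:C * _) ^+ _]exprMn [t%:C ^+ (_ + _)]exprD rmorphXn /=.
    by ring.
  apply: le_trans (absc_triangleB _ _) _; rewrite addrC; apply: lerD => //.
  apply: le_trans (absc_sum _ _ _) _.
  have -> : L.+1%:R * (t * absc u) ^+ L.+1 = \sum_(q < L.+1) (t * absc u) ^+ L.+1.
    by rewrite sumr_const card_ord mulr_natl.
  apply: ler_sum => q _.
  have qn : (q <= n)%N by apply: leq_trans (ltnW Ln); rewrite -ltnS.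
  apply: le_trans (ffact_term_le _ qn) _; rewrite abscM absc_real ger0_norm //.
  by apply: ler_weXn2l; [exact: ltW|exact: ltnW].
rewrite abscM abscX absc_real ger0_norm // exprMn.
have tL : 0 < t ^+ L.+1 by rewrite exprn_gt0.
have tB : 1 <= t ^+ L.+1 * B ^+ L.+1.
  rewrite -exprMn exprn_ege1 //.
  by apply: le_trans (ltW tu) _; rewrite ler_wpM2l.
have Ln' : L.+1%:R <= n%:R :> R by rewrite ler_nat.
move: tL tB BL BL0 E0 Ln'.
have : 0 <= absc u ^+ L.+1 by rewrite exprn_ge0.
have : 0 <= L.+1%:R :> R by [].
move: (absc u ^+ L.+1) (t ^+ L.+1) (B ^+ L.+1) (expR 1 * n%:R * expR (s * n%:R)) => x y z e.
move: (n%:R : R) (L.+1%:R : R) n0 => N l _ l0 x0 y0 yz xz z0 e0 lN h.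
rewrite -(ler_pM2l y0); apply: le_trans h _.
have h1 : l * (y * x) <= N * (y * z).
  by rewrite ler_pM ?mulr_ge0 // ?(ltW y0) // ler_wpM2l ?(ltW y0).
have h2 : 2 * N + e <= (y * z) * (2 * N + e).
  by rewrite ler_peMl //; lra.
lra.
Qed.

(** The terms up to degree L are bounded one by one. Beyond L all multipliers contain the factor - a
    + L = - eta, and what remains is a ratio of rising factorials to which [beta_multiplier]
    applies. Hence the large term exp (s n) is damped by |eta|. *)
Lemma lagq_near (n L m : nat) (a eta s B : R) (u : C) :
  (0 < n)%N -> (L < n)%N -> a = L%:R + eta -> `|eta| < 1 -> `|a| <= m%:R ->
  0 <= s -> outer s u -> absc u <= B -> 1 <= B ->
  absc (lagq n a u) <= 2 ^+ (m + L) * B ^+ L.+1 *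
    (n%:R + `|eta| * (3 * n%:R + expR 1 * n%:R * expR (s * n%:R))).
Proof.
move=> n0 Ln aE eta1 am s0 ou uB B1.
have u0 := absc_ge0 u; have B0 : 0 <= B by lra.
have nLn : (L.+1 + (n - L))%N = n.+1 by rewrite addSn subnKC // ltnW.
move: (eta1); rewrite ltr_norml => /andP[eta_m eta_p].
have cm : `|- a| <= m%:R by rewrite normrN.
rewrite /lagq -nLn big_split_ord /=; apply: le_trans (absc_triangle _ _) _.
rewrite mulrDr; apply: lerD.
  apply: le_trans (absc_sum _ _ _) _.
  apply: (@le_trans _ _ (\sum_(q < L.+1) 2 ^+ (m + L) * B ^+ L.+1)); last first.
    rewrite sumr_const card_ord -[leLHS]mulr_natr ler_wpM2l ?ler_nat //.
    by rewrite mulr_ge0 ?exprn_ge0.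
  apply: ler_sum => q _; rewrite abscM absc_real; apply: ler_pM; rewrite ?absc_ge0 //.
    apply: le_trans (risingf_abs_le _ cm) _; rewrite ler_weXn2l ?ler1n //.
    by rewrite leq_add2l -ltnS.
  have qn : (q <= n)%N by apply: leq_trans (ltnW Ln); rewrite -ltnS.
  apply: le_trans (ffact_term_le _ qn) _.
  apply: (@le_trans _ _ (B ^+ q)); first by apply: lerXn2r; rewrite ?nnegrE.
  by apply: ler_weXn2l => //; exact: ltnW.
pose y k : C := (n ^_ (L.+1 + k))%:R * (u / n%:R) ^+ (L.+1 + k).
(* The common factor of degree L + 1 is split off; the quotient is the beta moment with parameters 1
   - eta and L + 1 + eta. *)
have rE k : risingf (- a) (L.+1 + k) = risingf (- a) L.+1 *
    (rising (1 - eta) k / rising (1 - eta + (L.+1%:R + eta)) k).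
  rewrite /risingf risingD.
  have -> : - a + L.+1%:R = 1 - eta by rewrite aE -natr1; ring.
  have -> : 1 - eta + (L.+1%:R + eta) = L.+2%:R by rewrite -[L.+2%:R]natr1; ring.
  have -> : (L.+1 + k)`!%:R = L.+1`!%:R * rising L.+2%:R k :> R.
    elim: k => [|k IH]; first by rewrite addn0 rising0 mulr1.
    rewrite addnS factS natrM IH risingS.
    have -> : (L.+1 + k).+1%:R = L.+2%:R + k%:R :> R by rewrite -natrD addSn.
    by ring.
  have h1 : L.+1`!%:R != 0 :> R by exact: natrf_neq0.
  have h2 : rising L.+2%:R k != 0 :> R by rewrite gt_eqF // rising_gt0.
  by field; rewrite h1 h2.
have -> : \sum_(k < n - L) (risingf (- a) (L.+1 + k))%:C * y k =
    (risingf (- a) L.+1)%:C * \sum_(k < n - L)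
    (rising (1 - eta) k / rising (1 - eta + (L.+1%:R + eta)) k)%:C * y k.
  by rewrite mulr_sumr; apply: eq_bigr => k _; rewrite rE rmorphM mulrA.
rewrite abscM absc_real.
have r1 : `|risingf (- a) L.+1| <= 2 ^+ (m + L) * `|eta|.
  have -> : risingf (- a) L.+1 = risingf (- a) L * (- eta / L.+1%:R).
    have L0 : L.+1%:R != 0 :> R by rewrite pnatr_eq0.
    apply: (mulfI L0); rewrite risingfS aE; field.
    by rewrite addrC natr1.
  rewrite normrM; apply: ler_pM => //; first exact: risingf_abs_le.
  rewrite normrM normrN normfV (ger0_norm (ler0n R _)).
  by rewrite ler_piMr // invf_le1 // ler1n.
have b1 : absc (\sum_(k < n - L)
    (rising (1 - eta) k / rising (1 - eta + (L.+1%:R + eta)) k)%:C * y k) <=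
    B ^+ L.+1 * (3 * n%:R + expR 1 * n%:R * expR (s * n%:R)).
  apply: beta_multiplier; first by lra.
    by rewrite -natr1; have := ler0n R L; lra.
  by move=> t t01; exact: outer_scale_trexp.
apply: le_trans (ler_pM (normr_ge0 _) (absc_ge0 _) r1 b1) _.
by rewrite le_eqVlt; apply/orP; left; apply/eqP; ring.
Qed.

(** For |v| >= 1, passing from v to w costs at most a factor exp (- e) in the modulus of the inverse
    and another one in exp (1 - Re (1 / v)); the third e keeps the inequality strict. *)
Lemma outer_perturb (s e : R) (v w : C) : 0 <= s -> 0 < e ->
  outer s v -> absc (w - v) <= e -> outer (s + 3 * e) w.
Proof.
move=> s0 e0 ov wv; have [w1|w1] := ltP (absc w) 1; [by left|right].
have aw : 0 < absc w by lra.
have w0 : w != 0 by rewrite -absc_gt0.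
have hw : absc w <= absc v + e.
  by have := absc_triangle_sub w v; lra.
have e1 : expR (- e) <= (1 + e)^-1.
  by rewrite expRN lef_pV2 ?posrE ?expR_gt0 ?expR_ge1Dx //; lra.
rewrite absc_phi abscV.
have [v1|v1] := ltP (absc v) 1.
  have h1 : (1 + e)^-1 <= (absc w)^-1 by rewrite lef_pV2 ?posrE //; lra.
  have h2 : 1 <= expR (1 - complex.Re w^-1).
    have h : complex.Re w^-1 <= 1.
      by apply: le_trans (Re_leif_absc _) _; rewrite abscV invf_le1.
    by have := expR_ge1Dx (1 - complex.Re w^-1); lra.
  have h3 : expR (- (s + 3 * e)) < expR (- e) by rewrite ltr_expR; lra.
  have h4 : 0 < (absc w)^-1 by rewrite invr_gt0.
  have := expR_gt0 (- e); nra.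
case: ov => [|]; first by rewrite ltNge v1.
rewrite absc_phi abscV => h.
have av : 0 < absc v by lra.
have v0 : v != 0 by rewrite -absc_gt0.
have h1 : (absc v)^-1 * expR (- e) <= (absc w)^-1.
  apply: (@le_trans _ _ ((absc v)^-1 * (1 + e)^-1)).
    by rewrite ler_wpM2l ?invr_ge0 ?absc_ge0.
  rewrite -invfM lef_pV2 ?posrE ?mulr_gt0 //; last lra.
  by apply: le_trans hw _; nra.
have h2 : expR (1 - complex.Re v^-1) * expR (- e) <= expR (1 - complex.Re w^-1).
  rewrite -expRD ler_expR.
  have : `|complex.Re (w^-1 - v^-1)| <= e.
    apply: le_trans (Re_le_absc _) _.
    have -> : w^-1 - v^-1 = (v - w) / (w * v) by field; rewrite w0 v0.
    rewrite absc_div abscM absc_distC ler_pdivrMr ?mulr_gt0 //.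
    apply: le_trans wv _; rewrite ler_peMr ?(ltW e0) //.
    by rewrite -[1]mulr1 ler_pM.
  by rewrite ReB ler_norml => /andP[_]; lra.
apply: (@lt_le_trans _ _ (expR (- s) * expR (- e) * expR (- e))).
  by rewrite -!expRD ltr_expR; lra.
apply: le_trans (ler_pM _ _ h1 h2); rewrite ?mulr_ge0 ?invr_ge0 ?expR_ge0 ?absc_ge0 //.
rewrite mulrACA -mulrA ler_wpM2r ?mulr_ge0 ?expR_ge0 //.
exact: ltW.
Qed.

Lemma coef_linear_pow (v e : C) (N k : nat) :
  ((v%:P + e *: 'X) ^+ N)`_k = 'C(N, k)%:R * v ^+ (N - k) * e ^+ k.
Proof.
rewrite exprDn coef_sum.
under eq_bigr => i _.
  rewrite exprZn -scalerAr -polyC_exp mul_polyC coefMn !coefZ coefXn; over.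
have [kN|kN] := leqP k N; last first.
  rewrite bin_small // mul0r mul0r big1 // => i _.
  have -> : (k == i) = false by apply/eqP => ki; move: (ltn_ord i); rewrite -ki ltnS leqNgt kN.
  by rewrite !mulr0 mul0rn.
rewrite (bigD1 (Ordinal (kN : k < N.+1)%N)) //= eqxx mulr1 big1 ?addr0.
  by rewrite -mulr_natl; ring.
move=> i; rewrite -val_eqE /= eq_sym => /negPf ->.
by rewrite !mulr0 mul0rn.
Qed.

Lemma risingf_bin (m q : nat) : risingf m.+1%:R q = 'C(m + q, m)%:R :> R.
Proof.
elim: q => [|q IH]; first by rewrite risingf0 addn0 binn.
have q0 : q.+1%:R != 0 :> R by rewrite pnatr_eq0.
apply: (mulfI q0); rewrite risingfS IH -natrD -!natrM; congr _%:R.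
rewrite addSn addnS -(bin_sub (leqW (leq_addr _ _))) -(bin_sub (leq_addr _ _)).
rewrite subSn ?leq_addr // addKn.
by have := mul_bin_diag (m + q).+1 q; rewrite /= => ->; rewrite mulnC.
Qed.

(** The multiplier risingf (- a) q is a beta moment times binom(m + q, m). The binomial amounts to m
    differentiations, which Cauchy's estimate on a circle of radius e about v bounds at the cost of
    e^(- m). *)
Lemma lagq_far (n m : nat) (a s e B : R) (u : C) :
  (0 < n)%N -> 0 < - a <= m.+1%:R -> 0 <= s -> 0 < e <= 1 ->
  outer s u -> absc u <= B -> 1 <= B ->
  absc (lagq n a u) <= e^-1 ^+ m * (B + 1) ^+ m *
    (2 * n%:R + expR 1 * n%:R * expR ((s + 3 * e) * n%:R)).
Proof.
move=> n0 /andP[a0 am] s0 /andP[e0 e1] ou uB B1.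
set S := _ * (2 * _ + _).
pose y q : C := (risingf m.+1%:R q)%:C * ((n ^_ q)%:R * (u / n%:R) ^+ q).
have -> : lagq n a u = \sum_(q < n.+1)
    (rising (- a) q / rising (- a + (m.+1%:R + a)) q)%:C * y q.
  apply: eq_bigr => q _; rewrite /y [RHS]mulrA -rmorphM; congr (_%:C * _).
  have -> : - a + (m.+1%:R + a) = m.+1%:R by ring.
  have h1 : rising m.+1%:R q != 0 :> R by rewrite gt_eqF // rising_gt0.
  have h2 := natrf_neq0 R q.
  by rewrite /risingf; field; rewrite h1 h2.
apply: beta_multiplier => // [|t /andP[t0 t1]]; first lra.
pose v := t%:C * u.
have ov : outer s v by apply: outer_star => //; rewrite t0.
have vB : absc v <= B.
  by rewrite abscM absc_real ger0_norm //; have := absc_ge0 u; nra.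
pose P : {poly C} := v%:P + e%:C *: 'X.
(* The coefficient of X^m in P^(m + q), for P = v + e X, is binom(m + q, m) v^q e^m. *)
pose G : {poly C} := P ^+ m * \sum_(q < n.+1) ((n ^_ q)%:R / n%:R ^+ q) *: P ^+ q.
have GP w : G.[w] = P.[w] ^+ m * trexp n P.[w].
  rewrite /G hornerM horner_exp horner_sum; congr (_ * _).
  by apply: eq_bigr => q _; rewrite hornerZ horner_exp expr_div_n; ring.
have Gm : G`_m = (e ^+ m)%:C * \sum_(q < n.+1) y q * (t ^+ q)%:C.
  rewrite /G mulr_sumr coef_sum mulr_sumr; apply: eq_bigr => q _.
  rewrite -scalerAr coefZ -exprD coef_linear_pow addKn /y risingf_bin.
  rewrite rmorph_nat !rmorphXn /= /v exprMn expr_div_n.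
  by ring.
have : absc G`_m <= (B + 1) ^+ m * (2 * n%:R + expR 1 * n%:R * expR ((s + 3 * e) * n%:R)).
  apply: coef_le_circle => w w1; rewrite GP abscM abscX.
  have PE : P.[w] = v + e%:C * w by rewrite hornerD hornerC hornerZ hornerX.
  apply: ler_pM; rewrite ?exprn_ge0 ?absc_ge0 //.
    apply: lerXn2r; rewrite ?nnegrE ?absc_ge0 //; first lra.
    rewrite PE; apply: le_trans (absc_triangle _ _) _; apply: lerD => //.
    by rewrite abscM w1 mulr1 absc_real gtr0_norm.
  apply: trexp_outer => //; first lra.
  apply: (outer_perturb s0 e0 ov).
  by rewrite PE addrC addKr abscM w1 mulr1 absc_real gtr0_norm.
rewrite Gm abscM absc_real ger0_norm ?exprn_ge0 ?(ltW e0) //.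
by move=> h; rewrite /S exprVn -[leRHS]mulrA ler_pdivlMl ?exprn_gt0.
Qed.

End LaguerreBound.

(** * Subexponential growth on the exterior domain *)

Section LaguerreSubexp.
Variable R : realType.
Local Notation C := R[i].

Lemma near_ge_nat (x : R) : \forall n \near \oo, x <= n%:R.
Proof.
exists (Num.trunc x).+1 => // n /= h.
by apply: le_trans (ltW (truncnS_gt x)) _; rewrite ler_nat.
Qed.

Lemma near_lin_le_exp (k c : R) : 0 < k ->
  \forall n \near \oo, c * n%:R <= expR (k * n%:R).
Proof.
move=> k0; near=> n.
have n0 : 0 <= n%:R :> R by [].
apply: le_trans (_ : (k * n%:R) ^+ 2 / 2 <= _); last first.
  have := expR_ge1Dxn 1 (mulr_ge0 (ltW k0) n0).
  by rewrite (_ : 2`! = 2%N) //; lra.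
have : 2 * c / k ^+ 2 <= n%:R by near: n; exact: near_ge_nat.
rewrite ler_pdivrMr ?exprn_gt0 // => h.
have : 0 <= n%:R * (n%:R * k ^+ 2 - 2 * c) by rewrite mulr_ge0 // subr_ge0.
lra.
Unshelve. all: by end_near. Qed.

Lemma expR1_le4 : expR 1 <= 4 :> R.
Proof. by have /andP[_] := @expR_sub_quad R 1 (lexx _); rewrite expr1n; lra. Qed.

Lemma outer_bounded (s : R) (u : C) : 0 <= s -> outer s u -> absc u <= expR (s + 2).
Proof.
move=> s0 ou; have B1 : 1 <= expR (s + 2) by have := expR_ge1Dx (s + 2); lra.
have [u1|u1] := leP (absc u) 1; first exact: le_trans B1.
case: ou => [|h]; first by rewrite ltNge (ltW u1).
have au : 0 < absc u by lra.
move: h; rewrite absc_phi abscV => h.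
have h2 : expR (1 - complex.Re u^-1) <= expR 2.
  rewrite ler_expR; have := Re_le_absc u^-1; rewrite abscV ler_norml.
  have : (absc u)^-1 <= 1 by rewrite invf_le1 // ltW.
  by move=> ? /andP[]; lra.
have : expR (- s) < (absc u)^-1 * expR 2.
  by apply: lt_le_trans h _; rewrite ler_wpM2l // invr_ge0 ltW.
rewrite mulrC ltr_pdivlMr // expRN mulrC ltr_pdivrMr ?expR_gt0 // -expRD addrC.
exact: ltW.
Qed.

(** Either a n <= - 1, and [lagq_far] applies, or a n is within distance less than 1 of an index L,
    and [lagq_near] applies with |eta| = D n. The powers with exponents of order |a n| are
    subexponential because a n = o(n). *)
Lemma lagq_subexp (a D : nat -> R) (s : R) : 0 <= s ->
  (forall k, 0 < k -> \forall n \near \oo, `|a n| <= k * n%:R) ->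
  (\forall n \near \oo, (exists2 L, (L < n)%N & D n = `|a n - L%:R|) /\
     forall i, (i < n)%N -> D n <= `|a n - i%:R|) ->
  (forall d, 0 < d -> \forall n \near \oo, D n * expR (s * n%:R) <= expR (d * n%:R)) ->
  forall d, 0 < d -> \forall n \near \oo, forall u, outer s u ->
    absc (lagq n (a n) u) <= expR (d * n%:R).
Proof.
move=> s0 ao aD Ds d d0.
pose k := d / 8; have k0 : 0 < k by rewrite divr_gt0.
pose e := Num.min 1 (k / 3).
have e0 : 0 < e by rewrite lt_min ltr01 divr_gt0.
have e1 : e <= 1 by rewrite ge_min lexx.
have e3 : 3 * e <= k.
  by have : e <= k / 3 by [rewrite ge_min lexx orbT]; lra.
pose B := expR (s + 2).
have B1 : 1 <= B by have := expR_ge1Dx (s + 2); rewrite -/B; lra.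
(* [l] bounds the logarithmic cost per unit of |a n| + 1: [l1] pays for the powers of 2 and B in
   [lagq_near], and [l2] for those of 1 / e and B + 1 in [lagq_far]. *)
pose l1 := 3 + 3 * (s + 2).
have eB : 1 <= e^-1 * (B + 1).
  by rewrite -[1]mulr1 ler_pM // ?invf_ge1 //; lra.
pose l2 := ln (e^-1 * (B + 1)).
have l20 : 0 <= l2 by rewrite ln_ge0.
pose l := l1 + l2; have l0 : 0 < l by rewrite /l /l1; lra.
near=> n.
have n1 : 1 <= n%:R :> R by near: n; exact: near_ge_nat.
have n0 : (0 < n)%N by rewrite -(ltr_nat R); lra.
have hl : l / k <= n%:R by near: n; exact: near_ge_nat.
have hexp : 20 * n%:R <= expR (k * n%:R) by near: n; exact: near_lin_le_exp.
have ha : `|a n| <= k / l * n%:R by near: n; apply: ao; rewrite divr_gt0.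
have ha2 : `|a n| <= 1 / 2 * n%:R by near: n; apply: ao; rewrite divr_gt0.
have [[L Ln DL] Dmin] : (exists2 L, (L < n)%N & D n = `|a n - L%:R|) /\
    forall i, (i < n)%N -> D n <= `|a n - i%:R| by near: n.
have hD : D n * expR (s * n%:R) <= expR (k * n%:R) by near: n; exact: Ds.
move=> u ou; have uB := outer_bounded s0 ou.
pose m := Num.trunc `|a n|.
have am : `|a n| <= m.+1%:R by apply: ltW; exact: truncnS_gt.
have ma : m%:R <= `|a n| by rewrite truncn_le ?normr_ge0.
have lm : l * m.+1%:R <= 2 * (k * n%:R).
  rewrite -natr1 mulrDr mulr1.
  have : l * m%:R <= k * n%:R.
    have := ler_wpM2l (ltW l0) (le_trans ma ha).
    by rewrite mulrA [l * (k / l)]mulrC divfK ?gt_eqF.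
  have : l <= k * n%:R by rewrite mulrC -ler_pdivrMr.
  lra.
have Ek1 : 1 <= expR (k * n%:R) by have := expR_ge1Dx (k * n%:R); have := mulr_gt0 k0 (lt_le_trans ltr01 n1); lra.
have E4 := expR1_le4.
have kn0 : 0 <= k * n%:R by rewrite mulr_ge0 // ltW.
have dk : d = 8 * k by rewrite /k; lra.
have D0 : 0 <= D n by rewrite DL.
(* For a n <= - 1 the distance D n is at least 1, so the hypothesis on D n makes exp (s n) itself
   small. *)
have [an1|an1] := leP (a n) (-1).
  have D1 : 1 <= D n.
    rewrite DL ler0_norm; have := ler0n R L; lra.
  have mN : - a n <= m.+1%:R by rewrite -[leLHS]ger0_norm ?normrN //; lra.
  have := @lagq_far R n m (a n) s e B u n0 _ s0 _ ou uB B1.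
  rewrite mN e0 e1 andbT => /(_ ltac:(lra) isT).
  move/le_trans; apply; rewrite -exprMn.
  have h1 : (e^-1 * (B + 1)) ^+ m <= expR (2 * (k * n%:R)).
    rewrite -[e^-1 * _]lnK ?posrE; last lra.
    rewrite -expRM_natr ler_expR -/l2; apply: le_trans lm.
    by apply: ler_pM => //; rewrite ?ler_nat // /l /l1; lra.
  have h2 : expR ((s + 3 * e) * n%:R) <= expR (2 * (k * n%:R)).
    have -> : 2 * (k * n%:R) = k * n%:R + k * n%:R by ring.
    rewrite mulrDl !expRD; apply: ler_pM; rewrite ?expR_ge0 //.
      by apply: le_trans hD; rewrite ler_peMl ?expR_ge0.
    by rewrite ler_expR ler_wpM2r.
  have h3 : 2 * n%:R + expR 1 * n%:R * expR ((s + 3 * e) * n%:R) <= expR (3 * (k * n%:R)).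
    have -> : 3 * (k * n%:R) = k * n%:R + 2 * (k * n%:R) by ring.
    rewrite expRD; have Ek2 : 1 <= expR (2 * (k * n%:R)).
      by have := expR_ge1Dx (2 * (k * n%:R)); lra.
    have h4 : expR 1 * n%:R * expR ((s + 3 * e) * n%:R) <= 4 * n%:R * expR (2 * (k * n%:R)).
      by apply: ler_pM; rewrite ?mulr_ge0 ?expR_ge0 // ler_wpM2r.
    have h5 : 20 * n%:R * expR (2 * (k * n%:R)) <= expR (k * n%:R) * expR (2 * (k * n%:R)).
      by rewrite ler_wpM2r ?expR_ge0.
    have h6 : n%:R * 1 <= n%:R * expR (2 * (k * n%:R)) by rewrite ler_wpM2l.
    lra.
  apply: le_trans (ler_pM _ _ h1 h3) _.
  - by rewrite exprn_ge0 //; lra.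
  - by rewrite addr_ge0 ?mulr_ge0 ?expR_ge0.
  by rewrite -expRD ler_expR dk; lra.
(* The index trunc (a n), or 0 if a n is negative, is at distance less than 1. *)
have Dlt1 : D n < 1.
  have [an0|an0] := leP 0 (a n).
    have mn : (m < n)%N by rewrite -(ltr_nat R); lra.
    apply: le_lt_trans (Dmin _ mn) _; move: ma (truncnS_gt `|a n|); rewrite -/m -natr1.
    by rewrite (ger0_norm an0) => ? ?; rewrite ger0_norm; lra.
  by apply: le_lt_trans (Dmin 0%N n0) _; rewrite subr0 ler0_norm; lra.
have Lm : (L <= m.+1)%N.
  rewrite -ltnS -(ltr_nat R) -natr1.
  have : `|L%:R| <= `|a n| + D n.
    by rewrite DL distrC; apply: le_trans (ler_normD _ _); rewrite addrC subrK.
  by rewrite ger0_norm //; lra.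
have aE : a n = L%:R + (a n - L%:R) by rewrite addrC subrK.
have := lagq_near n0 Ln aE _ am s0 ou uB B1; rewrite -DL => /(_ Dlt1).
move/le_trans; apply.
have h1 : 2 ^+ (m.+1 + L) * B ^+ L.+1 <= expR (2 * (k * n%:R)).
  apply: (@le_trans _ _ (expR (2 * m.+1%:R) * expR (2 * (s + 2) * m.+1%:R))).
    apply: ler_pM; rewrite ?exprn_ge0 //; first lra.
      rewrite expRM_natr; apply: (@le_trans _ _ (2 ^+ (2 * m.+1))).
        by rewrite ler_weXn2l ?ler1n // mul2n -addnn leq_add2l.
      rewrite exprM; apply: lerXn2r; rewrite ?nnegrE ?expR_ge0 ?exprn_ge0 //.
      have := expR_ge1Dx (1 : R) => e1'.
      have -> : expR 2 = expR 1 ^+ 2 :> R by rewrite -expRM_natr; congr expR; ring.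
      by apply: lerXn2r; rewrite ?nnegrE ?expR_ge0 //; lra.
    have -> : expR (2 * (s + 2) * m.+1%:R) = B ^+ (m.+1 * 2).
      by rewrite exprM /B -!expRM_natr; congr expR; ring.
    by apply: ler_weXn2l => //; move: Lm; clear; lia.
  rewrite -expRD ler_expR; apply: le_trans lm.
  rewrite -mulrDl ler_wpM2r // /l /l1; lra.
have h3 : n%:R + D n * (3 * n%:R + expR 1 * n%:R * expR (s * n%:R)) <= expR (2 * (k * n%:R)).
  have -> : 2 * (k * n%:R) = k * n%:R + k * n%:R by ring.
  rewrite expRD.
  have h4 : expR 1 * n%:R * (D n * expR (s * n%:R)) <= 4 * n%:R * expR (k * n%:R).
    by apply: ler_pM; rewrite ?mulr_ge0 ?expR_ge0 // ler_wpM2r.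
  have h5 : 20 * n%:R * expR (k * n%:R) <= expR (k * n%:R) * expR (k * n%:R).
    by rewrite ler_wpM2r ?expR_ge0.
  have h6 : n%:R * 1 <= n%:R * expR (k * n%:R) by rewrite ler_wpM2l.
  have h7 : D n * n%:R <= 1 * n%:R by rewrite ler_wpM2r // ltW.
  lra.
apply: le_trans (ler_pM _ _ h1 h3) _.
- by rewrite mulr_ge0 ?exprn_ge0 //; lra.
- by rewrite addr_ge0 ?mulr_ge0 // addr_ge0 ?mulr_ge0 ?expR_ge0.
by rewrite -expRD ler_expR dk; lra.
Unshelve. all: by end_near. Qed.

End LaguerreSubexp.
(** * Zeros of the rescaled Laguerre polynomials *)

Section PowerSums.
Variable K : fieldType.

Lemma deriv_prod_XsubC (s : seq K) (x : K) : x \notin s ->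
  (\prod_(w <- s) ('X - w%:P))^`().[x] =
  (\prod_(w <- s) ('X - w%:P)).[x] * \sum_(w <- s) (x - w)^-1.
Proof.
elim: s => [|w s IH]; first by rewrite !big_nil mulr0 -polyC1 derivC horner0.
rewrite inE negb_or => /andP[xw xs].
rewrite !big_cons derivM derivXsubC mul1r hornerD !hornerM hornerXsubC IH //.
by rewrite mulrDr mulrA; field; rewrite subr_eq0.
Qed.

(** Write P = (X - z) Q with Q(z) nonzero: then P'(z) = Q(z) and P''(z) = 2 Q'(z), and Q' / Q is the
    sum of the inverse differences. *)
Lemma deriv2_prod_XsubC (s : seq K) (z : K) : uniq s -> z \in s ->
  let P := \prod_(w <- s) ('X - w%:P) in
  P^`().[z] != 0 /\
  P^`()^`().[z] = P^`().[z] * (2 * \sum_(w <- s | w != z) (z - w)^-1).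
Proof.
move=> us zs P.
have PE : P = ('X - z%:P) * \prod_(w <- rem z s) ('X - w%:P).
  by rewrite /P (perm_big _ (perm_to_rem zs)) big_cons.
have zr : z \notin rem z s by rewrite mem_rem_uniq // inE eqxx.
have P1 : P^`().[z] = (\prod_(w <- rem z s) ('X - w%:P)).[z].
  by rewrite PE derivM derivXsubC mul1r hornerD hornerM hornerXsubC subrr mul0r addr0.
split.
  rewrite P1 horner_prod prodf_seq_neq0; apply/allP => w wr /=.
  by rewrite hornerXsubC subr_eq0; apply/eqP => zw; move: zr; rewrite {1}zw wr.
have -> : \sum_(w <- s | w != z) (z - w)^-1 = \sum_(w <- rem z s) (z - w)^-1.
  by rewrite rem_filter // big_filter; apply: eq_bigl => w; rewrite inE.
rewrite P1 mulrCA -deriv_prod_XsubC // PE derivM derivXsubC mul1r derivD derivM derivXsubC mul1r.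
by rewrite !hornerD !hornerM hornerXsubC subrr; ring.
Qed.

(* Sum over the zeros z of z ^ m times the value at z of the differential      *)
(* equation divided by P'(z), and symmetrize the resulting double sum.         *)
Lemma power_sums_rec (s : seq K) (c N : K) (b : nat -> K) :
  uniq s -> (forall z, z \in s -> 2 * z * \sum_(w <- s | w != z) (z - w)^-1 = N * z - c) ->
  (forall m, b m = \sum_(z <- s) z ^+ m) ->
  forall m, N * b m.+1 = \sum_(i < m.+1) b (m - i)%N * b i + (c - m.+1%:R) * b m.
Proof.
move=> us hs bE m.
have E1 : N * b m.+1 - c * b m =
    \sum_(z <- s) \sum_(w <- s | w != z) 2 * z ^+ m.+1 * (z - w)^-1.
  rewrite !bE !mulr_sumr -sumrB; apply: eq_big_seq => z zs.
  rewrite -mulr_sumr exprS; have := hs z zs.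
  move: (\sum_(w <- s | w != z) (z - w)^-1) => S hS.
  have -> : 2 * (z * z ^+ m) * S = z ^+ m * (2 * z * S) by ring.
  by rewrite hS; ring.
(* Exchange the roles of z and w; then z^(m+1) and w^(m+1) combine into a difference divisible by z
   - w. *)
have E2 : \sum_(z <- s) \sum_(w <- s | w != z) z ^+ m.+1 * (z - w)^-1 =
    \sum_(z <- s) \sum_(w <- s | w != z) - (w ^+ m.+1 * (z - w)^-1).
  rewrite (exchange_big_dep xpredT) //=; apply: eq_bigr => z _.
  by apply: eq_big => [w|w _]; rewrite 1?eq_sym // -mulrN -invrN opprB.
have E3 : \sum_(z <- s) \sum_(w <- s | w != z) 2 * z ^+ m.+1 * (z - w)^-1 =
    \sum_(z <- s) \sum_(w <- s | w != z) \sum_(i < m.+1) z ^+ (m - i) * w ^+ i.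
  transitivity (\sum_(z <- s) \sum_(w <- s | w != z) z ^+ m.+1 * (z - w)^-1 +
      \sum_(z <- s) \sum_(w <- s | w != z) - (w ^+ m.+1 * (z - w)^-1)).
    rewrite -E2 -big_split; apply: eq_bigr => z _; rewrite -big_split.
    by apply: eq_bigr => w _ /=; ring.
  rewrite -big_split; apply: eq_bigr => z _; rewrite -big_split.
  apply: eq_bigr => w wz /=; rewrite -mulrBl subrXX mulrAC mulfV ?mul1r //.
  by rewrite subr_eq0 eq_sym.
have E4 : \sum_(z <- s) \sum_(w <- s) \sum_(i < m.+1) z ^+ (m - i) * w ^+ i =
    \sum_(i < m.+1) b (m - i)%N * b i.
  under eq_bigr do rewrite exchange_big.
  rewrite exchange_big; apply: eq_bigr => i _; rewrite !bE mulr_suml.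
  by apply: eq_bigr => z _; rewrite mulr_sumr.
(* The diagonal w = z contributes (m + 1) z^m for each z. *)
have E5 : \sum_(z <- s) \sum_(w <- s) \sum_(i < m.+1) z ^+ (m - i) * w ^+ i =
    m.+1%:R * b m +
    \sum_(z <- s) \sum_(w <- s | w != z) \sum_(i < m.+1) z ^+ (m - i) * w ^+ i.
  rewrite bE mulr_sumr -big_split; apply: eq_big_seq => z zs /=.
  rewrite (bigD1_seq z) //=; congr (_ + _).
  under eq_bigr => i _ do rewrite -exprD subnK ?leq_ord //.
  by rewrite sumr_const card_ord mulr_natl.
rewrite -E4 E5 -E3 -E1; ring.
Qed.

(** At a root z <> 0 of multiplicity m + 2, the term X P'' vanishes to order exactly m, with leading
    coefficient z (m + 1) (m + 2) Q(z), whereas the other terms vanish to higher order. *)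
Lemma ode_simple_roots (s : seq K) (c N M : K) : [pchar K] =i pred0 ->
  let P := \prod_(w <- s) ('X - w%:P) in
  'X * P^`()^`() + (c%:P - N *: 'X) * P^`() + M *: P = 0 ->
  0 \notin s -> uniq s.
Proof.
move=> ch P ode s0; apply/negPn/negP => /(uniqPn 0) h.
have [z zs zz] : exists2 z, z \in s & (1 < count_mem z s)%N.
  case: h => [i [j [ij js ee]]]; pose z := nth 0 s i.
  exists z; first by rewrite mem_nth // (ltn_trans ij).
  rewrite -(cat_take_drop j s) count_cat.
  have h1 : (0 < count_mem z (take j s))%N.
    rewrite -has_count has_pred1; apply/(nthP 0); exists i; last by rewrite nth_take.
    by rewrite size_take js.
  have h2 : (0 < count_mem z (drop j s))%N.
    rewrite -has_count has_pred1 /z ee; apply/(nthP 0); exists 0%N; last by rewrite nth_drop addn0.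
    by rewrite size_drop subn_gt0.
  by rewrite -(addn1 1) leq_add.
have z0 : z != 0 by apply: contraNneq s0 => <-.
pose m := (count_mem z s).-2.
have mE : count_mem z s = m.+2 by rewrite /m; case: (count_mem z s) zz => [|[]].
pose Q := \prod_(w <- [seq w <- s | w != z]) ('X - w%:P).
have PE : P = ('X - z%:P) ^+ m.+2 * Q.
  rewrite /P (bigID (pred1 z)) /= /Q big_filter; congr (_ * _).
  rewrite -mE -size_filter -big_filter.
  elim: s {P ode s0 h zs zz m mE Q} => [|w s IH]; first by rewrite big_nil expr0.
  by rewrite /=; case: eqP => [->|//]; rewrite big_cons /= exprS IH.
have Qz : Q.[z] != 0.
  rewrite horner_prod prodf_seq_neq0; apply/allP => w; rewrite mem_filter => /andP[wz _].
  by rewrite /= hornerXsubC subr_eq0 eq_sym.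
pose L : {poly K} := 'X - z%:P.
have L0 : L != 0 by rewrite -size_poly_eq0 size_XsubC.
have P1 : P^`() = L ^+ m.+1 * (m.+2%:R * Q + L * Q^`()).
  rewrite PE derivM deriv_exp derivXsubC mul1r /= -/L -[_ *+ m.+2]mulr_natl !exprS.
  by move: (L ^+ m) (m.+2%:R : {poly K}) => x k; ring.
have P2 : P^`()^`() = L ^+ m * (m.+1%:R * (m.+2%:R * Q + L * Q^`()) +
    L * (m.+2%:R * Q + L * Q^`())^`()).
  rewrite P1 derivM deriv_exp derivXsubC mul1r /= -/L -[_ *+ m.+1]mulr_natl !exprS.
  by move: (L ^+ m) (m.+1%:R : {poly K}) => x k; ring.
move: ode; rewrite P2 P1 PE -/L => ode.
pose G := 'X * (m.+1%:R * (m.+2%:R * Q + L * Q^`()) +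
    L * (m.+2%:R * Q + L * Q^`())^`()) +
    L * ((c%:P - N *: 'X) * (m.+2%:R * Q + L * Q^`()) + L * (M *: Q)).
have : L ^+ m * G = 0.
  rewrite -[RHS]ode /G -[N *: 'X]mul_polyC -[M *: Q]mul_polyC.
  by rewrite -[M *: (L ^+ _ * Q)]mul_polyC !exprS; ring.
move/eqP; rewrite mulf_eq0 expf_eq0 (negPf L0) andbF /= => /eqP G0.
have : G.[z] = z * (m.+1%:R * (m.+2%:R * Q.[z])).
  have Lz : L.[z] = 0 by rewrite hornerXsubC subrr.
  rewrite /G !hornerD !hornerM Lz !mul0r hornerX hornerD hornerM.
  by rewrite -!(rmorph_nat (@polyC K)) !hornerC !hornerD !hornerM Lz !mul0r !hornerC !addr0.
rewrite G0 horner0 => /esym/eqP.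
rewrite !mulf_eq0 (negPf z0) (negPf Qz) orbF.
have ch' k : (k.+1%:R == 0 :> K) = false.
  by apply/negbTE; move/pcharf0P: ch => ->.
by rewrite !ch'.
Qed.

End PowerSums.

(** * Recurrence and differential equation of the Laguerre polynomials *)

Section Coefficients.
Variable K : numFieldType.
Implicit Types a : K.

Lemma gbinomS a q : q.+1%:R * gbinom a q.+1 = (a - q%:R) * gbinom a q.
Proof.
have h1 : q`!%:R != 0 :> K by rewrite pnatr_eq0 -lt0n fact_gt0.
rewrite /gbinom big_ord_recr factS natrM /=; field.
by rewrite h1 addrC natr1 pnatr_eq0.
Qed.

Lemma gbinom0 a : gbinom a 0 = 1.
Proof. by rewrite /gbinom big_ord0 fact0 divr1. Qed.

Lemma gbinom_absorb a q : q.+1%:R * gbinom (a + 1) q.+1 = (a + 1) * gbinom a q.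
Proof.
have h1 : q`!%:R != 0 :> K by rewrite pnatr_eq0 -lt0n fact_gt0.
have -> : gbinom (a + 1) q.+1 = (a + 1) * (\prod_(i < q) (a - i%:R)) / q.+1`!%:R.
  rewrite /gbinom big_ord_recl subr0; congr (_ * _ / _); apply: eq_bigr => i _.
  by rewrite lift0 -natr1; ring.
rewrite /gbinom factS natrM; field.
by rewrite h1 addrC natr1 pnatr_eq0.
Qed.

Lemma laguerre_coef n a k : (laguerre n a)`_k =
  if (k <= n)%N then gbinom (n%:R + a) (n - k) / k`!%:R * (- 1) ^+ k else 0.
Proof.
have -> : laguerre n a = \poly_(k < n.+1)
    (gbinom (n%:R + a) (n - k) / k`!%:R * (- 1) ^+ k).
  rewrite poly_def; apply: eq_bigr => i _.
  by rewrite -[- 'X]scaleN1r exprZn scalerA.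
by rewrite coef_poly ltnS.
Qed.

(** The classical three-term recurrence, checked coefficient by coefficient. *)
Lemma laguerre_rec k a (x : K) :
  k.+2%:R * (laguerre k.+2 a).[x] =
  (k.*2.+3%:R + a - x) * (laguerre k.+1 a).[x] - (k.+1%:R + a) * (laguerre k a).[x].
Proof.
suff E : k.+2%:R%:P * laguerre k.+2 a =
    ((k.*2.+3%:R + a)%:P - 'X) * laguerre k.+1 a - (k.+1%:R + a)%:P * laguerre k a.
  have := congr1 (horner^~ x) E.
  by rewrite /= !hornerM hornerC !hornerD !hornerN !hornerM !hornerD !hornerN !hornerC hornerX.
apply/polyP => i; rewrite coefB !coefCM mulrBl coefB coefCM coefXM !laguerre_coef.
have kk : k.*2.+3%:R = 2 * k%:R + 3 :> K by rewrite -addnn -!natr1 natrD; ring.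
have [ik|ik] := leqP i k.+1; last first.
  rewrite [(i <= k)%N]leqNgt (ltn_trans _ ik) //= !mulr0 subr0.
  move: ik; rewrite leq_eqVlt => /predU1P[<-|ik].
    rewrite leqnn /= subnn leqnn subnn !gbinom0 factS natrM exprS sub0r.
    have h1 : k.+1`!%:R != 0 :> K by rewrite pnatr_eq0 -lt0n fact_gt0.
    have h2 : k.+2%:R != 0 :> K by rewrite pnatr_eq0.
    by move: (k.+1`!%:R) (k.+2%:R : K) h1 h2 => x1 x2 h1 h2; field; rewrite h1 h2.
  rewrite [(i <= k.+2)%N]leqNgt ik /= mulr0; case: i ik => //= i ik.
  by rewrite leqNgt -ltnS ik /= subr0.
rewrite (leqW ik); pose e := (k.+1 - i)%N.
have ke : k.+1 = (i + e)%N by rewrite subnKC.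
have kR : k%:R + 1 = i%:R + e%:R :> K by rewrite natr1 ke natrD.
have k1 : k.+1%:R = i%:R + e%:R :> K by rewrite -natrD -ke.
have k2 : k.+2%:R = i%:R + e%:R + 1 :> K by rewrite -natrD natr1 -ke.
have -> : (k.+2 - i)%N = e.+1 by rewrite subSn.
(* All the binomials in the coefficient of degree i are rational multiples of this one, with e = k +
   1 - i. *)
pose G := gbinom (k.+1%:R + a) e.
have E1 : gbinom (k.+2%:R + a) e.+1 = (i%:R + e%:R + 1 + a) / e.+1%:R * G.
  have e1 : e.+1%:R != 0 :> K by rewrite pnatr_eq0.
  apply: (mulfI e1).
  have -> : k.+2%:R + a = k.+1%:R + a + 1 by rewrite k1 k2; ring.
  by rewrite gbinom_absorb /G k1; field; rewrite addrC natr1.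
have E2 : (k.+1%:R + a) * (if (i <= k)%N then gbinom (k%:R + a) (k - i) / i`!%:R * (-1) ^+ i else 0) =
    e%:R * G / i`!%:R * (-1) ^+ i.
  move: ik; rewrite leq_eqVlt => /predU1P[ie|]; last first.
    rewrite ltnS => ik; rewrite ik /G.
    have -> : e = (k - i).+1 by rewrite /e subSn.
    have -> : k.+1%:R + a = k%:R + a + 1 by rewrite -natr1; ring.
    by rewrite gbinom_absorb !mulrA.
  by rewrite /e ie subnn ltnn mulr0 !mul0r.
rewrite E2 -/e -/G E1 kk.
have h1 : i`!%:R != 0 :> K by rewrite pnatr_eq0 -lt0n fact_gt0.
have h2 : e.+1%:R != 0 :> K by rewrite pnatr_eq0.
have kE : k%:R = i%:R + e%:R - 1 :> K by rewrite -kR; ring.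
have GE : gbinom (k.+1%:R + a) e = G by [].
case: i ik @e ke kR k1 k2 G GE E1 E2 h1 h2 kE => [|i] ik e ke kR k1 k2 G GE E1 E2 h1 h2 kE.
  rewrite /= subr0 k2 kE fact0; rewrite -[e.+1%:R]natr1 in h2 *.
  by move: (e%:R : K) h2 => x1 h2; field.
rewrite /= (ltnW ik).
have -> : (k.+1 - i)%N = e.+1 by rewrite /e subnSK.
have E3 : gbinom (k.+1%:R + a) e.+1 = (i.+1%:R + a) / e.+1%:R * G.
  apply: (mulfI h2); rewrite gbinomS GE k1; field.
  by rewrite addrC natr1.
rewrite E3 k2 kE factS natrM exprS.
have h3 : i`!%:R != 0 :> K by rewrite pnatr_eq0 -lt0n fact_gt0.
have h4 : i.+1%:R != 0 :> K by rewrite pnatr_eq0.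
rewrite -[e.+1%:R]natr1 in h2 *; rewrite -[i.+1%:R]natr1 in h4 *.
move: (i`!%:R) ((-1) ^+ i) (e%:R : K) (i%:R : K) h2 h3 h4 => x1 x2 x3 x4 h2 h3 h4.
by field; rewrite h2 h3 h4.
Qed.

Lemma laguerre_scaled n a (c : K) : laguerre n a \Po (c *: 'X) =
  \poly_(k < n.+1) (gbinom (n%:R + a) (n - k) / k`!%:R * (- c) ^+ k).
Proof.
rewrite poly_def /laguerre linear_sum /=; apply: eq_bigr => i _.
by rewrite linearZ /= rmorphXn rmorphN /= comp_polyX -scaleNr exprZn scalerA.
Qed.

(** Comparing coefficients, the equation amounts to the two-term recurrence [rec], the ratio of
    consecutive coefficients. *)
Lemma laguerre_scaled_ode n a : let N := n%:R in let P := laguerre n a \Po (N *: 'X) in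
  'X * P^`()^`() + ((a + 1)%:P - N *: 'X) * P^`() + (N ^+ 2) *: P = 0.
Proof.
move=> N P.
have rec k : k.+1%:R * (k.+1%:R + a) * P`_k.+1 = - (N * (N - k%:R)) * P`_k.
  rewrite /P laguerre_scaled !coef_poly.
  have [nk|kn] := leqP n k.
    rewrite ltnS ltnNge nk /= mulr0; move: nk; rewrite leq_eqVlt => /predU1P[<-|nk].
      by rewrite /N subrr mulr0 oppr0 mul0r.
    by rewrite ltnS leqNgt nk mulr0.
  rewrite !ltnS kn (ltnW kn); have -> : (n - k)%N = (n - k.+1).+1 by rewrite subnSK.
  set q := (n - k.+1)%N.
  have nq : n%:R = k%:R + 1 + q%:R :> K by rewrite natr1 -natrD subnKC.
  have h2 : q.+1%:R != 0 :> K by rewrite pnatr_eq0.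
  have E : gbinom (n%:R + a) q.+1 = (k%:R + 1 + a) / q.+1%:R * gbinom (n%:R + a) q.
    apply: (mulfI h2); rewrite gbinomS nq; field.
    by rewrite addrC natr1.
  rewrite E factS natrM exprS /N.
  have h1 : k`!%:R != 0 :> K by rewrite pnatr_eq0 -lt0n fact_gt0.
  have h3 : k.+1%:R != 0 :> K by rewrite pnatr_eq0.
  move: (gbinom (n%:R + a) q) ((- n%:R) ^+ k) => g x.
  rewrite nq -[q.+1%:R]natr1 in h2 *; rewrite -[k.+1%:R]natr1 in h3 *.
  move: (k`!%:R) (q%:R : K) (k%:R : K) h1 h2 h3 => x1 x2 x3 h1 h2 h3.
  by field; rewrite h1 h2 h3.
clearbody P; clearbody N.
apply/polyP => i; rewrite coef0 !coefD coefZ mulrBl coefB coefCM -scalerAl coefZ !coefXM.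
case: i => [|i] /=.
  have h := rec 0%N; rewrite mul1r subr0 in h.
  rewrite coef_deriv mulr0 subr0 add0r [a + 1]addrC [(1 + a) * _]h.
  by rewrite mulNr expr2 addNr.
rewrite !coef_deriv -[P`_i.+2 *+ i.+2]mulr_natl -[P`_i.+1 *+ i.+1]mulr_natl.
rewrite -[_ *+ i.+1]mulr_natl.
have := rec i.+1; move: (P`_i.+2) (P`_i.+1) => x y h.
transitivity (i.+2%:R * (i.+2%:R + a) * x + N * (N - i.+1%:R) * y).
  by rewrite -[i.+2%:R]natr1; move: (i.+1%:R : K) => j; ring.
by rewrite h; move: (i.+1%:R : K) => j; ring.
Qed.

End Coefficients.

(** * Product, power sums and size of the zeros *)

Section Zeros.
Variable R : realType.
Local Notation C := R[i].

Lemma zerosE (p : {poly C}) : p = lead_coef p *: \prod_(z <- zeros p) ('X - z%:P).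
Proof. exact: (svalP (closed_field_poly_normal p)). Qed.

Lemma gbinomC (a : R) q : gbinom a%:C q = (gbinom a q)%:C.
Proof.
rewrite /gbinom rmorphM fmorphV rmorph_nat rmorph_prod; congr (_ / _).
by apply: eq_bigr => i _; rewrite rmorphB rmorph_nat.
Qed.

Lemma risingf_gbinom (a : R) q : risingf (- a) q = (-1) ^+ q * gbinom a q.
Proof.
rewrite /risingf /gbinom mulrA; congr (_ / _).
rewrite -[X in _ ^+ X]card_ord -prodrN; apply: eq_bigr => i _; ring.
Qed.

Definition lagzeros (n : nat) (al : R) : seq C :=
  zeros (laguerre n al%:C \Po (n%:R *: 'X)).

Section Fixed.
Variables (n : nat) (al : R).
Hypothesis n_gt0 : (0 < n)%N.
Let P : {poly C} := laguerre n al%:C \Po (n%:R *: 'X).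
Let s := lagzeros n al.
Let a := n%:R + al.

Let nC : n%:R != 0 :> C. Proof. by rewrite pnatr_eq0 -lt0n. Qed.
Let nR : 0 < n%:R :> R. Proof. by rewrite ltr0n. Qed.
Let aC : n%:R + al%:C = a%:C :> C. Proof. by rewrite rmorphD rmorph_nat. Qed.

Let P_eq : P = \poly_(k < n.+1)
  ((gbinom a (n - k))%:C / k`!%:R * (- n%:R) ^+ k).
Proof.
rewrite /P laguerre_scaled aC; apply/polyP => i; rewrite !coef_poly.
by case: ifP => // _; rewrite gbinomC.
Qed.

Let fC k : k`!%:R != 0 :> C. Proof. by rewrite pnatr_eq0 -lt0n fact_gt0. Qed.

Let top_neq0 : (gbinom a (n - n))%:C / n`!%:R * (- n%:R) ^+ n != 0 :> C.
Proof.
by rewrite subnn gbinom0 rmorph1 mul1r mulf_neq0 ?invr_eq0 ?fC // expf_neq0 // oppr_eq0.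
Qed.

Let lead_P : lead_coef P = (- n%:R) ^+ n / n`!%:R.
Proof.
by rewrite P_eq lead_coef_poly // subnn gbinom0 rmorph1 mul1r mulrC.
Qed.

Let lead_neq0 : lead_coef P != 0.
Proof. by rewrite lead_P mulf_neq0 ?invr_eq0 ?fC // expf_neq0 // oppr_eq0. Qed.

Let PE : P = lead_coef P *: \prod_(z <- s) ('X - z%:P).
Proof. exact: zerosE. Qed.

Lemma size_lagzeros : size s = n.
Proof.
have : size P = n.+1 by rewrite P_eq size_poly_eq.
by rewrite PE size_scale // size_prod_XsubC => -[].
Qed.

(** The left-hand side times the leading coefficient is the reversed polynomial u^n P(1 / u). *)
Lemma lagzeros_prod (u : C) : \prod_(z <- s) (1 - z * u) = lagq n a u.
Proof.
have [->|u0] := eqVneq u 0.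
  rewrite big1 => [|z _]; last by rewrite mulr0 subr0.
  rewrite /lagq big_ord_recl risingf0 ffactn0 expr0 !mul1r big1 ?addr0 // => i _.
  by rewrite mul0r exprS mul0r !mulr0.
apply: (mulfI lead_neq0).
have E1 : lead_coef P * \prod_(z <- s) (1 - z * u) = u ^+ n * P.[u^-1].
  rewrite [in RHS]PE hornerZ horner_prod mulrCA; congr (_ * _).
  rewrite -size_lagzeros; elim: (s) => [|z s' IH]; first by rewrite !big_nil mulr1.
  rewrite !big_cons IH exprS hornerXsubC; field.
  by rewrite u0.
rewrite E1 lead_P P_eq horner_poly /lagq !mulr_sumr (reindex_inj rev_ord_inj) /=.
apply: eq_bigr => q _.
have qn : (q <= n)%N by rewrite -ltnS.
rewrite subSS subKn // risingf_gbinom.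
have -> : ((-1) ^+ q * gbinom a q)%:C = (-1) ^+ q * (gbinom a q)%:C :> C.
  by rewrite rmorphM rmorphXn rmorphN rmorph1.
have -> : n`!%:R = (n ^_ q)%:R * (n - q)`!%:R :> C by rewrite -natrM ffact_fact.
have h1 : (n ^_ q)%:R != 0 :> C by rewrite pnatr_eq0 -lt0n ffact_gt0.
have h2 := fC (n - q).
have -> : u ^+ n = u ^+ q * u ^+ (n - q) by rewrite -exprD subnKC.
have -> : (- n%:R) ^+ n = (- n%:R) ^+ q * (- n%:R) ^+ (n - q) :> C by rewrite -exprD subnKC.
have -> : (- n%:R) ^+ q = (-1) ^+ q * n%:R ^+ q :> C by rewrite -exprMn mulN1r.
rewrite expr_div_n exprVn.
have h3 : u ^+ (n - q) != 0 by rewrite expf_neq0.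
have h4 : n%:R ^+ q != 0 :> C by rewrite expf_neq0.
have h5 : (-1) ^+ q * (-1) ^+ q = 1 :> C by rewrite -exprMn mulrNN mulr1 expr1n.
move: ((-1) ^+ q) h5 h1 h2 h3 h4 => x h5.
move: ((n ^_ q)%:R : C) ((n - q)`!%:R : C) (u ^+ (n - q)) (n%:R ^+ q : C) => x1 x2 x3 x4.
move: ((- n%:R) ^+ (n - q)) (u ^+ q) (gbinom a q)%:C => x5 x6 x7 h1 h2 h3 h4.
(* The sign (- 1)^q occurs on both sides; its square is inserted so that the signs match. *)
transitivity (x * x * (x6 * x7 * x5 / x2)); first by rewrite h5; field; rewrite h2 h3.
by field; rewrite h1 h2 h4.
Qed.

Lemma lagzeros_prod_abs : \prod_(z <- s) absc z = (\prod_(i < n) `|a - i%:R|) / n%:R ^+ n.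
Proof.
have : P.[0] = (gbinom a n)%:C.
  rewrite horner_coef0 P_eq coef_poly /= subn0 fact0.
  by rewrite expr0 divr1 mulr1.
rewrite PE hornerZ horner_prod => /(congr1 (@absc R)).
rewrite abscM lead_P absc_div abscX abscN !absc_nat absc_real absc_prod.
rewrite (eq_bigr (@absc R)) => [h|z _]; last by rewrite hornerXsubC sub0r abscN.
have f0 : n`!%:R != 0 :> R by rewrite pnatr_eq0 -lt0n fact_gt0.
have n0 : n%:R ^+ n != 0 :> R by rewrite expf_neq0 // gt_eqF.
move: h; rewrite /gbinom normrM normr_prod normfV (ger0_norm (ler0n R _)).
move: (\prod_(z <- s) absc z) (\prod_(i < n) `|a - i%:R|) => x y h.
apply: (mulfI n0); rewrite mulrCA mulfV // mulr1.
by apply: (mulIf (x := n`!%:R^-1)); rewrite ?invr_eq0 // -h; ring.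
Qed.

Hypothesis al_notin : forall j, (1 <= j <= n)%N -> al != - j%:R.

(** The product of the moduli is nonzero: a - i = al + (n - i), and al avoids - 1, ..., - n. *)
Lemma lagzeros_neq0 z : z \in s -> z != 0.
Proof.
move=> zs; apply/eqP => z0.
have : \prod_(z <- s) absc z != 0.
  rewrite lagzeros_prod_abs mulf_neq0 ?invr_eq0 ?expf_neq0 ?gt_eqF //.
  apply: prodr_gt0 => i _; rewrite normr_gt0 subr_eq0 /a.
  have /al_notin : (1 <= n - i <= n)%N by rewrite subn_gt0 ltn_ord leq_subr.
  by apply: contraNneq => h; rewrite natrB ?(ltnW (ltn_ord i)) // opprB -h [_ + al]addrC addrK.
rewrite prodf_seq_neq0 => /allP /(_ z zs) /=.
by rewrite z0 absc0 eqxx.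
Qed.

Let ode : let M := \prod_(z <- s) ('X - z%:P) in
  'X * M^`()^`() + ((al%:C + 1)%:P - n%:R *: 'X) * M^`() + (n%:R ^+ 2) *: M = 0.
Proof.
move=> M; have := laguerre_scaled_ode n al%:C; rewrite /= -/P PE -/M !derivZ.
move: lead_neq0; move: (lead_coef P) => c c0 E.
apply: (scalerI c0); rewrite scaler0 -[RHS]E !scalerDr !scalerAr !scalerA.
by rewrite [c * _]mulrC.
Qed.

Let pcharC : [pchar C] =i pred0.
Proof. exact: pchar_num. Qed.

Lemma lagzeros_uniq : uniq s.
Proof.
apply: (ode_simple_roots pcharC ode); apply/negP => /lagzeros_neq0.
by rewrite eqxx.
Qed.

(** At a simple zero z the differential equation reads 2 z sum (z - w)^(-1) = n z - (al + 1), which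
    is the hypothesis of [power_sums_rec]. *)
Lemma lagzeros_sums m :
  n%:R * \sum_(z <- s) z ^+ m.+1 =
  \sum_(i < m.+1) (\sum_(z <- s) z ^+ (m - i)) * (\sum_(z <- s) z ^+ i) +
  (al%:C - m%:R) * \sum_(z <- s) z ^+ m.
Proof.
have -> : al%:C - m%:R = (al%:C + 1) - m.+1%:R :> C by rewrite -natr1; ring.
apply: (@power_sums_rec _ s (al%:C + 1) n%:R (fun k => \sum_(z <- s) z ^+ k)) => //.
  exact: lagzeros_uniq.
move=> z zs; have [M1 M2] := deriv2_prod_XsubC lagzeros_uniq zs.
have := congr1 (horner^~ z) ode; rewrite /= horner0.
have Mz : (\prod_(w <- s) ('X - w%:P)).[z] = 0.
  by rewrite horner_prod (big_rem z) //= hornerXsubC subrr mul0r.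
rewrite hornerD hornerZ Mz mulr0 addr0.
rewrite hornerD !hornerM hornerX hornerD hornerN hornerZ hornerX hornerC M2.
move: M1; move: (_^`().[z]) (\sum_(w <- s | w != z) (z - w)^-1) => x S x0 h.
apply: (mulfI x0); apply/eqP; rewrite -subr_eq0; apply/eqP; rewrite -[RHS]h.
ring.
Qed.

(** Beyond this radius the three-term recurrence makes |L_k (n z)| nondecreasing in k, starting from
    L_0 = 1, so L_n cannot vanish at n z. *)
Lemma lagzeros_bound z : z \in s -> n%:R * absc z < 4 * n%:R + 2 * `|al| + 2.
Proof.
move=> zs; rewrite ltNge; apply/negP => hz.
pose x : C := n%:R * z.
have ax : absc x = n%:R * absc z by rewrite abscM absc_nat.
have root_x : (laguerre n al%:C).[x] = 0.
  have : P.[z] = 0 by rewrite PE hornerZ horner_prod (big_rem z) //= hornerXsubC subrr mul0r mulr0.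
  by rewrite horner_comp hornerZ hornerX.
pose l k := absc (laguerre k al%:C).[x].
have l0 : l 0%N = 1.
  by rewrite /l /laguerre big_ord1 gbinom0 fact0 divr1 expr0 hornerZ hornerC mulr1 absc1.
have n1 : 1 <= n%:R :> R by rewrite ler1n.
have al0 := normr_ge0 al.
have l1 : 1 <= l 1%N.
  have -> : l 1%N = absc ((1 + al)%:C - x).
    rewrite /l /laguerre big_ord_recr big_ord1 /= gbinom0 hornerD !hornerZ.
    rewrite expr0 expr1 hornerC hornerN hornerX /gbinom big_ord1 !subr0 subn0.
    by rewrite !mulr1n !divr1 mulr1 mul1r rmorphD rmorph1.
  rewrite absc_distC; apply: le_trans (absc_triangle_sub _ _).
  rewrite absc_real ax; have := ler_normD 1 al; rewrite normr1; lra.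
have H k : (k.+1 <= n)%N -> 1 <= l k.+1 /\ l k <= l k.+1.
  elim: k => [_|k IH kn]; first by rewrite l0.
  have [h1 h2] := IH (ltnW kn).
  suff h3 : l k.+1 <= l k.+2 by split => //; apply: le_trans h3.
  have := congr1 (@absc R) (laguerre_rec k al%:C x).
  rewrite abscM absc_nat -/(l k.+2) => E.
  have k2 : 0 < k.+2%:R :> R by [].
  rewrite -(ler_pM2l k2) E; apply: le_trans (absc_triangle_sub _ _).
  rewrite !abscM -/(l k.+1) -/(l k).
  have kR : k%:R + 2 <= n%:R :> R by rewrite -natrD ler_nat addn2.
  have a1 : absc (k.+1%:R + al%:C) <= k%:R + 1 + `|al|.
    apply: le_trans (absc_triangle _ _) _; rewrite absc_nat absc_real -natr1.
    exact: lexx.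
  have a2 : absc x - (2 * k%:R + 3 + `|al|) <= absc (k.*2.+3%:R + al%:C - x).
    rewrite absc_distC; apply: le_trans (absc_triangle_sub _ _); rewrite lerD2l lerN2.
    apply: le_trans (absc_triangle _ _) _; rewrite absc_nat absc_real lerD2r.
    by rewrite -muln2 -addn3 natrD natrM mulrC.
  have l_0 : 0 <= l k by exact: absc_ge0.
  have h4 : absc (k.+1%:R + al%:C) * l k <= (k%:R + 1 + `|al|) * l k.+1.
    by apply: ler_pM => //; exact: absc_ge0.
  have h5 : (absc x - (2 * k%:R + 3 + `|al|)) * l k.+1 <= absc (k.*2.+3%:R + al%:C - x) * l k.+1.
    by rewrite ler_wpM2r //; lra.
  have h6 : (k%:R + 2) * l k.+1 <= (absc x - (2 * k%:R + 3 + `|al|) - (k%:R + 1 + `|al|)) * l k.+1.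
    by rewrite ler_wpM2r //; lra.
  have -> : k.+2%:R = k%:R + 2 :> R by rewrite -natrD addn2.
  lra.
have [] := H n.-1; rewrite prednK //.
by rewrite /l root_x absc0; lra.
Qed.

End Fixed.
End Zeros.

(** * Products of distances to integers *)

Section ProductBound.
Variable R : realType.

(** A lower bound for the product of the distances from a to k consecutive integers on one side of
    the nearest one. *)
Let g k : R := \prod_(j < k) Num.max (1 / 2) j%:R.

Let g_ge (n k : nat) : (0 < n)%N -> (k <= n)%N -> k`!%:R / (2 * n%:R) <= g k.
Proof.
move=> n0; have nR : 1 <= n%:R :> R by rewrite ler1n.
have n2 : 0 < 2 * n%:R :> R by lra.
case: k => [_|k kn].
  by rewrite /g big_ord0 fact0 div1r invf_le1 //; lra.
have : k`!%:R / 2 <= g k.+1.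
  elim: k {kn} => [|k IH].
    by rewrite /g big_ord1 fact0 le_max lexx.
  rewrite /g big_ord_recr /= -/(g k.+1) factS natrM.
  rewrite [k.+1%:R * _]mulrC mulrAC; apply: ler_pM; rewrite ?divr_ge0 //.
  by rewrite le_max lexx orbT.
apply: le_trans; rewrite factS natrM ler_pdivrMr //.
have -> : k`!%:R / 2 * (2 * n%:R) = n%:R * k`!%:R :> R by field.
by rewrite ler_wpM2r // ler_nat.
Qed.

(** The integers at distance j + 1 from the nearest index L are at distance at least max(1 / 2, j)
    from a. The two sides thus give L! and (n - L - 1)! up to factors 2 n, and together with
    binom(n, L) these recover n!. *)
Lemma prod_dist_ge (n L : nat) (a : R) : (L < n)%N ->
  (forall i, (i < n)%N -> `|a - L%:R| <= `|a - i%:R|) -> `|a - L%:R| <= 1 \/ a < 0 ->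
  `|a - L%:R| * n`!%:R <= (\prod_(i < n) `|a - i%:R|) * (4 * n%:R ^+ 3 * 'C(n, L)%:R).
Proof.
move=> Ln amin aD; have n0 : (0 < n)%N by exact: leq_ltn_trans Ln.
set D := `|a - L%:R| in amin aD *.
have D0 : 0 <= D by exact: normr_ge0.
have nR : 0 < n%:R :> R by rewrite ltr0n.
(* |i - L| is at most |a - i| + D: with D <= |a - i| this gives 1 / 2, and with D <= 1 the second
   bound. If a < 0, then L = 0 and |a - i| = i - a. *)
have far i : (i < n)%N -> i != L ->
    1 / 2 <= `|a - i%:R| /\ `|i%:R - L%:R| - 1 <= `|a - i%:R|.
  move=> iN iL; have h := amin i iN.
  have t : `|i%:R - L%:R| <= `|a - i%:R| + D.
    have -> : i%:R - L%:R = (i%:R - a) + (a - L%:R) by ring.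
    by rewrite (distrC a); exact: ler_normD.
  have d1 : 1 <= `|i%:R - L%:R| :> R.
    have [il|li] := ltnP i L.
      rewrite distrC ger0_norm ?subr_ge0 ?ler_nat ?(ltnW il) //.
      by rewrite lerBrDr addrC natr1 ler_nat.
    rewrite ger0_norm ?subr_ge0 ?ler_nat //.
    by rewrite lerBrDr addrC natr1 ler_nat ltn_neqAle eq_sym iL.
  split; first by lra.
  case: aD => [|a0]; first lra.
  have L0 : L = 0%N.
    apply/eqP; rewrite -leqn0 -(ler_nat R).
    have := amin 0%N n0; rewrite subr0 /D !ler0_norm //; try lra.
    by have := ler0n R L; lra.
  rewrite L0 subr0 ger0_norm // ler0_norm; have := ler0n R i; lra.
pose p := (n - L.+1)%N.
have nE : n = (L + (1 + p))%N by rewrite /p; lia.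
have prodE : \prod_(i < n) `|a - i%:R| =
    (\prod_(j < L) `|a - (L - j.+1)%:R|) * (D * \prod_(k < p) `|a - (L.+1 + k)%:R|).
  rewrite -[X in \prod_(i < X) _]/n nE big_split_ord /= big_split_ord big_ord1 /= addn0.
  congr (_ * (_ * _)); last by apply: eq_bigr => k _; rewrite addnA addn1.
  by rewrite (reindex_inj rev_ord_inj).
have h1 : L`!%:R / (2 * n%:R) <= \prod_(j < L) `|a - (L - j.+1)%:R|.
  apply: le_trans (g_ge n0 (ltnW Ln)) _; apply: ler_prod => j _.
  have jL := ltn_ord j.
  have [||f1 f2] := far (L - j.+1)%N; [by lia|by lia|].
  rewrite le_max ler0n orbT /= ge_max f1 /=; apply: le_trans f2.
  rewrite natrB // -natr1 distrC; have := ler0n R j => j0.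
  by rewrite ger0_norm; lra.
have h2 : p`!%:R / (2 * n%:R) <= \prod_(k < p) `|a - (L.+1 + k)%:R|.
  apply: le_trans (g_ge n0 _) _; first by rewrite /p leq_subr.
  apply: ler_prod => k _; have kp := ltn_ord k.
  have [||f1 f2] := far (L.+1 + k)%N; [by move: kp; rewrite /p; lia|by lia|].
  rewrite le_max ler0n orbT /= ge_max f1 /=; apply: le_trans f2.
  rewrite natrD -natr1; have := ler0n R k => k0.
  by rewrite ger0_norm; lra.
have f0 (k : nat) : 0 <= k`!%:R :> R by [].
have nf : n`!%:R <= n%:R * ('C(n, L)%:R * (L`!%:R * p`!%:R)) :> R.
  rewrite -!natrM ler_nat -(bin_fact (ltnW Ln)).
  have -> : (n - L)%N = p.+1 by rewrite /p subnSK.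
  rewrite factS [(L`! * (_ * _))%N]mulnCA [('C(n, L) * (p.+1 * _))%N]mulnCA.
  by rewrite leq_mul2r; apply/orP; right; rewrite /p; lia.
rewrite prodE.
have e2n : 0 < 2 * n%:R :> R by lra.
rewrite ler_pdivrMr // in h1; rewrite ler_pdivrMr // in h2.
have P1 : 0 <= \prod_(j < L) `|a - (L - j.+1)%:R| by apply: prodr_ge0.
have P2 : 0 <= \prod_(k < p) `|a - (L.+1 + k)%:R| by apply: prodr_ge0.
have h3 := ler_pM (f0 L) (f0 p) h1 h2.
have C0 : 0 <= 'C(n, L)%:R :> R by [].
apply: le_trans (ler_wpM2l D0 nf) _.
apply: le_trans (ler_wpM2l D0 (ler_wpM2l (ltW nR) (ler_wpM2l C0 h3))) _.
by rewrite le_eqVlt; apply/orP; left; apply/eqP; ring.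
Qed.

(** One term of the binomial expansion of (1 + x)^n, which is at most exp (x n). With x small and L
    = o(n) the bound is exp (o(n)). *)
Lemma bin_le_exp (n L : nat) (x : R) : 0 < x -> (L <= n)%N ->
  'C(n, L)%:R <= expR (x * n%:R + L%:R * - ln x).
Proof.
move=> x0 Ln.
have h : 'C(n, L)%:R * x ^+ L <= expR (x * n%:R).
  apply: (@le_trans _ _ ((1 + x) ^+ n)).
    rewrite exprDn (bigD1 (Ordinal (Ln : L < n.+1)%N)) //= expr1n mul1r mulr_natl lerDl.
    by apply: sumr_ge0 => i _; rewrite expr1n mul1r mulrn_wge0 // exprn_ge0 // ltW.
  rewrite expRM_natr; apply: lerXn2r; rewrite ?nnegrE ?expR_ge0 ?expR_ge1Dx //.
  lra.
rewrite expRD mulrN expRN [L%:R * ln x]mulrC [expR (ln x * _)]expRM_natr lnK ?posrE //.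
by rewrite ler_pdivlMr // exprn_gt0.
Qed.

Lemma fact_ge_exp (n : nat) : (0 < n)%N -> n%:R ^+ n <= n`!%:R * expR n%:R :> R.
Proof.
case: n => // n _; have f0 : 0 < n.+1`!%:R :> R by rewrite ltr0n fact_gt0.
rewrite mulrC -ler_pdivrMr //.
by have := @expR_ge1Dxn R n.+1%:R n (ler0n _ _); lra.
Qed.

End ProductBound.

Section DistS.
Variable R : realType.

(** With i = n - j, the distance from al to {- n, ..., - 1} is that from a = n + al to {0, ..., n -
    1}. *)
Lemma distS_props (n : nat) (al : R) : (0 < n)%N ->
  let a := n%:R + al in
  (exists2 L, (L < n)%N & distS n al = `|a - L%:R|) /\
  forall i, (i < n)%N -> distS n al <= `|a - i%:R|.
Proof.
move=> n0 a.
have aE i : (i < n)%N -> `|a - i%:R| = `|al + (n - i)%:R|.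
  by move=> iN; rewrite natrB ?(ltnW iN) // /a; congr `|_|; ring.
split; last first.
  move=> i iN; rewrite aE //; apply: ge_bigmin_seq => //.
  by rewrite mem_index_iota; lia.
suff [j jn ->] : exists2 j, (1 <= j <= n)%N & distS n al = `|al + j%:R|.
  exists (n - j)%N; first by lia.
  by rewrite aE; [congr `|_ + _%:R|; lia|lia].
rewrite /distS.
have : forall (r : seq nat), (forall j, j \in r -> (1 <= j <= n)%N) ->
    exists2 j, (1 <= j <= n)%N & \big[Num.min/`|al + 1|]_(j <- r) `|al + j%:R| = `|al + j%:R|.
  elim=> [|i r IH] hr; first by exists 1%N => //; rewrite big_nil.
  have [j jn E] : exists2 j, (1 <= j <= n)%N &
      \big[Num.min/`|al + 1|]_(j <- r) `|al + j%:R| = `|al + j%:R|.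
    by apply: IH => j jr; apply: hr; rewrite inE jr orbT.
  rewrite big_cons E minEle; case: ifP => _; last by exists j.
  by exists i => //; apply: hr; rewrite mem_head.
by apply => j; rewrite mem_index_iota ltnS.
Qed.

End DistS.

(** * Asymptotics under the hypotheses on alpha *)

Section Asymptotics.
Variable R : realType.
Local Notation C := R[i].
Variable alpha : nat -> R.
Hypothesis alpha_notin : forall n j : nat, (1 <= j <= n)%N -> alpha n != - j%:R.
Hypothesis alpha_lim : alpha n / n%:R @[n --> \oo] --> (-1 : R).

Let zs n := lagzeros n (alpha n).
Let a n := n%:R + alpha n.
Let D n := distS n (alpha n).

Lemma shifted_small (k : R) : 0 < k -> \forall n \near \oo, `|a n| <= k * n%:R.
Proof.
move=> k0; have /cvgrPdist_lt /(_ _ k0) H := alpha_lim; near=> n.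
have n0 : 0 < n%:R :> R.
  by apply: lt_le_trans (ltr01) _; near: n; exact: near_ge_nat.
have : `|-1 - alpha n / n%:R| < k by near: n.
rewrite -normrN opprD !opprK => h.
have -> : a n = (1 + alpha n / n%:R) * n%:R by rewrite /a; field; rewrite gt_eqF.
by rewrite normrM (ger0_norm (ltW n0)) ler_wpM2r ?(ltW n0) // ltW.
Unshelve. all: by end_near. Qed.

Lemma near_distS : \forall n \near \oo, (exists2 L, (L < n)%N & D n = `|a n - L%:R|) /\
     forall i, (i < n)%N -> D n <= `|a n - i%:R|.
Proof. by exists 1%N => // n /= n0; exact: distS_props. Qed.

Lemma lagzeros_subexp (s : R) : 0 <= s ->
  (forall d, 0 < d -> \forall n \near \oo, D n * expR (s * n%:R) <= expR (d * n%:R)) ->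
  subexp_on (outer s) zs.
Proof.
move=> s0 hD d d0.
have := lagq_subexp s0 shifted_small near_distS hD d0.
move=> H; near=> n; move=> u ou.
rewrite lagzeros_prod; last by near: n; exists 1%N.
by move: u ou; near: n.
Unshelve. all: by end_near. Qed.

Lemma lagzeros_bounded : \forall n \near \oo, forall z, z \in zs n -> absc z <= 10.
Proof.
near=> n; move=> z zsn.
have n0 : (0 < n)%N by near: n; exists 1%N.
have n1 : 1 <= n%:R :> R by rewrite ler1n.
have := lagzeros_bound n0 zsn.
have : `|a n| <= 1 * n%:R by near: n; exact: shifted_small.
have : `|alpha n| <= `|a n| + n%:R.
  have -> : alpha n = a n - n%:R by rewrite /a addrC addKr.
  by apply: le_trans (ler_normB _ _) _; rewrite [`|n%:R|]ger0_norm.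
move=> h1 h2 h3; rewrite -(ler_pM2l (lt_le_trans ltr01 n1)); lra.
Unshelve. all: by end_near. Qed.

(** Strong induction on m. The first power sum equals n + alpha n = o(n). In the recurrence for a
    later one, divided by n, every product has a factor that is o(n) by induction and another of
    size at most n, and alpha n is of order n. *)
Lemma lagzeros_means (m : nat) (e : R) : (0 < m)%N -> 0 < e ->
  \forall n \near \oo, absc (\sum_(z <- zs n) z ^+ m) <= e * n%:R.
Proof.
elim/ltn_ind: m e => -[//|[|m]] IH e _ e0.
  near=> n.
  have n0 : (0 < n)%N by near: n; exists 1%N.
  have nR : n%:R != 0 :> R by rewrite pnatr_eq0 -lt0n.
  have nC : n%:R != 0 :> C by rewrite pnatr_eq0 -lt0n.
  have al_n j : (1 <= j <= n)%N -> alpha n != - j%:R by exact: alpha_notin.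
  have := lagzeros_sums n0 al_n 0.
  have s0 : \sum_(z <- zs n) z ^+ 0 = n%:R :> C.
    under eq_bigr do rewrite expr0.
    by rewrite big_const_seq count_predT iter_addr_0 size_lagzeros.
  rewrite big_ord1 subn0 -/(zs n) s0 subr0 -mulrDl [_ * n%:R]mulrC => /(mulfI nC) ->.
  have -> : n%:R + (alpha n)%:C = (a n)%:C by rewrite rmorphD rmorph_nat.
  by rewrite absc_real; near: n; exact: shifted_small.
(* For the power m + 2 there are m + 2 products, and the last term is of size at most 3 n times a
   small sum: in all (m + 5) e' n^2. *)
pose e' := Num.min 1 (e / (m%:R + 6)).
have m6 : 0 < m%:R + 6 :> R by rewrite ltr_wpDl.
have e'0 : 0 < e' by rewrite lt_min ltr01 divr_gt0.
have e'1 : e' <= 1 by rewrite ge_min lexx.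
have e'e : e' * (m%:R + 6) <= e by rewrite -ler_pdivlMr // ge_min lexx orbT.
have small : \forall n \near \oo, forall j, (0 < j < m.+2)%N ->
    absc (\sum_(z <- zs n) z ^+ j) <= e' * n%:R.
  have : \forall n \near \oo, forall j : 'I_m.+2, (0 < j)%N ->
      absc (\sum_(z <- zs n) z ^+ j) <= e' * n%:R.
    apply: filter_forall => j; have [j0|j0] := posnP j.
      by apply: nearW => n h; move: (h); rewrite {1}j0.
    have := IH j (ltn_ord j) e' j0 e'0.
    by apply: filterS => n h _.
  by apply: filterS => n h j /andP[j0 jm]; exact: (h (Ordinal jm)).
near=> n.
have n0 : (0 < n)%N by near: n; exists 1%N.
have nR : 1 <= n%:R :> R by rewrite ler1n.
have al_n j : (1 <= j <= n)%N -> alpha n != - j%:R by exact: alpha_notin.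
have s0 : absc (\sum_(z <- zs n) z ^+ 0) <= n%:R.
  under eq_bigr do rewrite expr0.
  by rewrite big_const_seq count_predT iter_addr_0 size_lagzeros // absc_nat.
have hj : forall j, (0 < j < m.+2)%N ->
    absc (\sum_(z <- zs n) z ^+ j) <= e' * n%:R by near: n.
have han : `|a n| <= 1 * n%:R by near: n; exact: shifted_small.
have hm : m.+1%:R <= n%:R :> R by near: n; exact: near_ge_nat.
have e'n : e' * n%:R <= n%:R by rewrite ler_piMl.
have := congr1 (@absc R) (lagzeros_sums n0 al_n m.+1).
rewrite abscM absc_nat => E; rewrite -(ler_pM2l (lt_le_trans ltr01 nR)) E.
apply: le_trans (absc_triangle _ _) _.
have t1 : absc (\sum_(i < m.+2) (\sum_(z <- zs n) z ^+ (m.+1 - i)) * (\sum_(z <- zs n) z ^+ i)) <=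
    (m%:R + 2) * (n%:R * (e' * n%:R)).
  apply: le_trans (absc_sum _ _ _) _.
  have -> : (m%:R + 2) * (n%:R * (e' * n%:R)) = \sum_(i < m.+2) n%:R * (e' * n%:R).
    have -> : m%:R + 2 = m.+2%:R :> R by rewrite -natrD addn2.
    by rewrite sumr_const card_ord [LHS]mulr_natl.
  apply: ler_sum => i _; rewrite abscM.
  have [i0|i0] := posnP i.
    rewrite i0 subn0 mulrC; apply: ler_pM; rewrite ?absc_ge0 //.
    by apply: hj; rewrite ltnS leqnn.
  apply: ler_pM; rewrite ?absc_ge0 //; last by apply: hj; rewrite i0 ltn_ord.
  have [mi|mi] := posnP (m.+1 - i)%N; first by rewrite mi.
  apply: le_trans e'n; apply: hj; rewrite mi ltnS leq_subLR leq_addl //.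
have t2 : absc (((alpha n)%:C - m.+1%:R) * \sum_(z <- zs n) z ^+ m.+1) <=
    (3 * n%:R) * (e' * n%:R).
  rewrite abscM; apply: ler_pM; rewrite ?absc_ge0 //; last by apply: hj; rewrite ltnS leqnn.
  have -> : (alpha n)%:C - m.+1%:R = (a n)%:C - n%:R - m.+1%:R :> C.
    by rewrite /a rmorphD rmorph_nat; congr (_ - _); rewrite addrAC subrr add0r.
  apply: le_trans (absc_triangleB _ _) _.
  apply: le_trans (lerD (absc_triangleB _ _) (lexx _)) _.
  by rewrite absc_real !absc_nat; lra.
apply: le_trans (lerD t1 t2) _.
have -> : (m%:R + 2) * (n%:R * (e' * n%:R)) + 3 * n%:R * (e' * n%:R) =
  (e' * (m%:R + 5)) * (n%:R * n%:R) by ring.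
have -> : n%:R * (e * n%:R) = e * (n%:R * n%:R) by ring.
rewrite ler_wpM2r ?mulr_ge0 //; apply: le_trans e'e; rewrite ler_wpM2l ?(ltW e'0) //.
lra.
Unshelve. all: by end_near. Qed.

(** The product of the moduli is that of the |a n - i| over n^n. By [prod_dist_ge] it is at least D
    n n! / n^n up to exp (o(n)), and n! / n^n >= exp (- n). *)
Lemma lagzeros_prod_ge (r d : R) : 0 < d ->
  (forall d, 0 < d -> \forall n \near \oo, expR (- (r + d) * n%:R) <= D n) ->
  \forall n \near \oo, expR ((- 1 - r - d) * n%:R) <= \prod_(z <- zs n) absc z.
Proof.
move=> d0 hD.
(* Of the eight shares of d, one goes to D n, three to 4 n^3 and two to the binomial coefficient.
   [l] is such that L (- ln k) <= k n in [bin_le_exp]. *)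
pose k := d / 8; have k0 : 0 < k by rewrite divr_gt0.
pose l := 1 + `|ln k|; have l0 : 0 < l by rewrite ltr_pwDl.
near=> n.
have n0 : (0 < n)%N by near: n; exists 1%N.
have nR : 1 <= n%:R :> R by rewrite ler1n.
have hd : expR (- (r + k) * n%:R) <= D n by near: n; exact: hD.
have ha : `|a n| <= k / (2 * l) * n%:R.
  by near: n; apply: shifted_small; rewrite divr_gt0 // mulr_gt0.
have ha1 : `|a n| <= 1 / 2 * n%:R by near: n; apply: shifted_small; rewrite divr_gt0.
have hexp : 4 * n%:R <= expR (k * n%:R) by near: n; exact: near_lin_le_exp.
have [[L Ln DL] Dmin] := distS_props (alpha n) n0.
rewrite -/(a n) -/(D n) in DL Dmin.
rewrite lagzeros_prod_abs // -/(a n).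
have D0 : 0 <= D n by rewrite DL.
have aD : `|a n - L%:R| <= 1 \/ a n < 0.
  have [an0|] := leP 0 (a n); [left|by right].
  have mn : (Num.trunc (a n) < n)%N.
    rewrite -(ltr_nat R); apply: le_lt_trans (_ : a n < _); first by rewrite truncn_le.
    by apply: le_lt_trans (ler_norm _) _; lra.
  rewrite -DL; apply: le_trans (Dmin _ mn) _.
  have := truncnS_gt (a n); rewrite -natr1 => h.
  by rewrite ger0_norm ?subr_ge0 ?truncn_le //; lra.
have hP := @prod_dist_ge R n L (a n) Ln _ aD.
rewrite -DL in hP; have {}hP := hP Dmin.
have L2 : L%:R <= 2 * `|a n|.
  have := Dmin 0%N n0; rewrite subr0 DL => h.
  have : `|L%:R| <= `|a n| + `|a n - L%:R|.
    by rewrite distrC; apply: le_trans (ler_normD _ _); rewrite addrC subrK.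
  by rewrite ger0_norm //; lra.
have Lk : L%:R * - ln k <= k * n%:R.
  apply: (@le_trans _ _ (L%:R * l)).
    rewrite ler_wpM2l //; apply: le_trans (ler_norm _) _; rewrite normrN /l; lra.
  have : 2 * `|a n| * l <= k * n%:R.
    have -> : k * n%:R = 2 * (k / (2 * l) * n%:R) * l by field; rewrite gt_eqF.
    by rewrite ler_wpM2r ?(ltW l0) // ler_wpM2l.
  by apply: le_trans; rewrite ler_wpM2r ?(ltW l0).
have hC : 'C(n, L)%:R <= expR (2 * (k * n%:R)).
  apply: le_trans (bin_le_exp k0 (ltnW Ln)) _; rewrite ler_expR; lra.
have hn3 : 4 * n%:R ^+ 3 <= expR (3 * (k * n%:R)).
  have -> : expR (3 * (k * n%:R)) = expR (k * n%:R) ^+ 3 by rewrite -expRM_natr; congr expR; ring.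
  apply: (@le_trans _ _ ((4 * n%:R) ^+ 3)).
    by rewrite exprMn ler_wpM2r ?exprn_ge0 // -natrX ler_nat.
  by apply: lerXn2r; rewrite ?nnegrE ?mulr_ge0 ?expR_ge0.
set Pr := \prod_(i < n) _ in hP *.
have Pr0 : 0 <= Pr by apply: prodr_ge0.
have nn : 0 < n%:R ^+ n :> R by rewrite exprn_gt0 // (lt_le_trans ltr01).
rewrite ler_pdivlMr //.
have h1 : D n * n`!%:R <= Pr * expR (5 * (k * n%:R)).
  apply: le_trans hP _; rewrite ler_wpM2l //.
  have -> : 5 * (k * n%:R) = 3 * (k * n%:R) + 2 * (k * n%:R) by ring.
  by rewrite expRD; apply: ler_pM; rewrite ?mulr_ge0 ?exprn_ge0.
have h2 := fact_ge_exp R n0.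
have E1 : expR ((-1 - r - d) * n%:R) = expR (- (r + k) * n%:R) * expR (- n%:R) * expR (- (7 * (k * n%:R))).
  by rewrite -!expRD; congr expR; rewrite /k; field.
have h3 : expR (- (r + k) * n%:R) * n%:R ^+ n <= D n * (n`!%:R * expR n%:R).
  by apply: ler_pM; rewrite ?expR_ge0 ?exprn_ge0.
have h4 : D n * (n`!%:R * expR n%:R) <= Pr * expR (5 * (k * n%:R)) * expR n%:R.
  by rewrite mulrA ler_wpM2r ?expR_ge0.
rewrite E1.
have h5 := le_trans h3 h4.
rewrite -(ler_pM2r (expR_gt0 n%:R)) -(ler_pM2r (expR_gt0 (7 * (k * n%:R)))).
apply: (@le_trans _ _ (expR (- (r + k) * n%:R) * n%:R ^+ n)).
  rewrite le_eqVlt; apply/orP; left; apply/eqP.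
  have e1 : expR (- n%:R) * expR n%:R = 1 :> R by rewrite -expRD addNr expR0.
  have e2 : expR (- (7 * (k * n%:R))) * expR (7 * (k * n%:R)) = 1 :> R by rewrite -expRD addNr expR0.
  move: (expR (- n%:R)) (expR n%:R : R) (expR (- (7 * (k * n%:R)))) (expR (7 * (k * n%:R))) e1 e2 => x y z w e1 e2.
  transitivity (expR (- (r + k) * n%:R) * n%:R ^+ n * (x * y) * (z * w)); first by ring.
  by rewrite e1 e2 !mulr1.
apply: le_trans h5 _; rewrite mulrAC ler_wpM2l ?mulr_ge0 ?expR_ge0 // ler_expR.
have : 0 <= k * n%:R by rewrite mulr_ge0 // ltW.
lra.
Unshelve. all: by end_near. Qed.

Lemma distS_gt0 n : (0 < n)%N -> 0 < D n.
Proof.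
move=> n0; have [[L Ln DL] _] := distS_props (alpha n) n0.
rewrite -/(a n) -/(D n) in DL; rewrite DL normr_gt0 /a subr_eq0.
have := @alpha_notin n (n - L)%N; rewrite subn_gt0 Ln leq_subr => /(_ isT).
apply: contraNneq => h; rewrite natrB ?(ltnW Ln) // -h; apply/eqP; ring.
Qed.

Lemma root_le_expR (x c : R) n : (0 < n)%N -> 0 < x ->
  (x `^ n%:R^-1 <= expR c) = (x <= expR (c * n%:R)).
Proof.
move=> n0 x0; rewrite /powR gt_eqF // ler_expR mulrC ler_pdivrMr ?ltr0n //.
by rewrite -{2}(lnK (x := x)) ?posrE // ler_expR.
Qed.

Lemma distS_root_lower (s : R) : distS n (alpha n) `^ n%:R^-1 @[n --> \oo] --> expR (- s) ->
  forall d, 0 < d -> \forall n \near \oo, expR (- (s + d) * n%:R) <= D n.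
Proof.
move=> h d d0; have lt : expR (- (s + d)) < expR (- s) by rewrite ltr_expR; lra.
near=> n; have n0 : (0 < n)%N by near: n; exists 1%N.
have hn : expR (- (s + d)) < D n `^ n%:R^-1 by near: n; exact: cvgr_gt h _ lt.
rewrite leNgt; apply/negP => /ltW; rewrite -root_le_expR ?distS_gt0 // leNgt => /negP; apply.
exact: hn.
Unshelve. all: by end_near. Qed.

(** The limit l is only required to be at most exp (- s), so the lemma serves r = s finite as well
    as r = oo, where l = 0 and s is arbitrary. *)
Lemma distS_root_upper (s l : R) : distS n (alpha n) `^ n%:R^-1 @[n --> \oo] --> l ->
  l <= expR (- s) ->
  forall d, 0 < d -> \forall n \near \oo, D n * expR (s * n%:R) <= expR (d * n%:R).
Proof.
move=> h ls d d0; have lt : l < expR (- s + d) by apply: le_lt_trans ls _; rewrite ltr_expR; lra.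
near=> n; have n0 : (0 < n)%N by near: n; exists 1%N.
have hn : D n `^ n%:R^-1 < expR (- s + d) by near: n; exact: cvgr_lt h _ lt.
move: (ltW hn); rewrite root_le_expR ?distS_gt0 // => /(ler_wpM2r (expR_ge0 (s * n%:R))).
by move/le_trans; apply; rewrite -expRD ler_expR -mulrDl addrAC addNr add0r.
Unshelve. all: by end_near. Qed.

End Asymptotics.
(** * Equidistribution on the curve *)

Section Kernel.
Variable R : realType.
Local Notation C := R[i].

Let c N (i : nat) : R := 'C(N, i)%:R.
Let gap (i j : nat) : nat := (i - j) + (j - i).

Let ker_sum N (w : C) : R :=
  \sum_(i < N.+1) \sum_(j < N.+1) c N i * c N j * complex.Re (w ^+ gap i j).

(* Since only nonnegative powers of w occur, this is the real part of a         *)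
(* polynomial even away from the unit circle.                                  *)
Let ker_sum_circle N (w : C) : absc w = 1 -> ker_sum N w = (absc (1 + w) ^+ 2) ^+ N.
Proof.
move=> w1; have ww : w * w^*%C = 1 by rewrite mul_conjc w1 expr1n.
have E : ((absc (1 + w) ^+ 2) ^+ N)%:C =
    (\sum_(i < N.+1) (c N i)%:C * w ^+ i) * (\sum_(j < N.+1) (c N j)%:C * w^*%C ^+ j).
  rewrite rmorphXn /= -mul_conjc exprMn; congr (_ * _).
    rewrite exprDn; apply: eq_bigr => i _.
    by rewrite expr1n mul1r /c rmorph_nat mulr_natl.
  rewrite rmorphD rmorph1 exprDn; apply: eq_bigr => i _.
  by rewrite expr1n mul1r /c rmorph_nat mulr_natl.
have -> : (absc (1 + w) ^+ 2) ^+ N = complex.Re ((absc (1 + w) ^+ 2) ^+ N)%:C by [].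
rewrite E mulr_suml Re_sum; apply: eq_bigr => i _.
rewrite mulr_sumr Re_sum; apply: eq_bigr => j _.
have -> : (c N i)%:C * w ^+ i * ((c N j)%:C * w^*%C ^+ j) =
    (c N i * c N j)%:C * (w ^+ i * w^*%C ^+ j) by rewrite rmorphM /= mulrACA.
rewrite Re_realM; congr (_ * _).
have [ij|ij] := leqP j i.
  have -> : gap i j = (i - j)%N by rewrite /gap (eqP ij) addn0.
  by rewrite -{2}(subnK ij) exprD -mulrA -exprMn ww expr1n mulr1.
have -> : gap i j = (j - i)%N by rewrite /gap (eqP (ltnW ij)) add0n.
rewrite -{2}(subnK (ltnW ij)) exprD mulrCA -exprMn ww expr1n mulr1.
by rewrite -rmorphXn /=; case: (w ^+ _).
Qed.

(** The mean of the kernel over the circle, that is, its constant term. *)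
Let Z N : R := \sum_(i < N.+1) c N i ^+ 2.

(** At w = 1 the kernel is the double sum of the c_i c_j; bound each product by the mean of the two
    squares. *)
Let Z_ge N : 4 ^+ N <= N.+1%:R * Z N.
Proof.
have -> : 4 ^+ N = ker_sum N 1 :> R.
  rewrite ker_sum_circle ?absc1 //; congr (_ ^+ N).
  by rewrite (_ : 1 + 1 = 2%:R) // absc_nat expr2; ring.
apply: (@le_trans _ _ (\sum_(i < N.+1) \sum_(j < N.+1) (c N i ^+ 2 / 2 + c N j ^+ 2 / 2))).
  apply: ler_sum => i _; apply: ler_sum => j _; rewrite expr1n /= mulr1.
  have := sqr_ge0 (c N i - c N j); rewrite sqrrB; lra.
under eq_bigr => i _ do rewrite big_split /= sumr_const card_ord -mulr_suml -/(Z N).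
rewrite big_split /= sumr_const card_ord sumrMnl -mulr_suml -/(Z N).
rewrite -[X in X + _]mulr_natl -[X in _ + X]mulr_natl; lra.
Qed.

Let Z_gt0 N : 0 < Z N.
Proof.
have := Z_ge N; have : 0 < 4 ^+ N :> R by rewrite exprn_gt0.
move=> /lt_le_trans h /h; by rewrite pmulr_rgt0 // ltr0n.
Qed.

Let ker_sum_far N (w : C) (d : R) : absc w = 1 -> 0 < d <= 1 -> d <= absc (w - 1) ->
  ker_sum N w <= Z N * (N.+1%:R * (1 - d ^+ 2 / 4) ^+ N).
Proof.
move=> w1 /andP[d0 d1] wd; rewrite ker_sum_circle //.
have := absc_add1_sqr w; rewrite w1 expr1n mulr1 => E.
have d2 : d ^+ 2 <= absc (w - 1) ^+ 2 by apply: lerXn2r; rewrite ?nnegrE ?absc_ge0 ?(ltW d0).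
have dd : d ^+ 2 <= 1 by rewrite expr_le1 // ltW.
apply: (@le_trans _ _ (4 ^+ N * (1 - d ^+ 2 / 4) ^+ N)).
  rewrite -exprMn; apply: lerXn2r; rewrite ?nnegrE ?sqr_ge0 //; lra.
rewrite mulrA [Z N * _]mulrC ler_wpM2r ?Z_ge // exprn_ge0 //; lra.
Qed.

(** (N + 1) y^N (1 - y) is at most the geometric sum times 1 - y, hence at most 1; the second factor
    y^N tends to 0. *)
Let lin_exprn_lt (y e : R) : 0 <= y < 1 -> 0 < e -> exists N, N.+1%:R * (y ^+ 2) ^+ N < e.
Proof.
move=> /andP[y0 y1] e0; have [||N hN] := @exprn_lt_eps R y ((1 - y) * e).
- by rewrite y0.
- by rewrite mulr_gt0 // subr_gt0.
exists N.
have h : N.+1%:R * y ^+ N * (1 - y) <= 1.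
  apply: (@le_trans _ _ ((\sum_(i < N.+1) y ^+ i) * (1 - y))).
    rewrite ler_wpM2r ?subr_ge0 ?(ltW y1) //.
    have -> : N.+1%:R * y ^+ N = \sum_(i < N.+1) y ^+ N by rewrite sumr_const card_ord mulr_natl.
    apply: ler_sum => i _; have iN : (i <= N)%N by rewrite -ltnS.
    by apply: ler_wiXn2l => //; exact: ltW.
  have := subrX1 y N.+1; have := exprn_ge0 N.+1 y0.
  set S := \sum_(i < _) _; lra.
have y1' : 0 < 1 - y by rewrite subr_gt0.
rewrite -(ltr_pM2l y1'); apply: le_lt_trans hN.
rewrite -exprM mulnC exprM expr2.
have -> : (1 - y) * (N.+1%:R * (y ^+ N * y ^+ N)) = N.+1%:R * y ^+ N * (1 - y) * y ^+ N by ring.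
by rewrite ler_piMl // exprn_ge0.
Qed.

(** Discrete convolution of the samples F m with the de la Vallee Poussin kernel |1 + w|^(2 N),
    written as the real part of a polynomial. For M > N the kernel has exact mean Z over the M
    nodes, so Re p(w) is a weighted average of the samples; the weights away from w are small, and
    p(0) is the plain average. *)
Lemma circle_approx (d e : R) : 0 < d <= 1 -> 0 < e -> exists N : nat,
  forall M, (N < M)%N -> forall F : nat -> R,
  exists p : {poly C}, p.[0] = ((\sum_(m < M) F m) / M%:R)%:C /\
    forall (w : C) (y e' B : R), absc w = 1 ->
      (forall m, `|F m - y| <= B) -> 0 <= e' ->
      (forall m : 'I_M, absc (w - cis (2 * pi / M%:R) ^+ m) < d -> `|F m - y| <= e') ->
      `|complex.Re p.[w] - y| <= e' + B * e.
Proof.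
move=> d01 e0; have [d0 d1] := andP d01.
have dd : d ^+ 2 <= 1 by rewrite expr_le1 // ltW.
(* The square of 1 - d^2 / 8 dominates the ratio 1 - d^2 / 4 in [ker_sum_far]. *)
have [|N hN] := @lin_exprn_lt (1 - d ^+ 2 / 8) e _ e0.
  have := exprn_gt0 2 d0; move=> ?; apply/andP; split; lra.
exists N => M NM F; have M0 : (0 < M)%N by exact: leq_ltn_trans NM.
have MR : 0 < M%:R :> R by rewrite ltr0n.
pose om m : C := (cis (2 * pi / M%:R) ^+ m)^*%C.
have om1 m : absc (om m) = 1 by rewrite absc_conj abscX absc_cis expr1n.
pose kp (u : C) : {poly C} := \sum_(i < N.+1) \sum_(j < N.+1)
  (c N i * c N j)%:C *: (u *: 'X) ^+ gap i j.
have kpE u w : complex.Re (kp u).[w] = ker_sum N (u * w).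
  rewrite horner_sum Re_sum; apply: eq_bigr => i _.
  rewrite horner_sum Re_sum; apply: eq_bigr => j _.
  by rewrite hornerZ horner_exp hornerZ hornerX Re_realM.
have kp0 u : (kp u).[0] = (Z N)%:C.
  rewrite horner_sum rmorph_sum; apply: eq_bigr => i _.
  rewrite horner_sum (bigD1 i) //= big1 ?addr0 => [|j ji].
    by rewrite hornerZ horner_exp hornerZ hornerX mulr0 /gap subnn expr0 mulr1 expr2.
  rewrite hornerZ horner_exp hornerZ hornerX mulr0 expr0n.
  rewrite (_ : (gap i j == 0)%N = false) ?mulr0 //; apply/negbTE.
  by apply: contra ji; rewrite /gap addn_eq0 !subn_eq0 -eqn_leq eq_sym.
have Z0 := Z_gt0 N.
have mean w : \sum_(m < M) ker_sum N (om m * w) = M%:R * Z N.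
  have -> : \sum_(m < M) ker_sum N (om m * w) =
      complex.Re (\sum_(i < N.+1) \sum_(j < N.+1) (c N i * c N j)%:C *
        (w ^+ gap i j * \sum_(m < M) om m ^+ gap i j)).
    rewrite exchange_big Re_sum; apply: eq_bigr => i _.
    rewrite exchange_big Re_sum; apply: eq_bigr => j _.
    rewrite Re_realM mulr_sumr Re_sum mulr_sumr; apply: eq_bigr => m _.
    by rewrite exprMn [w ^+ _ * _]mulrC.
  have hs i j : (i < N.+1)%N -> (j < N.+1)%N ->
      \sum_(m < M) om m ^+ gap i j = (if i == j then M%:R else 0).
    move=> iN jN; have := @sum_unity_roots R M (gap i j) M0.
    move/(congr1 (fun z : C => z^*%C)); rewrite rmorph_sum.
    under eq_bigr do rewrite rmorphXn.
    move=> ->; have [<-|ij] := eqVneq i j.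
      by rewrite /gap subnn dvdn0 rmorph_nat.
    rewrite (_ : (M %| gap i j)%N = false) ?rmorph0 //; apply/negbTE.
    (* No aliasing: a nonzero gap is at most N < M, hence not a multiple of M. *)
    have : (0 < gap i j < M)%N by move: iN jN NM ij; rewrite /gap; clear; lia.
    by case/andP => ? ?; rewrite gtnNdvd.
  have -> : M%:R * Z N = complex.Re ((M%:R * Z N)%:C) by [].
  congr complex.Re; rewrite /Z [in RHS]mulr_sumr rmorph_sum; apply: eq_bigr => i _.
  rewrite (bigD1 i) //= [X in _ + X]big1 ?addr0 => [|j ji].
    rewrite (hs i i) // eqxx /gap subnn expr0 mul1r -[M%:R in LHS](rmorph_nat (real_complex R)).
    by rewrite -rmorphM /=; congr (_%:C); rewrite expr2 mulrC.
  by rewrite (hs i j) // (_ : (val i == val j) = false) ?mulr0 //; apply/negbTE; rewrite eq_sym.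
exists (\sum_(m < M) (F m / (M%:R * Z N))%:C *: kp (om m)); split.
  rewrite horner_sum mulr_suml rmorph_sum; apply: eq_bigr => m _.
  rewrite hornerZ kp0 -rmorphM; congr (_%:C); field.
  by rewrite !gt_eqF.
move=> w y e' B w1 FB e'0 near_F.
have omw m : absc (om m * w) = 1 by rewrite abscM om1 w1 mulr1.
have ker0 m : 0 <= ker_sum N (om m * w) by rewrite ker_sum_circle // exprn_ge0 // sqr_ge0.
have -> : complex.Re (\sum_(m < M) (F m / (M%:R * Z N))%:C *: kp (om m)).[w] - y =
    (\sum_(m < M) (F m - y) * ker_sum N (om m * w)) / (M%:R * Z N).
  under [in RHS]eq_bigr do rewrite mulrBl.
  rewrite sumrB -mulr_sumr mean mulrBl mulfK ?mulf_neq0 ?gt_eqF //; congr (_ - _).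
  rewrite horner_sum Re_sum mulr_suml; apply: eq_bigr => m _.
  by rewrite hornerZ Re_realM kpE mulrAC.
have B0 : 0 <= B by apply: le_trans (FB 0%N).
have MZ : 0 < M%:R * Z N by rewrite mulr_gt0.
rewrite normrM normfV (ger0_norm (ltW MZ)) ler_pdivrMr //.
apply: le_trans (ler_norm_sum _ _ _) _.
have term m : (m < M)%N -> `|(F m - y) * ker_sum N (om m * w)| <=
    e' * ker_sum N (om m * w) + B * (Z N * e).
  move=> mM; rewrite normrM (ger0_norm (ker0 m)).
  have [near|far] := ltP (absc (w - cis (2 * pi / M%:R) ^+ m)) d.
    apply: (@le_trans _ _ (e' * ker_sum N (om m * w))).
      by rewrite ler_wpM2r //; exact: (near_F (Ordinal mM)).
    by rewrite lerDl !mulr_ge0 // ltW.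
  apply: (@le_trans _ _ (B * (Z N * e))); last first.
    by rewrite lerDr mulr_ge0.
  apply: ler_pM => //.
  have far' : d <= absc (om m * w - 1).
    suff -> : absc (om m * w - 1) = absc (w - cis (2 * pi / M%:R) ^+ m) by [].
    set v := cis _ ^+ m; have v1 : absc v = 1 by rewrite abscX absc_cis expr1n.
    rewrite -[LHS]mul1r -v1 -abscM mulrBr mulr1 mulrA mul_conjc v1 expr1n.
    by rewrite mul1r.
  apply: le_trans (ker_sum_far N (omw m) d01 far') _.
  rewrite ler_wpM2l ?(ltW Z0) //; apply: le_trans (ltW hN).
  rewrite ler_wpM2l //; apply: lerXn2r; rewrite ?nnegrE ?sqr_ge0 //; first lra.
  have := sqr_ge0 (d ^+ 2); rewrite sqrrB; lra.
apply: (@le_trans _ _ (\sum_(m < M) (e' * ker_sum N (om m * w) + B * (Z N * e)))).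
  by apply: ler_sum => m _; exact: term.
rewrite big_split /= -mulr_sumr mean sumr_const card_ord -mulr_natl.
by rewrite le_eqVlt; apply/orP; left; apply/eqP; ring.
Qed.

End Kernel.

(** * Injectivity of phi on the closed unit disc *)

Section PhiInjective.
Variable R : realType.
Local Notation C := R[i].

(** With a = sin^2 (t / 4) <= t^2 / 16 one has cos t = 1 - 8 a (1 - a); the term 8 a^2 makes the
    inequality strict. *)
Lemma cos_gt_quad (t : R) : t != 0 -> 1 - t ^+ 2 / 2 < cos t.
Proof.
move=> t0; have h4 : `|sin (t / 4)| <= `|t / 4| by exact: sin_le_id.
have s4 : sin (t / 4) ^+ 2 <= (t / 4) ^+ 2.
  by rewrite -real_normK ?num_real // -[leRHS]real_normK ?num_real // lerXn2r ?nnegrE.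
have e1 : cos t = 1 - 2 * sin (t / 2) ^+ 2.
  have := cosD (t / 2) (t / 2); rewrite -splitr => ->.
  by have := cos2Dsin2 (t / 2); lra.
have e2 : sin (t / 2) = 2 * (sin (t / 4) * cos (t / 4)).
  have -> : t / 2 = t / 4 + t / 4 by lra.
  by rewrite sinD; ring.
have cs := cos2Dsin2 (t / 4).
have t2 : 0 < t ^+ 2 by rewrite exprn_even_gt0.
have e3 : cos t = 1 - 8 * (sin (t / 4) ^+ 2 * cos (t / 4) ^+ 2) by rewrite e1 e2; ring.
rewrite e3; set a := sin _ ^+ 2 in s4 cs *; set b := cos _ ^+ 2 in cs *.
have -> : b = 1 - a by lra.
have a0 : 0 <= a by exact: sqr_ge0.
have a1 : a <= t ^+ 2 / 16 by move: s4; rewrite expr_div_n; lra.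
have : 8 * (a * (1 - a)) < t ^+ 2 / 2.
  have [->|a_neq0] := eqVneq a 0; first by lra.
  have a2 : 0 < a * a by rewrite mulr_gt0 // lt_neqAle eq_sym a_neq0.
  by rewrite mulrBr mulr1; lra.
lra.
Qed.

Lemma absc_expm1_lt (h : C) : 0 <= complex.Re h -> h != 0 ->
  absc (1 - cexp (- h)) < absc h.
Proof.
case: h => x y /= x0 h0; rewrite -(ltr_pXn2r (n := 2)) ?nnegrE ?absc_ge0 //.
rewrite !absc_sqr /= cosN sinN.
have e0 := expR_gt0 (- x); have e1 : expR (- x) <= 1 by rewrite -expR0 ler_expR; lra.
have ex : 1 - x <= expR (- x) by have := expR_ge1Dx (- x); lra.
have -> : (1 - (expR (- x) * cos y - 0 * - sin y)) ^+ 2 +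
   (0 - (expR (- x) * - sin y + 0 * cos y)) ^+ 2 =
   (1 - expR (- x)) ^+ 2 + expR (- x) * (2 * (1 - cos y)).
  have : sin y ^+ 2 = 1 - cos y ^+ 2 by rewrite -(cos2Dsin2 y); ring.
  move: (sin y) (cos y) (expR (- x)) => s c e h; rewrite !sqrrB; ring: h.
have [y0|y0] := eqVneq y 0.
  have x1 : 0 < x.
    rewrite lt_neqAle x0 andbT eq_sym; apply: contra h0 => /eqP ->.
    by rewrite y0.
  rewrite y0 cos0 subrr mulr0 mulr0 expr0n /= !addr0 ltr_pXn2r ?nnegrE //; first last.
    by lra.
  by have := expR_gt1Dx (x := - x); rewrite oppr_eq0 gt_eqF // => /(_ isT); lra.
have := cos_gt_quad y0; have := cos_le1 y => c1 c2.
apply: ler_ltD; first by apply: lerXn2r; rewrite ?nnegrE //; lra.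
apply: (@le_lt_trans _ _ (2 * (1 - cos y))); last lra.
by rewrite ler_piMl //; lra.
Qed.

(** If phi z = phi w, then z = w exp (z - w), so |w - z| = |w| |1 - exp (- (w - z))|. For w <> z
    with Re (w - z) >= 0 the last factor is less than |w - z|, a contradiction since |w| <= 1. *)
Lemma phi_inj (z w : C) : absc z <= 1 -> absc w <= 1 -> phi z = phi w -> z = w.
Proof.
wlog h0 : z w / 0 <= complex.Re (w - z).
  move=> H z1 w1 zw; have [h|h] := leP 0 (complex.Re (w - z)); first exact: H.
  by apply/esym/H => //; move: h; rewrite !ReB; lra.
move=> z1 w1 E; apply/eqP; rewrite eq_sym -subr_eq0; apply: contraT => hn.
have zE : z = w * cexp (- (w - z)).
  apply: (mulIf (cexp_neq0 (1 - z))); move: E; rewrite /phi => ->.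
  by rewrite -mulrA -cexpD; congr (_ * cexp _); ring.
have : absc (w - z) = absc w * absc (1 - cexp (- (w - z))).
  by rewrite -abscM mulrBr mulr1 -zE.
have := absc_expm1_lt h0 hn.
move=> lt eq; move: lt; rewrite eq ltNge => /negP[].
by rewrite ler_piMl // absc_ge0.
Qed.

End PhiInjective.

Section Limit.
Variable R : realType.
Local Notation C := R[i].

Definition curve (r : R) (z : C) : Prop := absc (phi z) = expR (- r) /\ absc z <= 1.

Lemma ccont_bounded (F : C -> C) (B : R) : (forall c, ccont_at F c) ->
  exists2 K, 0 < K & forall z, absc z <= B -> absc (F z) <= K.
Proof.
move=> Fc; have /choice[eta eta_] : forall c, exists d, 0 < d /\
    forall z, absc (z - c) < d -> absc (F z - F c) < 1.
  by move=> c; have [d d0 h] := Fc c 1 ltr01; exists d.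
have [s hs] := @finite_cover_disc R eta B (fun c => (eta_ c).1).
exists (1 + \sum_(c <- s) absc (F c)).
  by rewrite ltr_pwDl // sumr_ge0 // => *; exact: absc_ge0.
move=> z /hs[c cs zc]; have := (eta_ c).2 z zc.
have := absc_triangle_sub (F z) (F c).
suff : absc (F c) <= \sum_(c <- s) absc (F c) by lra.
by rewrite (big_rem c) //= lerDl sumr_ge0 // => *; exact: absc_ge0.
Qed.

Lemma seq_min_pos (s : seq C) (d : C -> R) : (forall c, 0 < d c) ->
  exists2 e, 0 < e <= 1 & forall c, c \in s -> e <= d c.
Proof.
move=> d0; elim: s => [|c s [e /andP[e0 e1] IH]]; first by exists 1 => //; rewrite ltr01 lexx.
exists (Num.min e (d c)); first by rewrite lt_min e0 d0 ge_min e1.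
by move=> c'; rewrite inE => /orP[/eqP ->|/IH h]; rewrite ge_min ?lexx ?orbT // h.
Qed.

Section Curve.
Variable r : R.

Lemma curve_away (p : C) : ~ curve r p ->
  exists2 d, 0 < d & forall z, absc (z - p) < d -> ~ curve r z.
Proof.
move=> np; have [e|e] := eqVneq (absc (phi p)) (expR (- r)).
  have p1 : 1 < absc p by rewrite ltNge; apply/negP => p1; apply: np.
  exists (absc p - 1); first by rewrite subr_gt0.
  by move=> z hz [_ z1]; have := absc_triangle_sub p z; rewrite absc_distC; lra.
have e0 : 0 < `|absc (phi p) - expR (- r)| by rewrite normr_gt0 subr_eq0.
have [d d0 hd] := ccont_phi p e0; exists d => // z /hd h [h' _]; move: h.
rewrite -h' ltNge => /negP; apply; rewrite ler_norml; apply/andP; split.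
  by have := absc_triangle_sub (phi z) (phi p); lra.
by rewrite absc_distC; exact: absc_triangle_sub.
Qed.

(** Phi is injective on the compact curve, so its inverse is uniformly continuous on the image, and
    so is f composed with it. *)
Lemma curve_inverse_modulus (f : C -> R) (e : R) :
  (forall c, ccont_at (fun z => (f z)%:C) c) -> 0 < e ->
  exists2 d, 0 < d <= 1 & forall z w, curve r z -> curve r w ->
    absc (phi z - phi w) < d -> `|f z - f w| < e.
Proof.
move=> fc e0; have e2 : 0 < e / 2 by rewrite divr_gt0.
(* Continuity at the single point phi c: a point p <> c of the curve has phi p <> phi c, so near p
   the values of phi keep a positive distance from phi c. Finitely many neighbourhoods suffice. *)
have local c : curve r c -> exists2 d, 0 < d & forall z, curve r z ->
    absc (phi z - phi c) < d -> `|f z - f c| < e / 2.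
  move=> cc; have /choice[eta eta_] : forall p, exists ed : R * R, [/\ 0 < ed.1, 0 < ed.2 &
      forall z, absc (z - p) < ed.1 -> curve r z -> absc (phi z - phi c) < ed.2 ->
        `|f z - f c| < e / 2].
    move=> p; have [->|pc] := eqVneq p c.
      have [d d0 hd] := fc c _ e2; exists (d, 1); split => //= z /hd h _ _.
      by rewrite -absc_real rmorphB.
    have [cp|ncp] := pselect (curve r p); last first.
      have [d d0 hd] := curve_away ncp; exists (d, 1); split => //= z /hd.
      by [].
    have g0 : 0 < absc (phi p - phi c) / 2.
      rewrite divr_gt0 // absc_gt0 subr_eq0; apply: contra pc => /eqP.
      by move/phi_inj => -> //; [case: cp | case: cc].
    have [d d0 hd] := ccont_phi p g0; exists (d, absc (phi p - phi c) / 2); split => //= z /hd h _ h'.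
    have := absc_dist_triangle (phi z) (phi p) (phi c); rewrite (absc_distC (phi p) (phi z)).
    by lra.
  have [s hs] := @finite_cover_disc R (fun p => (eta p).1) 1 (fun p => (let: And3 h _ _ := eta_ p in h)).
  have [d /andP[d0 _] hd] := @seq_min_pos s (fun p => (eta p).2) (fun p => (let: And3 _ h _ := eta_ p in h)).
  exists d => // z cz zc; have [p ps zp] := hs z cz.2.
  have [_ _] := eta_ p; apply => //.
  by apply: lt_le_trans zc _; exact: hd.
have /choice[eta eta_] : forall c, exists ed : R * R, [/\ 0 < ed.1, 0 < ed.2 &
    forall z w, absc (w - c) < ed.1 -> curve r z -> curve r w ->
      absc (phi z - phi w) < ed.2 -> `|f z - f w| < e].
  move=> c; have [cc|ncc] := pselect (curve r c); last first.
    have [d d0 hd] := curve_away ncc; exists (d, 1); split => //= z w /hd.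
    by [].
  have [d d0 hd] := local c cc; have d2 : 0 < d / 2 by rewrite divr_gt0.
  have [d' d'0 hd'] := ccont_phi c d2.
  exists (d', d / 2); split => //= z w wc cz cw zw.
  have h1 := hd' w wc.
  have h2 : `|f w - f c| < e / 2 by apply: hd => //; lra.
  have h3 : `|f z - f c| < e / 2.
    by apply: hd => //; have := absc_dist_triangle (phi w) (phi z) (phi c); lra.
  have -> : f z - f w = (f z - f c) - (f w - f c) by ring.
  by apply: le_lt_trans (ler_normB _ _) _; lra.
have [s hs] := @finite_cover_disc R (fun p => (eta p).1) 1 (fun p => (let: And3 h _ _ := eta_ p in h)).
have [d d01 hd] := @seq_min_pos s (fun p => (eta p).2) (fun p => (let: And3 _ h _ := eta_ p in h)).
exists d => // z w cz cw zw; have [p ps wp] := hs w cw.2.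
have [_ _] := eta_ p; apply => //.
by apply: lt_le_trans zw _; exact: hd.
Qed.

End Curve.
End Limit.

(** * Concentration on the curve and limits of means *)

Section MeanLimit.
Variable R : realType.
Local Notation C := R[i].

Lemma exprn_sub_le (a b : C) (l : R) n : 1 <= l -> absc a <= l -> absc b <= l ->
  absc (a ^+ n - b ^+ n) <= n%:R * l ^+ n * absc (a - b).
Proof.
move=> l1 al bl; have l0 : 0 <= l by lra.
elim: n => [|n IH]; first by rewrite !expr0 subrr absc0 mul0r mul0r.
have -> : a ^+ n.+1 - b ^+ n.+1 = a * (a ^+ n - b ^+ n) + (a - b) * b ^+ n.
  by rewrite !exprS; ring.
apply: le_trans (absc_triangle _ _) _; rewrite !abscM.
have h1 : absc a * absc (a ^+ n - b ^+ n) <= l * (n%:R * l ^+ n * absc (a - b)).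
  by apply: ler_pM => //; exact: absc_ge0.
have h2 : absc (a - b) * absc (b ^+ n) <= absc (a - b) * l ^+ n.+1.
  rewrite ler_wpM2l ?absc_ge0 // abscX exprS.
  apply: le_trans (_ : l ^+ n <= _); last by rewrite ler_peMl ?exprn_ge0.
  by apply: lerXn2r; rewrite ?nnegrE ?absc_ge0.
apply: le_trans (lerD h1 h2) _; rewrite -natr1 exprS.
by rewrite le_eqVlt; apply/orP; left; apply/eqP; ring.
Qed.

Lemma sum_nat_of_bool (T : Type) (s : seq T) (b : pred T) :
  \sum_(z <- s) (b z)%:R = (count b s)%:R :> R.
Proof.
elim: s => [|x s IH] /=; first by rewrite big_nil.
by rewrite big_cons IH natrD.
Qed.

Variables (r : R) (zs : nat -> seq C).
Hypotheses (r0 : 0 <= r)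
  (zs_size : forall n, (0 < n)%N -> size (zs n) = n)
  (zs_neq0 : forall n, (0 < n)%N -> forall z, z \in zs n -> z != 0)
  (zs_bounded : \forall n \near \oo, forall z, z \in zs n -> absc z <= 10)
  (zs_means : forall m e, (0 < m)%N -> 0 < e ->
     \forall n \near \oo, absc (\sum_(z <- zs n) z ^+ m) <= e * n%:R)
  (zs_prod : forall d, 0 < d ->
     \forall n \near \oo, expR ((- 1 - r - d) * n%:R) <= \prod_(z <- zs n) absc z)
  (zs_subexp : subexp_on (outer r) zs).

(** The numbers x z = log |phi z| + r have a sum at least - o(n), by the product and the first power
    sum. By [sparse_outer] they are nearly nonpositive except at o(n) zeros, where they are bounded;
    so only o(n) of them can be below - d. *)
Lemma sparse_inner (d : R) : 0 < d ->
  sparse zs (fun z => absc (phi z) <= expR (- r - d)).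
Proof.
move=> d0 e e0; pose B := 21 + r; have B0 : 0 < B by rewrite ltr_wpDr.
(* The sum lies between - 2 d' n and d' n + B e' n - d count, so d count <= 3 d' n + B e' n = e d n.
   For |z| <= 10 one has x z <= 21 + r = B. *)
have [d' d'E] : {d' | d' = e * d / 6} by exists (e * d / 6).
have d'0 : 0 < d' by rewrite d'E !divr_gt0 ?mulr_gt0.
pose e' := e * d / (2 * B); have e'0 : 0 < e' by rewrite divr_gt0 ?mulr_gt0.
have sp := sparse_outer r0 zs_subexp d'0 e'0.
set bad1 := fun z : C => `[< _ >] in sp.
near=> n.
have n0 : (0 < n)%N by near: n; exists 1%N.
have hb : forall z, z \in zs n -> absc z <= 10 by near: n.
have h1 : absc (\sum_(z <- zs n) z ^+ 1) <= d' * n%:R by near: n; exact: zs_means.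
have hp : expR ((- 1 - r - d') * n%:R) <= \prod_(z <- zs n) absc z by near: n; exact: zs_prod.
have hc : (count bad1 (zs n))%:R <= e' * n%:R by near: n; exact: sp.
set bad2 := fun z : C => `[< _ >].
pose x z := ln (absc z) + (1 - complex.Re z) + r.
have xs : - (2 * d' * n%:R) <= \sum_(z <- zs n) x z.
  rewrite 2!big_split /= sumrB !big_const_seq !count_predT !iter_addr_0 zs_size //.
  have hR : \sum_(z <- zs n) complex.Re z <= d' * n%:R.
    apply: le_trans h1; apply: le_trans (Re_leif_absc _); rewrite Re_sum.
    by under [leRHS]eq_bigr do rewrite expr1.
  have hl : (- 1 - r - d') * n%:R <= \sum_(z <- zs n) ln (absc z).
    rewrite -ler_expR expR_sum; apply: le_trans hp _.
    rewrite le_eqVlt; apply/orP; left; apply/eqP; apply: eq_big_seq => z zn.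
    by rewrite lnK // posrE absc_gt0 (zs_neq0 n0).
  rewrite -[1 *+ n]/(n%:R) -[r *+ n]mulr_natl.
  move: hl hR; set S1 := \sum_(z <- _) _; set S2 := \sum_(z <- _) _.
  by move=> ? ?; lra.
have term z : z \in zs n -> x z <= d' + B * (bad1 z)%:R - d * (bad2 z)%:R.
  move=> zn; have z0 := zs_neq0 n0 zn.
  have E : absc (phi z) = expR (x z - r).
    by rewrite absc_phi addrK expRD lnK // posrE absc_gt0.
  have [h|] := boolP (bad2 z).
    move/asboolP: h; rewrite E ler_expR => h.
    have : 0 <= B * (bad1 z)%:R by rewrite mulr_ge0 // ltW.
    by rewrite mulr1; lra.
  move=> _; rewrite mulr0 subr0; have [_|nb] := boolP (bad1 z).
    have l10 : ln (absc z) <= 10.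
      rewrite -ler_expR lnK ?posrE ?absc_gt0 //; apply: le_trans (hb z zn) _.
      have := expR_ge1Dx (10 : R); lra.
    have re10 : - complex.Re z <= 10.
      by have := Re_le_absc z; rewrite ler_norml => /andP[h _]; have := hb z zn; lra.
    by rewrite mulr1 /x /B; lra.
  rewrite mulr0 addr0; rewrite leNgt; apply: contra nb => h.
  apply/asboolP; split=> //; right; rewrite E ler_expR; lra.
have : \sum_(z <- zs n) x z <=
    \sum_(z <- zs n) (d' + B * (bad1 z)%:R - d * (bad2 z)%:R).
  by rewrite !big_seq; apply: ler_sum => z; exact: term.
move: xs; set S := \sum_(z <- zs n) x z => xs.
rewrite sumrB big_split /= -!mulr_sumr !sum_nat_of_bool.
rewrite big_const_seq count_predT iter_addr_0 zs_size // -[d' *+ n]mulr_natl => hh.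
have hc' : B * (count bad1 (zs n))%:R <= e * d / 2 * n%:R.
  have -> : e * d / 2 * n%:R = B * (e' * n%:R) by rewrite /e'; field; rewrite gt_eqF.
  by rewrite ler_wpM2l // ltW.
rewrite -(ler_pM2l d0).
have e1 : d' * n%:R = e * d * n%:R / 6 by rewrite d'E; ring.
have e2 : 2 * d' * n%:R = 2 * (e * d * n%:R / 6) by rewrite d'E; ring.
have e3 : d * (e * n%:R) = e * d * n%:R by ring.
have e4 : n%:R * d' = e * d * n%:R / 6 by rewrite d'E; ring.
have e5 : e * d / 2 * n%:R = e * d * n%:R / 2 by ring.
rewrite e3; move: xs hh hc'; rewrite e2 e4 e5; clear.
by lra.
Unshelve. all: by end_near. Qed.

(** Every point has a neighbourhood with few zeros where |G| >= e: by continuity on the curve, by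
    [sparse_inner] where |phi| < exp (- r), and by [sparse_outer] where |phi| > exp (- r), or where
    |phi| = exp (- r) and the modulus exceeds 1. Finitely many of them cover the disc that contains
    the zeros. *)
Lemma sparse_off_curve (G : C -> R) (e : R) : (forall c, ccont_at (fun z => (G z)%:C) c) ->
  (forall z, curve r z -> `|G z| < e) -> sparse zs (fun z => e <= `|G z|).
Proof.
move=> Gc hG.
have /choice[eta eta_] : forall c, exists d, 0 < d /\
    sparse zs (fun z => absc (z - c) < d /\ e <= `|G z|).
  move=> c; have [cc|ncc] := pselect (curve r c).
    have g0 : 0 < e - `|G c| by rewrite subr_gt0 hG.
    have [d d0 hd] := Gc c _ g0; exists d; split=> //.
    apply: (sparse_sub _ (sparse0 zs)) => z [/hd h eG].
    move: h; rewrite -rmorphB absc_real => h.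
    have := ler_normD (G z - G c) (G c); rewrite subrK => h'; lra.
  have [lt|ge] := ltP (absc (phi c)) (expR (- r)).
    pose q := (expR (- r) - absc (phi c)) / 2.
    have q0 : 0 < q by rewrite divr_gt0 // subr_gt0.
    have [d d0 hd] := ccont_phi c q0; exists d; split=> //.
    have s0 : 0 < expR (- r) - q by rewrite /q; have := absc_ge0 (phi c); lra.
    have dd : 0 < - r - ln (expR (- r) - q).
      have : ln (expR (- r) - q) < - r; last by lra.
      by rewrite -ltr_expR lnK ?posrE // ltrBlDr ltrDl.
    apply: sparse_sub (sparse_inner dd) => z [/hd h _].
    have -> : - r - (- r - ln (expR (- r) - q)) = ln (expR (- r) - q) by ring.
    rewrite lnK ?posrE //.
    have := absc_triangle_sub (phi z) (phi c); rewrite /q in h *; lra.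
  have [gt|le] := ltP (expR (- r)) (absc (phi c)).
    pose q := (absc (phi c) - expR (- r)) / 2.
    have q0 : 0 < q by rewrite divr_gt0 // subr_gt0.
    have [d d0 hd] := ccont_phi c q0; exists d; split=> //.
    have dd : 0 < ln (expR (- r) + q) + r.
      have : - r < ln (expR (- r) + q); last by lra.
      by rewrite -ltr_expR lnK ?posrE ?addr_gt0 ?expR_gt0 // ltrDl.
    apply: sparse_sub (sparse_outer r0 zs_subexp dd) => z [/hd h _].
    have hz : expR (- r) + q <= absc (phi z).
      by have := absc_triangle_sub (phi c) (phi z); rewrite absc_distC /q in h *; lra.
    split.
      apply/eqP => z0; move: hz; rewrite z0 /phi mul0r absc0.
      by have := expR_gt0 (- r); lra.
    right; have -> : - r + (ln (expR (- r) + q) + r) = ln (expR (- r) + q) by ring.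
    by rewrite lnK // posrE addr_gt0 ?expR_gt0.
  have c1 : 1 < absc c.
    by rewrite ltNge; apply/negP => c1; apply: ncc; split=> //; apply/eqP; rewrite eq_le le.
  have dd : 0 < (absc c - 1) / 2 by rewrite divr_gt0 // subr_gt0.
  exists ((absc c - 1) / 2); split=> //.
  apply: sparse_sub (sparse_outer r0 zs_subexp dd) => z [h _].
  have hz : 1 + (absc c - 1) / 2 <= absc z.
    by have := absc_triangle_sub c z; rewrite absc_distC; lra.
  by split; [rewrite -absc_gt0; lra | left].
have [s hs] := @finite_cover_disc R eta 10 (fun c => (eta_ c).1).
apply: (@sparse_sub_near _ zs _ (fun z => exists2 c, c \in s & absc (z - c) < eta c /\ e <= `|G z|)).
  by apply: filterS zs_bounded => n hn z /hn /hs[c cs zc] eG; exists c.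
by apply: sparse_bigU => c _; exact: (eta_ c).2.
Qed.

Definition vanish (F : C -> C) := forall e : R, 0 < e ->
  \forall n \near \oo, absc (\sum_(z <- zs n) F z) <= e * n%:R.

Lemma vanish0 : vanish (fun=> 0).
Proof.
by move=> e e0; apply: nearW => n; rewrite big1 // absc0 mulr_ge0 // ltW.
Qed.

Lemma vanishD F G : vanish F -> vanish G -> vanish (fun z => F z + G z).
Proof.
move=> hF hG e e0; have e2 : 0 < e / 2 by rewrite divr_gt0.
apply: filterS2 (hF _ e2) (hG _ e2) => n h1 h2; rewrite big_split /=.
by apply: le_trans (absc_triangle _ _) _; lra.
Qed.

Lemma vanishZ c F : vanish F -> vanish (fun z => c * F z).
Proof.
move=> hF e e0; have c0 : 0 < absc c + 1 by rewrite ltr_wpDl ?absc_ge0.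
have e2 : 0 < e / (absc c + 1) by rewrite divr_gt0.
apply: filterS (hF _ e2) => n h1; rewrite -mulr_sumr abscM.
apply: (@le_trans _ _ ((absc c + 1) * (e / (absc c + 1) * n%:R))).
  by apply: ler_pM; rewrite ?absc_ge0 // lerDl.
by rewrite mulrA [_ * (e / _)]mulrC divfK ?gt_eqF.
Qed.

Lemma vanish_approx F : (forall e, 0 < e -> exists2 G, vanish G &
    forall z, absc z <= 10 -> absc (F z - G z) <= e) -> vanish F.
Proof.
move=> h e e0; have e2 : 0 < e / 2 by rewrite divr_gt0.
have [G hG FG] := h _ e2.
near=> n.
have n0 : (0 < n)%N by near: n; exists 1%N.
have hb : forall z, z \in zs n -> absc z <= 10 by near: n.
have h1 : absc (\sum_(z <- zs n) G z) <= e / 2 * n%:R by near: n; exact: hG.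
have -> : \sum_(z <- zs n) F z = \sum_(z <- zs n) (F z - G z) + \sum_(z <- zs n) G z.
  by rewrite -big_split; apply: eq_bigr => z _ /=; rewrite subrK.
apply: le_trans (absc_triangle _ _) _.
have : absc (\sum_(z <- zs n) (F z - G z)) <= e / 2 * n%:R.
  apply: le_trans (absc_sum _ _ _) _.
  apply: (@le_trans _ _ (\sum_(z <- zs n) e / 2)).
    by rewrite !big_seq; apply: ler_sum => z /hb; exact: FG.
  by rewrite big_const_seq count_predT iter_addr_0 zs_size // -[_ *+ n]mulr_natr.
lra.
Unshelve. all: by end_near. Qed.

Lemma vanish_horner (w : C -> C) : (forall k, vanish (fun z => w z ^+ k.+1)) ->
  forall (q : {poly C}) m, vanish (fun z => w z ^+ m.+1 * q.[w z]).
Proof.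
move=> hw; elim/poly_ind => [|q c IH] m.
  have := vanish0; congr vanish; apply/funext => z.
  by rewrite horner0 mulr0.
have := vanishD (IH m.+1) (vanishZ c (hw m)).
congr vanish; apply/funext => z.
by rewrite hornerMXaddC exprS; ring.
Qed.

(** With K = k + 1, phi^K is z^K e^K exp (- K z), and (1 - K z / N)^N approximates the exponential
    uniformly on the disc of radius 10. The approximants are polynomials divisible by z, so their
    means vanish. *)
Lemma vanish_phi k : vanish (fun z => phi z ^+ k.+1).
Proof.
apply: vanish_approx => e e0; set K := k.+1.
(* q0 / N bounds the error: (10 e)^K comes from z^K e^K, exp (10 K) from the powers of the two
   bases, and the square from the second-order remainder of exp. *)
pose q0 : R := (10 * expR 1) ^+ K * (expR (10 * K%:R) * (5 * (10 * K%:R) ^+ 2)).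
have K1 : 1 <= K%:R :> R by rewrite ler1n.
have q00 : 0 <= q0.
  rewrite /q0 mulr_ge0 ?exprn_ge0 ?mulr_ge0 ?expR_ge0 ?exprn_ge0 //; lra.
pose N := (Num.trunc (q0 / e + 10 * K%:R)).+1.
have NE : q0 / e + 10 * K%:R < N%:R by exact: truncnS_gt.
have qe : 0 <= q0 / e by rewrite divr_ge0 // ltW.
have N0 : 0 < N%:R :> R by rewrite ltr0n.
pose t : C := (K%:R / N%:R)%:C.
pose q : {poly C} := (cexp 1 ^+ K)%:P * (1 - t *: 'X) ^+ N.
exists (fun z => z ^+ K * q.[z]).
  apply: vanish_horner => m; exact: (fun e => @zs_means m.+1 e isT).
move=> z z10.
have qE : q.[z] = cexp 1 ^+ K * (1 - t * z) ^+ N.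
  by rewrite /q hornerM hornerC horner_exp hornerD hornerN hornerC hornerZ hornerX.
have pE : phi z ^+ K = z ^+ K * (cexp 1 ^+ K * cexp (- (t * z)) ^+ N).
  rewrite /phi exprMn; congr (_ * _).
  have -> : cexp (1 - z) = cexp 1 * cexp (- z) by rewrite -cexpD.
  rewrite exprMn; congr (_ * _); rewrite !cexpX; congr cexp.
  rewrite mulrN mulrN; congr (- _); rewrite mulrA; congr (_ * _).
  by rewrite /t -!(rmorph_nat (real_complex R)) -rmorphM; congr (_%:C); field; rewrite gt_eqF.
rewrite pE qE -!mulrBr !abscM.
have t0 : absc t = K%:R / N%:R by rewrite absc_real ger0_norm // divr_ge0.
set h := t * z.
have hh : absc h <= 10 * K%:R / N%:R.
  rewrite abscM t0 mulrC mulrA ler_pM2r ?invr_gt0 // ler_wpM2r //; lra.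
have h1 : absc h <= 1.
  apply: le_trans hh _; rewrite ler_pdivrMr // mul1r; lra.
pose l : R := expR (10 * K%:R / N%:R).
have l1 : 1 <= l by rewrite -expR0 ler_expR divr_ge0 // mulr_ge0.
have lN : l ^+ N = expR (10 * K%:R).
  by rewrite -expRM_natr; congr expR; field; rewrite gt_eqF.
have al : absc (cexp (- h)) <= l.
  rewrite absc_cexp ler_expR; apply: le_trans hh; rewrite ReN.
  by have := Re_le_absc h; rewrite ler_norml => /andP[]; lra.
have bl : absc (1 - h) <= l.
  apply: le_trans (absc_triangleB _ _) _; rewrite absc1.
  apply: le_trans (expR_ge1Dx _) _; by rewrite ler_expR.
have hd := @exprn_sub_le (cexp (- h)) (1 - h) l N l1 al bl.
have hq : absc (cexp (- h) - (1 - h)) <= 5 * (10 * K%:R / N%:R) ^+ 2.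
  have -> : cexp (- h) - (1 - h) = cexp (- h) - 1 - (- h) by ring.
  apply: le_trans (@cexp_sub_quad R (- h) _) _; rewrite ?abscN //.
  by rewrite ler_pM2l //; apply: lerXn2r; rewrite ?nnegrE ?absc_ge0 // divr_ge0 // mulr_ge0.
rewrite lN in hd.
have hd2 : absc (cexp (- h) ^+ N - (1 - h) ^+ N) <=
   expR (10 * K%:R) * (5 * (10 * K%:R) ^+ 2) / N%:R.
  apply: le_trans hd _.
  apply: (@le_trans _ _ (N%:R * expR (10 * K%:R) * (5 * (10 * K%:R / N%:R) ^+ 2))).
    by rewrite ler_wpM2l // mulr_ge0 ?expR_ge0.
  by rewrite le_eqVlt; apply/orP; left; apply/eqP; field; rewrite gt_eqF.
apply: (@le_trans _ _ (10 ^+ K * (expR 1 ^+ K * (expR (10 * K%:R) * (5 * (10 * K%:R) ^+ 2) / N%:R)))).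
  apply: ler_pM; rewrite ?absc_ge0 ?mulr_ge0 ?absc_ge0 //.
    by rewrite abscX; apply: lerXn2r; rewrite ?nnegrE ?absc_ge0.
  apply: ler_pM; rewrite ?absc_ge0 //.
  by rewrite abscX absc_cexp.
have -> : 10 ^+ K * (expR 1 ^+ K * (expR (10 * K%:R) * (5 * (10 * K%:R) ^+ 2) / N%:R)) = q0 / N%:R.
  by rewrite /q0 [(10 * expR 1) ^+ K]exprMn !mulrA.
by rewrite ler_pdivrMr // mulrC -ler_pdivrMr //; lra.
Qed.

(** Weyl's criterion: the positive powers of phi z have vanishing means, and only the constant term
    remains. *)
Lemma mean_poly_phi (p : {poly C}) (s : C) (e : R) : 0 < e ->
  \forall n \near \oo,
  `|\sum_(z <- zs n) complex.Re p.[s * phi z] - n%:R * complex.Re p.[0]| <= e * n%:R.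
Proof.
move=> e0; have hw k : vanish (fun z => (s * phi z) ^+ k.+1).
  have := vanishZ (s ^+ k.+1) (vanish_phi k).
  by congr vanish; apply/funext => z; rewrite [RHS]exprMn.
have : vanish (fun z => p.[s * phi z] - p.[0]).
  elim/poly_ind: p => [|q c _].
    have := vanish0; congr vanish; apply/funext => z.
    by rewrite !horner0 subrr.
  have := vanish_horner hw q 0; congr vanish; apply/funext => z.
  by rewrite !hornerMXaddC; ring.
move=> hp; near=> n.
have n0 : (0 < n)%N by near: n; exists 1%N.
have h1 : absc (\sum_(z <- zs n) (p.[s * phi z] - p.[0])) <= e * n%:R by near: n; exact: hp.
apply: le_trans h1; apply: le_trans (Re_le_absc _).
rewrite Re_sum; under [in leRHS]eq_bigr do rewrite ReB.
rewrite sumrB [X in _ <= `|_ - X|]big_const_seq count_predT iter_addr_0 zs_size //.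
by rewrite -[X in _ <= `|_ - X|]mulr_natl.
Unshelve. all: by end_near. Qed.

(** Sample f at points of the curve whose images under phi are equally spaced, and let p be the
    polynomial of [circle_approx]. Then f and Re p(exp r phi) are close on the curve, hence at all
    but o(n) zeros, and the mean of the latter tends to p(0), the average of the samples. *)
Lemma mean_limit (f : C -> R) (B eps : R) :
  (forall c, ccont_at (fun z => (f z)%:C) c) -> (forall z, `|f z| <= B) -> 0 < eps ->
  exists N : nat, forall M, (N < M)%N -> forall gam : nat -> C,
  (forall m, curve r (gam m)) ->
  (forall m, (m < M)%N -> (expR r)%:C * phi (gam m) = cis (2 * pi / M%:R) ^+ m) ->
  \forall n \near \oo,
  `|\sum_(z <- zs n) f z - n%:R * ((\sum_(m < M) f (gam m)) / M%:R)| <= eps * n%:R.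
Proof.
move=> fc fB eps0; pose e := eps / 5; have e0 : 0 < e by rewrite divr_gt0.
have B0 : 0 <= B by apply: le_trans (fB 0).
have [d d01 hd] := curve_inverse_modulus r fc e0; have [d0 d1] := andP d01.
have e'0 : 0 < e / (2 * B + 1) by rewrite divr_gt0 // ltr_wpDl // mulr_ge0.
have [N hN] := circle_approx d01 e'0.
exists N => M NM gam cg hg.
have [p [p0 hp]] := hN M NM (fun m => f (gam m)).
pose s : C := (expR r)%:C.
have sr : absc s = expR r by rewrite absc_real ger0_norm // expR_ge0.
pose G z := complex.Re p.[s * phi z] - f z.
have Gc c : ccont_at (fun z => (G z)%:C) c.
  have : ccont_at (fun z => (complex.Re p.[s * phi z])%:C + (- 1) * (f z)%:C) c.
    apply: ccontD; last by apply: ccontM; [exact: ccont_cst | exact: fc].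
    have hp' : ccont_at (fun z => p.[s * phi z]) c.
      apply: (@ccont_comp R (horner p) (fun z => s * phi z)); first exact: ccont_horner.
      by apply: ccontM; [exact: ccont_cst | exact: ccont_phi].
    move=> x /hp'[d' d'0 hd']; exists d' => // z /hd'; apply: le_lt_trans.
    by rewrite -rmorphB absc_real -ReB; exact: Re_le_absc.
  apply: eq_ccont => z; by rewrite /G rmorphB /= mulN1r.
have Gcurve z : curve r z -> `|G z| < 3 * e.
  move=> cz; have w1 : absc (s * phi z) = 1.
    by rewrite abscM sr cz.1 -expRD subrr expR0.
  have fB2 m : `|f (gam m) - f z| <= 2 * B.
    by apply: le_trans (ler_normB _ _) _; have := fB (gam m); have := fB z; lra.
  have := hp (s * phi z) (f z) e (2 * B) w1 fB2 (ltW e0).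
  move=> /(_ _)/le_lt_trans; apply.
    move=> m hm; rewrite distrC; apply/ltW/hd => //; apply: le_lt_trans hm.
    have <- : s * phi (gam m) = cis (2 * pi / M%:R) ^+ m by exact: hg.
    rewrite -mulrBr abscM sr ler_peMl ?absc_ge0 //.
    by rewrite -expR0 ler_expR.
  have : 2 * B * (e / (2 * B + 1)) <= e.
    rewrite mulrA ler_pdivrMr ?ltr_wpDl ?mulr_ge0 //; rewrite mulrC ler_pM2l //; lra.
  by lra.
have sp := sparse_off_curve Gc Gcurve.
have [K K0 hK] := ccont_bounded 10 Gc.
have eK : 0 < e / K by rewrite divr_gt0.
have pR : complex.Re p.[0] = (\sum_(m < M) f (gam m)) / M%:R by rewrite p0.
near=> n.
have n0 : (0 < n)%N by near: n; exists 1%N.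
have hb : forall z, z \in zs n -> absc z <= 10 by near: n.
have h1 : `|\sum_(z <- zs n) complex.Re p.[s * phi z] - n%:R * complex.Re p.[0]| <= e * n%:R.
  by near: n; exact: mean_poly_phi.
have hc : (count (fun z => `[< 3 * e <= `|G z| >]) (zs n))%:R <= e / K * n%:R.
  by near: n; exact: sp.
have hG : `|\sum_(z <- zs n) G z| <= 4 * e * n%:R.
  apply: le_trans (ler_norm_sum _ _ _) _.
  apply: (@le_trans _ _ (\sum_(z <- zs n) (3 * e + K * (`[< 3 * e <= `|G z| >])%:R))).
    rewrite !big_seq; apply: ler_sum => z zn.
    have [_|lt] := asboolP (3 * e <= `|G z|).
      have := hK z (hb z zn); rewrite absc_real mulr1.
      by move/le_trans; apply; rewrite lerDr mulr_ge0 // ltW.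
    by rewrite mulr0 addr0 ltW // ltNge; apply/negP.
  rewrite big_split /= -[X in _ + X <= _]mulr_sumr sum_nat_of_bool.
  rewrite big_const_seq count_predT iter_addr_0 zs_size // -[(3 * e) *+ n]mulr_natr.
  have : K * (count (fun z => `[< 3 * e <= `|G z| >]) (zs n))%:R <= e * n%:R.
    have -> : e * n%:R = K * (e / K * n%:R) by field; rewrite gt_eqF.
    by rewrite ler_wpM2l // ltW.
  lra.
rewrite pR in h1; move: h1.
have -> : \sum_(z <- zs n) complex.Re p.[s * phi z] =
    \sum_(z <- zs n) G z + \sum_(z <- zs n) f z.
  by rewrite -big_split; apply: eq_bigr => z _ /=; rewrite /G subrK.
set A := n%:R * _; set S := \sum_(z <- _) f z.
move=> h1; have -> : S - A = (\sum_(z <- zs n) G z + S - A) - \sum_(z <- zs n) G z by ring.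
apply: le_trans (ler_normB _ _) _.
have -> : eps = 5 * e by rewrite /e; lra.
lra.
Unshelve. all: by end_near. Qed.

End MeanLimit.
(** * Parametrization of the curve *)

Section CurveFunctions.
Variable R : realType.
Local Notation C := R[i].

Let dD (f g : R -> R) (x a b : R) : is_derive x 1 f a -> is_derive x 1 g b ->
  is_derive x 1 (fun s => f s + g s) (a + b).
Proof. by move=> hf hg; exact: is_deriveD. Qed.

Let dM (f g : R -> R) (x a b : R) : is_derive x 1 f a -> is_derive x 1 g b ->
  is_derive x 1 (fun s => f s * g s) (f x * b + g x * a).
Proof. by move=> hf hg; exact: is_deriveM. Qed.

Let dN (f : R -> R) (x a : R) : is_derive x 1 f a -> is_derive x 1 (fun s => - f s) (- a).
Proof. by move=> hf; exact: is_deriveN. Qed.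

Let dC (c x : R) : is_derive x 1 (fun=> c) 0.
Proof. exact: is_derive_cst. Qed.

Let did (x : R) : is_derive x 1 (fun s => s) 1. Proof. exact: is_derive_id. Qed.

Let dcomp (f g : R -> R) (x a b : R) : is_derive (g x) 1 f a -> is_derive x 1 g b ->
  is_derive x 1 (fun s => f (g s)) (a * b).
Proof. by move=> hf hg; exact: is_derive1_comp. Qed.

Let deq (f : R -> R) (x a b : R) : is_derive x 1 f a -> a = b -> is_derive x 1 f b.
Proof. by move=> h <-. Qed.

Let m (s : R) : R := (1 - s) * expR s.

Let m_deriv (s : R) : is_derive s 1 m (- (s * expR s)).
Proof.
apply: deq (dM (dD (dC 1 s) (dN (did s))) (is_derive_expR s)) _.
by rewrite sub0r; ring.
Qed.

(** The derivative of m is - s exp s <= - s for s >= 0. This quantitative decrease gives injectivity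
    and the continuity of the inverse up to s = 0, where m' vanishes. *)
Let m_drop a b : 0 <= a <= b -> (b - a) ^+ 2 / 2 <= m a - m b.
Proof.
move=> /andP[a0 ab].
have F (c : R) : is_derive c 1 (fun s : R => m s + s * s * 2^-1) (c - c * expR c).
  apply: deq (dD (m_deriv c) (dM (dM (did c) (did c)) (dC 2^-1 c))) _.
  by rewrite /= !mulr0 !mulr1; lra.
have [c /andP[ac cb] E] := mvt_eq ab (fun c _ => F c).
have : (c - c * expR c) * (b - a) <= 0.
  have -> : c - c * expR c = - (c * (expR c - 1)) by ring.
  rewrite mulNr oppr_le0; apply: mulr_ge0; last by rewrite subr_ge0.
  apply: mulr_ge0; first exact: le_trans ac.
  by rewrite subr_ge0 -expR0 ler_expR; exact: le_trans ac.
have : 0 <= a * (b - a) by rewrite mulr_ge0 // subr_ge0.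
have -> : (b - a) ^+ 2 = b * b - a * a - 2 * (a * (b - a)) by ring.
move: E; lra.
Qed.

Let m_inj a b : 0 <= a -> 0 <= b -> m a = m b -> a = b.
Proof.
wlog ab : a b / a <= b.
  by move=> H a0 b0 E; have [/H|/ltW/H h] := leP a b; [exact|rewrite h].
move=> a0 b0 E; have : (b - a) ^+ 2 / 2 <= 0 by rewrite -(subrr (m a)) {2}E m_drop // a0.
have := sqr_ge0 (b - a) => h1 h2.
have /eqP : (b - a) ^+ 2 = 0 by lra.
by rewrite sqrf_eq0 subr_eq0 => /eqP.
Qed.

(** The inverse of m on [0, 2]. On [- 1, 1] it is 1 + W(- c / e), with W the principal branch of the
    Lambert function. *)
Definition kap (c : R) : R := xget 0 [set t | 0 <= t <= 2 /\ m t = c].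

Let kapK s : 0 <= s <= 2 -> kap (m s) = s.
Proof.
move=> s02; rewrite /kap; case: xgetP => [t _ [/andP[t0 _] E]|/(_ s)[]//].
by apply: m_inj => //; case/andP: s02.
Qed.

Let kapP c : -1 <= c <= 1 -> 0 <= kap c <= 2 /\ m (kap c) = c.
Proof.
move=> /andP[c0 c1].
have [|||t] := @IVT R m 0 2 c; first by [].
- apply: derivable_within_continuous => x _; have h := m_deriv x; exact: ex_derive.
- rewrite /m subr0 expR0 mulr1.
  have := expR_ge1Dx (2 : R) => h; rewrite ge_min le_max c1 andbT.
  have e2 : (1 - 2) * expR 2 = - expR 2 :> R by ring.
  by apply/orP; right; rewrite e2; lra.
rewrite in_itv /= => t02 <-; rewrite kapK //; split=> //.
Qed.

Let kap_holder c d : -1 <= c <= 1 -> -1 <= d <= 1 -> (kap c - kap d) ^+ 2 <= 2 * `|c - d|.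
Proof.
wlog cd : c d / kap c <= kap d.
  move=> H cc dd; have [/H|/ltW/H h] := leP (kap c) (kap d); first exact.
  by rewrite -sqrrN opprB distrC h.
move=> /kapP[/andP[c0 _] mc] /kapP[_ md].
have := @m_drop (kap c) (kap d); rewrite c0 cd mc md => /(_ isT).
have := ler_norm (c - d); rewrite -sqrrN opprB; lra.
Qed.

Let kap_deriv (s : R) : 0 < s < 2 -> is_derive (m s) 1 kap (- (s * expR s))^-1.
Proof.
move=> /andP[s0 s2]; apply: is_derive_inverse; last 2 first.
- exact: m_deriv.
- by rewrite oppr_eq0 mulf_neq0 ?gt_eqF ?expR_gt0.
- near=> x; apply: kapK; apply/andP; split; apply/ltW.
    by near: x; exact: lt_nbhsr.
  by near: x; exact: lt_nbhsl.
- near=> x; apply: differentiable_continuous; apply/derivable1_diffP.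
  have h := m_deriv x; exact: ex_derive.
Unshelve. all: by end_near. Qed.

Variable r : R.

Let ang (t : R) : R := 2 * pi * t.
Let c (t : R) : R := expR (- r) * cos (ang t).

(* The point z of Gamma r of argument ang t satisfies (1 - tau) exp tau = c t   *)
(* with tau = 1 - Re z, and then |z| = exp (- r - tau).  The argument of phi z  *)
(* is 2 pi arg_phi t, and dens is the derivative of arg_phi.                    *)
Definition tau (t : R) : R := kap (c t).
Definition rho (t : R) : R := expR (- r - tau t).
Definition ycoord (t : R) : R := rho t * sin (ang t).
Definition dens (t : R) : R := tau t + ycoord t ^+ 2 / tau t.
Definition arg_phi (t : R) : R := t - ycoord t / (2 * pi).
Definition path (t : R) : C := (1 - tau t) +i* ycoord t.

Hypothesis r0 : 0 <= r.

Let er0 : 0 < expR (- r) <= 1.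
Proof. by rewrite expR_gt0 -expR0 ler_expR oppr_le0. Qed.

Let c1 t : -1 <= c t <= 1.
Proof.
rewrite -ler_norml /c normrM ger0_norm ?expR_ge0 //.
by have /andP[e0 e1] := er0; rewrite mulr_ile1 ?expR_ge0 // cos_max.
Qed.

Lemma tau_itv t : 0 <= tau t <= 2.
Proof. by have [] := kapP (c1 t). Qed.

Lemma tauE t : (1 - tau t) * expR (tau t) = expR (- r) * cos (2 * pi * t).
Proof. by have [] := kapP (c1 t). Qed.

Lemma tau_uniq t s : 0 <= s <= 2 -> (1 - s) * expR s = expR (- r) * cos (2 * pi * t) ->
  s = tau t.
Proof. by move=> s02 E; rewrite /tau /c /ang -E -/(m s) kapK. Qed.

Lemma rho_gt0 t : 0 < rho t. Proof. exact: expR_gt0. Qed.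

Lemma rho_le1 t : rho t <= 1.
Proof. by rewrite -expR0 ler_expR; have /andP[] := tau_itv t; move: r0; lra. Qed.

Lemma rho_cos t : rho t * cos (2 * pi * t) = 1 - tau t.
Proof.
rewrite /rho expRD mulrAC -tauE -mulrA -expRD.
by rewrite addrN expR0 mulr1.
Qed.

Lemma path_polar t : path t = (rho t)%:C * cis (2 * pi * t).
Proof.
apply/eqP; rewrite eq_complex /= -rho_cos /ycoord /ang; apply/andP; split; apply/eqP; ring.
Qed.

Lemma absc_path t : absc (path t) = rho t.
Proof. by rewrite path_polar abscM absc_cis mulr1 absc_real ger0_norm // ltW ?rho_gt0. Qed.

(** For tau <= 1, 1 - tau^2 <= (1 - tau) exp tau = exp (- r) cos (2 pi t); squaring gives cos^2 >= 1
    - 2 tau^2. This keeps [ycoord t / tau t] bounded near z = 1, a corner of the curve for r = 0. *)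
Lemma sin_le_tau t : sin (2 * pi * t) ^+ 2 <= 2 * tau t ^+ 2.
Proof.
have /andP[t0 t2] := tau_itv t; have cs := cos2Dsin2 (2 * pi * t).
have [t1|/ltW t1] := leP (tau t) 1; last first.
  have : 1 <= tau t ^+ 2 by rewrite expr_ge1.
  by have := sqr_ge0 (cos (2 * pi * t)); lra.
have E := tauE t; have /andP[e0 e1] := er0.
have h1 : 1 - tau t ^+ 2 <= expR (- r) * cos (2 * pi * t).
  rewrite -E; have -> : 1 - tau t ^+ 2 = (1 - tau t) * (1 + tau t) by ring.
  by rewrite ler_wpM2l ?subr_ge0 // expR_ge1Dx.
have h2 : tau t ^+ 2 <= 1 by rewrite expr_le1.
have h3 : (1 - tau t ^+ 2) ^+ 2 <= cos (2 * pi * t) ^+ 2.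
  apply: (@le_trans _ _ ((expR (- r) * cos (2 * pi * t)) ^+ 2)).
    by apply: lerXn2r; rewrite ?nnegrE ?subr_ge0 // (le_trans _ h1) // subr_ge0.
  by rewrite exprMn ler_piMl ?sqr_ge0 // expr_le1 // ltW.
have := sqr_ge0 (tau t ^+ 2).
move: h3; have -> : (1 - tau t ^+ 2) ^+ 2 = 1 - 2 * tau t ^+ 2 + tau t ^+ 2 ^+ 2 by ring.
lra.
Qed.

Lemma ycoord_sqr_le t : ycoord t ^+ 2 <= 2 * tau t ^+ 2.
Proof.
apply: le_trans (sin_le_tau t); rewrite exprMn ler_piMl ?sqr_ge0 //.
by rewrite expr_le1 ?rho_le1 // ltW ?rho_gt0.
Qed.

(** tau t = 0 would force exp (- r) cos (2 pi t) = 1, hence cos (2 pi t) = 1, which excludes 0 < t <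
    1. *)
Lemma tau_gt0 t : 0 < t < 1 -> 0 < tau t.
Proof.
move=> /andP[t0 t1]; have /andP[h0 _] := tau_itv t; rewrite lt_neqAle h0 andbT eq_sym.
apply/eqP => h; have := tauE t; rewrite h subr0 mul1r expR0.
have p0 := pi_gt0 R.
have [ct|ct] := leP (cos (2 * pi * t)) 0.
  have /andP[e0 _] := er0; have := mulr_ge0_le0 (ltW e0) ct; lra.
have := cos_le1 (2 * pi * t); rewrite le_eqVlt => /orP[/eqP c1'|c1'].
  have s0 : sin (2 * pi * t) = 0.
    apply/eqP; rewrite -sqrf_eq0; apply/eqP.
    by have := cos2Dsin2 (2 * pi * t); rewrite c1'; lra.
  have /eqP[] : cis (2 * pi * t) != 1 :> C.
    by apply: cis_neq1; [rewrite !mulr_gt0 | rewrite -[ltRHS]mulr1 ltr_pM2l // mulr_gt0].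
  by rewrite /cis c1' s0.
have /andP[e0 e1] := er0; have : expR (- r) * cos (2 * pi * t) < 1.
  by apply: le_lt_trans c1'; rewrite ler_piMl // ltW.
by move=> /[swap] <-; rewrite ltxx.
Qed.

Let tau_lt2 t : tau t < 2.
Proof.
have /andP[h0 h2] := tau_itv t; rewrite lt_neqAle h2 andbT; apply/eqP => h.
have := tauE t; have := c1 t; rewrite /c /ang h => /andP[h1 _] E; move: h1; rewrite -E.
by have := expR_ge1Dx (2 : R); lra.
Qed.

Let ang_deriv (t : R) : is_derive t 1 ang (2 * pi).
Proof.
apply: deq (dM (dC (2 * pi) t) (did t)) _.
by rewrite mulr0 addr0 mulr1.
Qed.

Let c_deriv (t : R) : is_derive t 1 c (- (2 * pi * (expR (- r) * sin (ang t)))).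
Proof.
apply: deq (dM (dC (expR (- r)) t) (dcomp (is_derive_cos (ang t)) (ang_deriv t))) _.
ring.
Qed.

Lemma tau_deriv (t : R) : 0 < t < 1 -> is_derive t 1 tau (2 * pi * (ycoord t / tau t)).
Proof.
move=> t01; have t0 := tau_gt0 t01.
have h : is_derive (c t) 1 kap (- (tau t * expR (tau t)))^-1.
  have -> : c t = m (tau t) by rewrite /m tauE.
  by apply: kap_deriv; rewrite t0 tau_lt2.
apply: deq (dcomp h (c_deriv t)) _.
rewrite /ycoord /rho expRD expRN [expR (- tau t)]expRN; field.
by rewrite !gt_eqF ?expR_gt0.
Qed.

Lemma rho_deriv (t : R) : 0 < t < 1 ->
  is_derive t 1 rho (- (2 * pi * (rho t * (ycoord t / tau t)))).
Proof.
move=> t01; have h := dD (dC (- r) t) (dN (tau_deriv t01)).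
by apply: deq (dcomp (is_derive_expR _) h) _; rewrite sub0r -/(rho t); ring.
Qed.

Lemma ycoord_deriv (t : R) : 0 < t < 1 -> is_derive t 1 ycoord (2 * pi * (1 - dens t)).
Proof.
move=> t01; have h := dM (rho_deriv t01) (dcomp (is_derive_sin (ang t)) (ang_deriv t)).
have dE : dens t = 1 - rho t * cos (ang t) + rho t * sin (ang t) * (ycoord t / tau t).
  by rewrite /dens /ang rho_cos subKr expr2 mulrA.
by apply: deq h _; rewrite dE; ring.
Qed.

Lemma arg_phi_deriv (t : R) : 0 < t < 1 -> is_derive t 1 arg_phi (dens t).
Proof.
move=> t01; have h := dD (did t) (dN (dM (ycoord_deriv t01) (dC (2 * pi)^-1 t))).
by apply: deq h _; rewrite mulr0 add0r mulKf ?mulf_neq0 ?gt_eqF ?pi_gt0 // opprB addrC subrK.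
Qed.

(** [kap] is Hoelder of exponent 1 / 2 up to the end of its domain, so continuity also holds at t =
    0 and t = 1 for r = 0. *)
Lemma tau_continuous : continuous tau.
Proof.
move=> t; apply/cvgrPdist_lt => e e0.
have cc : {for t, continuous c}.
  apply: differentiable_continuous; apply/derivable1_diffP; have h := c_deriv t; exact: ex_derive.
have e2 : 0 < e ^+ 2 / 2 by rewrite divr_gt0 // exprn_gt0.
move/cvgrPdist_lt: cc => /(_ _ e2) cc; near=> s.
have hs : `|c t - c s| < e ^+ 2 / 2 by near: s.
rewrite -(ltr_pXn2r (n := 2)) ?nnegrE ?(ltW e0) // real_normK ?num_real //.
by apply: le_lt_trans (kap_holder (c1 t) (c1 s)) _; lra.
Unshelve. all: by end_near. Qed.

Lemma rho_continuous : continuous rho.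
Proof.
move=> t; apply: (@continuous_comp _ _ _ (fun t => - r - tau t) expR).
  by apply: continuousB; [exact: cst_continuous | exact: tau_continuous].
exact: continuous_expR.
Qed.

Lemma ycoord_continuous : continuous ycoord.
Proof.
move=> t; apply: continuousM; first exact: rho_continuous.
apply: (@continuous_comp _ _ _ ang sin); last exact: continuous_sin.
by apply: differentiable_continuous; apply/derivable1_diffP; have h := ang_deriv t; exact: ex_derive.
Qed.

Lemma arg_phi_continuous : continuous arg_phi.
Proof.
move=> t; have h : {for t, continuous (fun t => ycoord t / (2 * pi))}.
  by apply: continuousM; [exact: ycoord_continuous | exact: cst_continuous].
have hid : {for t, continuous (fun t : R => t)} by exact: cvg_id.
exact: (continuousB hid h).
Qed.

Lemma ratio_continuous (t : R) : 0 < t < 1 -> {for t, continuous (fun t => ycoord t / tau t)}.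
Proof.
move=> t01; apply: continuousM; first exact: ycoord_continuous.
by apply: continuousV; [rewrite gt_eqF // tau_gt0 | exact: tau_continuous].
Qed.

Lemma dens_continuous (t : R) : 0 < t < 1 -> {for t, continuous dens}.
Proof.
move=> t01; apply: continuousD; first exact: tau_continuous.
have h : {for t, continuous (fun t => ycoord t * (ycoord t / tau t))}.
  by apply: continuousM; [exact: ycoord_continuous | exact: ratio_continuous].
rewrite /prop_for /continuous_at /=; rewrite expr2 -mulrA.
by apply: cvg_trans h; apply: near_eq_cvg; near=> s; rewrite expr2 mulrA.
Unshelve. all: by end_near. Qed.

Lemma ratio_le t : 0 < t < 1 -> `|ycoord t / tau t| <= 2.
Proof.
move=> t01; have t0 := tau_gt0 t01.
rewrite normrM normfV (gtr0_norm t0) ler_pdivrMr //.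
rewrite -(ler_pXn2r (n := 2)) ?nnegrE ?mulr_ge0 ?(ltW t0) // real_normK ?num_real //.
apply: le_trans (ycoord_sqr_le t) _; rewrite exprMn ler_wpM2r ?sqr_ge0 //; lra.
Qed.

(** [dens] is |1 - z|^2 / Re (1 - z) at z = path t, and 0 by the convention for division when tau t
    = 0. Its sign makes arg phi increase along the curve. *)
Lemma dens_itv t : 0 <= dens t <= 6.
Proof.
have /andP[h0 h2] := tau_itv t; apply/andP; split.
  by rewrite addr_ge0 // divr_ge0 ?sqr_ge0.
have : ycoord t ^+ 2 / tau t <= 4; last by rewrite /dens; lra.
have [->|n0] := eqVneq (tau t) 0; first by rewrite invr0 mulr0.
rewrite ler_pdivrMr ?lt_neqAle ?h0 ?andbT 1?eq_sym //.
apply: le_trans (ycoord_sqr_le t) _; rewrite expr2 mulrA ler_wpM2r //; lra.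
Qed.

Lemma ycoord_0 : ycoord 0 = 0. Proof. by rewrite /ycoord /ang mulr0 sin0 mulr0. Qed.

Lemma ycoord_1 : ycoord 1 = 0.
Proof. by rewrite /ycoord /ang mulr1 mulr_natl sin2pi mulr0. Qed.

Lemma tau_01 : tau 0 = tau 1.
Proof. by rewrite /tau /c /ang mulr0 mulr1 cos0 mulr_natl cos2pi. Qed.

Lemma arg_phi_0 : arg_phi 0 = 0. Proof. by rewrite /arg_phi ycoord_0 mul0r subr0. Qed.

Lemma arg_phi_1 : arg_phi 1 = 1. Proof. by rewrite /arg_phi ycoord_1 mul0r subr0. Qed.

(** The factor exp (1 - z) has modulus exp tau and argument - Im z; the modulus cancels in rho = exp
    (- r - tau). *)
Lemma phi_path t : phi (path t) = (expR (- r))%:C * cis (2 * pi * arg_phi t).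
Proof.
have E : 1 - path t = tau t +i* - ycoord t.
  by apply/eqP; rewrite eq_complex /= sub0r; apply/andP; split; apply/eqP; ring.
rewrite /phi E path_polar /cexp /= -/(cis (- ycoord t)).
have -> : 2 * pi * arg_phi t = 2 * pi * t + - ycoord t.
  by rewrite /arg_phi mulrBr [_ * (_ / _)]mulrC divfK // mulf_neq0 // gt_eqF ?pi_gt0.
rewrite cisD mulrACA -rmorphM; congr (_%:C * _).
by rewrite /rho -expRD subrK.
Qed.

Lemma curve_path t : curve r (path t).
Proof.
split; last by rewrite absc_path rho_le1.
by rewrite phi_path abscM absc_cis mulr1 absc_real ger0_norm // expR_ge0.
Qed.

Lemma path_inj s t : 0 <= s < 1 -> 0 <= t < 1 -> path s = path t -> s = t.
Proof.
wlog st : s t / s <= t.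
  by move=> H s1 t1 E; have [/H|/ltW/H h] := leP s t; [exact|rewrite h].
move=> /andP[s0 s1] /andP[t0 t1] E; apply/eqP; rewrite eq_le st /= leNgt; apply/negP => lt.
have E' := E; move: E'; rewrite !path_polar.
have -> : rho s = rho t by rewrite -!absc_path E.
move/(mulfI _) => /(_ _)/= h.
have {}h : cis (2 * pi * s) = cis (2 * pi * t) :> C.
  by apply: h; rewrite -absc_eq0 absc_real normr_eq0 gt_eqF // rho_gt0.
have p0 : 0 < 2 * pi :> R by rewrite mulr_gt0 // pi_gt0.
have /eqP[] : cis (2 * pi * (t - s)) != 1 :> C.
  apply: cis_neq1; first by rewrite mulr_gt0 // subr_gt0.
  by rewrite -[ltRHS]mulr1 ltr_pM2l //; lra.
by rewrite mulrBr cisD -h -cisD addrN cis0.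
Qed.

Lemma arg_exists (z : C) : z != 0 -> exists2 t : R, 0 <= t < 1 &
  z = (absc z)%:C * cis (2 * pi * t).
Proof.
move=> z0; have a0 : 0 < absc z by rewrite absc_gt0.
have p0 := pi_gt0 R; have pp : 0 < 2 * pi :> R by rewrite mulr_gt0.
pose x := complex.Re z / absc z; pose y := complex.Im z / absc z.
have xy : x ^+ 2 + y ^+ 2 = 1.
  by rewrite !expr_div_n -mulrDl -absc_sqr divff // gt_eqF // exprn_gt0.
have x1 : -1 <= x <= 1.
  rewrite -ler_norml -(@expr_le1 _ 2) // real_normK ?num_real //.
  by rewrite -[leRHS]xy lerDl sqr_ge0.
have zE w : cos w = x -> sin w = y -> z = (absc z)%:C * cis w.
  move=> cw sw; apply/eqP; rewrite eq_complex; apply/andP; split; apply/eqP.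
    by rewrite Re_realM [complex.Re (cis _)]cw /x mulrC divfK // gt_eqF.
  by rewrite Im_realM [complex.Im (cis _)]sw /y mulrC divfK // gt_eqF.
pose a := acos x.
have a_ge0 : 0 <= a by exact: acos_ge0.
have a_lepi : a <= pi by exact: acos_lepi.
have ca : cos a = x by rewrite acosK // in_itv.
have sa : sin a = `|y|.
  rewrite sin_acos // -sqrtr_sqr; congr Num.sqrt; lra.
have [y0|y0] := leP 0 y.
  exists (a / (2 * pi)).
    rewrite divr_ge0 ?(ltW pp) //= ltr_pdivrMr //; lra.
  by apply: zE; rewrite mulrC divfK ?gt_eqF // sa ger0_norm.
exists (1 - a / (2 * pi)).
  have a_gt0 : 0 < a.
    rewrite lt_neqAle a_ge0 andbT eq_sym; apply/eqP => az.
    by move: sa; rewrite az sin0 => /esym/eqP; rewrite normr_eq0 lt_eqF.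
  have : 0 < a / (2 * pi) by rewrite divr_gt0.
  have : a / (2 * pi) <= 1 by rewrite ler_pdivrMr //; lra.
  by move=> *; apply/andP; split; lra.
have -> : 2 * pi * (1 - a / (2 * pi)) = - a + 2 * pi.
  by rewrite mulrBr mulr1 [_ * (a / _)]mulrC divfK ?gt_eqF // addrC.
apply: zE; rewrite mulr_natl; first by rewrite cosD2pi cosN.
by rewrite sinD2pi sinN sa ltr0_norm // opprK.
Qed.

(** If z on the curve has argument 2 pi t, then 1 - Re z solves the equation that determines tau t,
    by [tau_uniq]; the modulus follows. *)
Lemma curve_in_path z : curve r z -> exists2 t : R, 0 <= t < 1 & path t = z.
Proof.
move=> [E z1]; have z0 : z != 0.
  rewrite -absc_gt0 lt_neqAle absc_ge0 andbT eq_sym; apply/eqP => h.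
  by move: E; rewrite absc_phi h mul0r; have := expR_gt0 (- r); lra.
have [t t01 zE] := arg_exists z0; exists t => //.
have a0 : 0 < absc z by rewrite absc_gt0.
have reE : complex.Re z = absc z * cos (2 * pi * t).
  by rewrite {1}zE /= mul0r subr0.
have tE : 1 - complex.Re z = tau t.
  have := Re_le_absc z; rewrite ler_norml => /andP[h1 h2].
  apply: tau_uniq; first by apply/andP; split; lra.
  rewrite subKr {1}reE -E absc_phi; ring.
rewrite path_polar [RHS]zE; congr (_%:C * _).
have := E; rewrite absc_phi tE => h.
by rewrite /rho expRD -h -mulrA -expRD addrN expR0 mulr1.
Qed.

Lemma arg_phi_incr s t : 0 <= s <= t -> t <= 1 -> arg_phi s <= arg_phi t.
Proof.
move=> /andP[s0 st] t1.
have df x : x \in `]0, 1[%R -> derivable arg_phi x 1.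
  by rewrite in_itv /= => /arg_phi_deriv h; exact: ex_derive.
have d0 x : x \in `]0, 1[%R -> 0 <= derive1 arg_phi x.
  rewrite in_itv /= => /arg_phi_deriv h.
  by rewrite derive1E derive_val; have /andP[] := dens_itv x.
apply: (ger0_derive1_le_cc df d0) => //.
- by apply: continuous_subspaceT => x; exact: arg_phi_continuous.
- by rewrite in_itv /= s0 (le_trans st).
- by rewrite in_itv /= t1 (le_trans s0).
Qed.

End CurveFunctions.
(** * The limit measure *)

Section ComplexTopology.
Variable R : realType.
Local Notation C := R[i].

Lemma continuous_complex (f : R -> C) (t : R) :
  {for t, continuous (fun s => complex.Re (f s))} ->
  {for t, continuous (fun s => complex.Im (f s))} -> {for t, continuous f}.
Proof.
move=> /cvgrPdist_lt hr /cvgrPdist_lt hi; apply/cvgrPdist_lt => -[e e'] /=.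
rewrite ltcE /= => /andP[/eqP e0 epos]; have e2 : 0 < e / 2 by rewrite divr_gt0.
near=> s; rewrite absc_norm ltcE /= e0 eqxx /=.
have h1 : `|complex.Re (f t) - complex.Re (f s)| < e / 2 by near: s; exact: hr.
have h2 : `|complex.Im (f t) - complex.Im (f s)| < e / 2 by near: s; exact: hi.
apply: le_lt_trans (absc_le_ReIm _) _; rewrite ReB ImB; lra.
Unshelve. all: by end_near. Qed.

Lemma continuous_ccont (f : C -> R) : continuous f ->
  forall c, ccont_at (fun z => (f z)%:C) c.
Proof.
move=> fc c e e0; have /cvgrPdist_lt/(_ e e0)/nbhs_ballP[d /= d0 hd] := fc c.
case: d d0 hd => d d'; rewrite ltcE /= => /andP[/eqP d'0 d0] hd; exists d => // z hz.
rewrite -rmorphB absc_real distrC; apply: hd.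
by rewrite -ball_normE /ball_ /= absc_norm ltcE /= d'0 eqxx absc_distC.
Qed.

Lemma measurable_path (g : R -> C) : continuous g ->
  measurable_fun [set: R] (g : R -> borelC R).
Proof.
move=> /continuousP gc; apply: (@measurability _ _ _ (borelC R) setT g (@open C)) => //.
move=> _ [B oB <-]; rewrite setTI; apply: open_measurable; exact: gc.
Qed.

Lemma measurable_test (f : C -> R) : continuous f ->
  measurable_fun [set: borelC R] (f : borelC R -> R).
Proof.
move=> /continuousP fc; apply: (measurability _ (RGenOpens.measurableE R)).
move=> _ [_ [a [b ->] <-]]; rewrite setTI; apply: sub_sigma_algebra; apply: fc.
exact: interval_open.
Qed.

Local Notation mu := (@lebesgue_measure R).

(** f need not be continuous at the end points: monotone convergence along the intervals
    [a + u n, b - u n], which are nonempty as u n <= (b - a) / 3, reduces this to the closed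
    case. *)
Lemma ge0_FTC_open (F f : R -> R) (a b : R) : a < b -> continuous F ->
  (forall x, a < x < b -> [/\ is_derive x 1 F (f x), {for x, continuous f} & 0 <= f x]) ->
  (\int[mu]_(x in `]a, b[) (f x)%:E = (F b - F a)%:E)%E.
Proof.
move=> ab Fc hf; pose u n : R := (b - a) / 3 * n.+1%:R^-1.
have ba : 0 < b - a by rewrite subr_gt0.
have u0 n : 0 < u n by rewrite mulr_gt0 ?divr_gt0 // invr_gt0.
have u1 n : u n <= (b - a) / 3.
  by rewrite ler_piMr ?divr_ge0 ?(ltW ba) // invf_le1 // ler1n.
have u_decr p q : (p <= q)%N -> u q <= u p.
  by move=> pq; rewrite ler_wpM2l ?divr_ge0 ?(ltW ba) // lef_pV2 ?posrE // ler_nat.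
have u_cvg : u n @[n --> \oo] --> 0.
  rewrite -[0](mulr0 ((b - a) / 3)); apply: cvgM; first exact: cvg_cst.
  exact: cvg_harmonic.
pose I n : set R := `[a + u n, b - u n]%classic.
have bigI : \bigcup_n I n = `]a, b[%classic.
  apply/seteqP; split=> x /=.
    move=> [n _]; rewrite /I /= !in_itv /= => /andP[h1 h2]; have := u0 n.
    by move=> ?; apply/andP; split; lra.
  rewrite in_itv /= => /andP[ax xb].
  have m0 : 0 < Num.min (x - a) (b - x) by rewrite lt_min !subr_gt0 ax.
  have [n _ hn] := cvgr_lt _ u_cvg _ m0; exists n => //.
  have := hn n (leqnn n); rewrite /= lt_min => /andP[h1 h2].
  by rewrite /I /= in_itv /=; apply/andP; split; lra.
have fI n x : x \in `[a + u n, b - u n] -> a < x < b.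
  rewrite in_itv /= => /andP[h1 h2]; have := u0 n.
  by move=> ?; apply/andP; split; lra.
have cI n : {within I n, continuous f}.
  by apply: continuous_in_subspaceT => x; rewrite inE => /fI /hf[].
have mI n : measurable_fun (I n) (EFin \o f).
  apply/measurable_EFinP; apply: subspace_continuous_measurable_fun; last exact: cI.
  exact: measurable_itv.
have lim1 : (\int[mu]_(x in I n) (f x)%:E)%E @[n --> \oo] --> (\int[mu]_(x in `]a, b[) (f x)%:E)%E.
  rewrite -bigI; apply: ge0_nondecreasing_set_cvg_integral => //.
  - move=> p q pq; apply/subsetPset => x; rewrite /I /= !in_itv /= => /andP[h1 h2].
    by have := u_decr p q pq; move=> ?; apply/andP; split; lra.
  - by move=> n; exact: measurable_itv.
  - by move=> n x /fI /hf[_ _]; rewrite lee_fin.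
have eqI n : (\int[mu]_(x in I n) (f x)%:E = (F (b - u n) - F (a + u n))%:E)%E.
  have lt : a + u n < b - u n by have := u1 n; have := u0 n; lra.
  rewrite (@continuous_FTC2 R f F) //.
  - exact: cI.
  - split.
    - move=> x xi; have /hf[h _ _] : a < x < b.
        apply: (fI n); move: xi; rewrite !in_itv /= => /andP[? ?].
        by apply/andP; split; exact: ltW.
      exact: ex_derive.
    - by apply: cvg_at_right_filter; exact: Fc.
    - by apply: cvg_at_left_filter; exact: Fc.
  - move=> x xi; have /hf[h _ _] : a < x < b.
    apply: (fI n); move: xi; rewrite !in_itv /= => /andP[? ?].
    by apply/andP; split; exact: ltW.
  by rewrite derive1E derive_val.
have lim2 : (\int[mu]_(x in I n) (f x)%:E)%E @[n --> \oo] --> ((F b - F a)%:E : \bar R)%E.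
  under eq_cvg do rewrite eqI.
  apply: cvg_EFin; first by near=> n.
  apply: cvgB.
    have h : b - u n @[n --> \oo] --> b.
      by rewrite -[X in _ --> X]subr0; apply: cvgB => //; exact: cvg_cst.
    exact: (cvg_comp _ _ h (Fc b)).
  have h : a + u n @[n --> \oo] --> a.
    by rewrite -[X in _ --> X]addr0; apply: cvgD => //; exact: cvg_cst.
  exact: (cvg_comp _ _ h (Fc a)).
exact: (cvg_unique _ lim1 lim2).
Unshelve. all: by end_near. Qed.

End ComplexTopology.

(** * The arc measure and its line integrals *)

Section ArcMeasure.
Variable R : realType.
Local Notation C := R[i].
Local Notation leb := (@lebesgue_measure R).
Local Notation I01 := (`](0 : R), (1 : R)[%classic).

Lemma measurable_dens (r : R) : 0 <= r -> measurable_fun I01 (dens r).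
Proof.
move=> r0; apply: open_continuous_measurable_fun; first exact: interval_open.
by move=> t; rewrite inE /= in_itv /= => t01; exact: dens_continuous.
Qed.

(** The increment of arg phi / (2 pi) as a measure on the parameters; its push-forward by the path
    is [curve_measure]. *)
Definition arc_measure (r : R) (r0 : 0 <= r) (A : set (measurableTypeR R)) : \bar R :=
  (\int[leb]_(t in I01 `&` A) (dens r t)%:E)%E.

Section Fixed.
Variables (r : R) (r0 : 0 <= r).
Local Notation nu := (arc_measure r0).

Let dens_ge0 t : (0 <= (dens r t)%:E)%E.
Proof. by rewrite lee_fin; have /andP[] := dens_itv r0 t. Qed.

Let nu0 : nu set0 = 0%E.
Proof. by rewrite /arc_measure setI0 integral_set0. Qed.

Let nu_ge0 A : (0 <= nu A)%E.
Proof. by apply: integral_ge0 => t _; exact: dens_ge0. Qed.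

Let nu_sigma_additive : semi_sigma_additive nu.
Proof.
move=> /= A mA tA mUA; rewrite /arc_measure setI_bigcupr.
have mI k : measurable (I01 `&` A k : set R) by apply: measurableI; [exact: measurable_itv | exact: mA].
rewrite ge0_integral_bigcup //; last 2 first.
- apply/measurable_EFinP; apply: measurable_funS (measurable_dens r0) => //.
  by move=> t [n _ []].
- exact: trivIset_setIl.
apply: is_cvg_ereal_nneg_natsum_cond => n _ _.
by apply: integral_ge0 => t _; exact: dens_ge0.
Qed.

HB.instance Definition _ := isMeasure.Build _ _ _ nu nu0 nu_ge0 nu_sigma_additive.

Lemma arc_measure_itv (a b : R) : 0 <= a <= b -> b <= 1 ->
  nu `[a, b[%classic = (arg_phi r b - arg_phi r a)%:E.
Proof.
move=> /andP[a0]; rewrite le_eqVlt => /orP[/eqP <-|ab] b1.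
  by rewrite set_itvco0 // subrr; exact: nu0.
have sub t : a < t < b -> 0 < t < 1.
  by move=> /andP[h1 h2]; apply/andP; split; lra.
have mab : measurable_fun `]a, b[ (fun t => (dens r t)%:E).
  by apply/measurable_EFinP; apply: measurable_funS (measurable_dens r0).
have -> : nu `[a, b[%classic = (\int[leb]_(t in `]a, b[) (dens r t)%:E)%E.
  rewrite /arc_measure; have [az|az] := eqVneq a 0.
    congr (integral _ _ _); apply/seteqP; split=> t /=; rewrite !in_itv /= az.
      by move=> [/andP[-> _] /andP[]].
    by move=> /andP[t0 tb]; rewrite t0 (ltW t0) tb (lt_le_trans tb).
  have a1 : 0 < a by rewrite lt_neqAle eq_sym az.
  rewrite -(integral_itv_bndoo true true mab); congr (integral _ _ _).
  apply/seteqP; split=> t /=; rewrite !in_itv /=; first by case.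
  by move=> /andP[ta tb]; rewrite ta tb (lt_le_trans a1) // (lt_le_trans tb).
apply: (ge0_FTC_open ab (arg_phi_continuous r0)) => t /sub t01.
split; [exact: arg_phi_deriv|exact: dens_continuous|].
by have /andP[] := dens_itv r0 t.
Qed.

Let nu_setT : nu setT = 1%:E.
Proof.
have := @arc_measure_itv 0 1; rewrite lexx ler01 arg_phi_0 arg_phi_1 subr0 => <- //.
rewrite /arc_measure setIT; congr (integral _ _ _); apply/seteqP; split=> t /=; rewrite !in_itv /=.
  by move=> /andP[t0 t1]; rewrite t0 t1 (ltW t0).
by case.
Qed.

HB.instance Definition _ := Measure_isProbability.Build _ _ R nu nu_setT.

Lemma path_continuous : continuous (path r).
Proof.
move=> t; apply: continuous_complex => /=; last exact: ycoord_continuous.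
by apply: continuousB; [exact: cst_continuous | exact: tau_continuous].
Qed.

(* The unused argument gives the instance below access to 0 <= r.              *)
Definition arc_path (h : 0 <= r) : measurableTypeR R -> borelC R := path r.

Let measurable_arc_path : measurable_fun [set: measurableTypeR R] (arc_path r0).
Proof. exact: measurable_path path_continuous. Qed.

HB.instance Definition _ := isMeasurableFun.Build _ _ _ _ (arc_path r0) measurable_arc_path.

Definition curve_measure : probability (borelC R) R := distribution nu (arc_path r0).

Let path_near (t : R) (P : R -> Prop) : 0 < t < 1 -> (forall s, 0 < s < 1 -> P s) ->
  \forall s \near t, P s.
Proof.
move=> /andP[t0 t1] h; near=> s; apply: h; apply/andP; split.
  by near: s; exact: lt_nbhsr.
by near: s; exact: lt_nbhsl.
Unshelve. all: by end_near. Qed.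

Local Notation q := (fun t => ycoord r t / tau r t).

Let re_deriv (t : R) : 0 < t < 1 ->
  is_derive t 1 (fun s => complex.Re (path r s)) (- (2 * pi * q t)).
Proof.
move=> t01; have := is_deriveB (is_derive_cst (1 : R) t 1) (tau_deriv r0 t01).
by rewrite sub0r.
Qed.

Lemma velocity_path (t : R) : 0 < t < 1 ->
  velocity (path r) t = (- (2 * pi * q t)) +i* (2 * pi * (1 - dens r t)).
Proof.
move=> t01; rewrite /velocity; congr (_ +i* _); rewrite derive1E.
  by have h := re_deriv t01; rewrite derive_val.
by have h := ycoord_deriv r0 t01; rewrite derive_val.
Qed.

(** The path is C1 on the open interval, so the exceptional list is empty. The bound is 2 pi (2 +
    5), from [ratio_le] and [dens_itv]. *)
Lemma path_piecewise_C1 : piecewise_C1 (path r).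
Proof.
split; first by apply: continuous_subspaceT => t; exact: path_continuous.
exists [::], (14 * pi) => t; rewrite in_itv /= => t01 _; split.
- by have h := re_deriv t01; exact: ex_derive.
- by have h := ycoord_deriv r0 t01; exact: ex_derive.
- have h : {for t, continuous
      (fun t => (- (2 * pi * q t)) +i* (2 * pi * (1 - dens r t)) : C)}.
    apply: continuous_complex => /=.
      apply: continuousN; apply: continuousM; first exact: cst_continuous.
      exact: ratio_continuous.
    apply: continuousM; first exact: cst_continuous.
    by apply: continuousB; [exact: cst_continuous | exact: dens_continuous].
  rewrite /prop_for /continuous_at (velocity_path t01).
  apply: cvg_trans h; apply: near_eq_cvg; apply: path_near => // s s01.
  by rewrite velocity_path.
- rewrite velocity_path // absc_norm lecR.
  apply: le_trans (absc_le_ReIm _) _ => /=.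
  have p0 : 0 < 2 * pi :> R by rewrite mulr_gt0 // pi_gt0.
  have h1 := ratio_le r0 t01; have /andP[h2 h3] := dens_itv r0 t.
  rewrite normrN [`|2 * pi * (ycoord r t / tau r t)|]normrM [`|2 * pi * (1 - dens r t)|]normrM.
  rewrite (gtr0_norm p0) -mulrDr.
  have -> : 14 * pi = 2 * pi * 7 :> R by ring.
  rewrite ler_pM2l //.
  have : `|1 - dens r t| <= 5 by rewrite ler_norml; apply/andP; split; lra.
  lra.
Qed.

Let Rint_open (h k : R -> R) : (forall t, 0 < t < 1 -> h t = k t) ->
  measurable_fun I01 k ->
  \int[leb]_(t in `[0, 1]) h t = \int[leb]_(t in I01) k t.
Proof.
move=> hk mk.
have hk' : {in I01, h =1 k}.
  by move=> t; rewrite inE /= in_itv /= => /hk.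
rewrite /Rintegral integral_itv_bndoo; last first.
  apply/measurable_EFinP; apply: eq_measurable_fun mk => t tI.
  by rewrite hk'.
by congr fine; apply: eq_integral => t tI; rewrite hk'.
Qed.

Let q_continuous (t : R) : 0 < t < 1 -> {for t, continuous (fun t => 2 * pi * q t)}.
Proof.
move=> t01; apply: continuousM; first exact: cst_continuous.
exact: ratio_continuous.
Qed.

Let path_neq0 t : path r t != 0.
Proof. by rewrite -absc_gt0 absc_path // rho_gt0. Qed.

(** The logarithmic derivative of rho(t) cis (2 pi t): real part rho' / rho, imaginary part 2 pi. *)
Let logvel t : 0 < t < 1 ->
  velocity (path r) t = path r t * ((- (2 * pi * q t)) +i* (2 * pi)).
Proof.
move=> t01; have t0 := tau_gt0 r0 t01; rewrite velocity_path // /dens.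
have -> : ycoord r t ^+ 2 / tau r t = q t * ycoord r t by rewrite expr2 mulrAC.
have yE : ycoord r t = q t * tau r t by rewrite divfK // gt_eqF.
rewrite /path; set Q := q t in yE *.
apply/eqP; rewrite eq_complex /= yE; apply/andP; split; apply/eqP; ring.
Qed.

(** The imaginary part of z' / z is the constant 2 pi. The real part is - tau', whose integral
    vanishes since tau takes the same value at both ends. *)
Lemma line_integral_inv : line_integral (path r) (fun z => z^-1) = two_pi_i R.
Proof.
have G t : 0 < t < 1 ->
    (path r t)^-1 * velocity (path r) t = (- (2 * pi * q t)) +i* (2 * pi).
  by move=> t01; rewrite logvel // mulKf.
have mI : measurable (I01 : set R) by exact: measurable_itv.
have l01 : leb I01 = 1%E.
  by rewrite lebesgue_measure_itv /= lte_fin ltr01 sube0.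
have im : \int[leb]_(t in `[0, 1]) complex.Im ((path r t)^-1 * velocity (path r) t) = 2 * pi.
  transitivity (2 * pi * fine (leb I01)); last by rewrite l01 mulr1.
  rewrite -Rintegral_cst //; apply: Rint_open; last exact: measurable_cst.
  by move=> t /G ->.
have mq : measurable_fun I01 (fun t => 2 * pi * q t).
  apply: open_continuous_measurable_fun; first exact: interval_open.
  by move=> t; rewrite inE /= in_itv /= => t01; exact: q_continuous.
rewrite /line_integral /two_pi_i; congr (_ +i* _); last exact: im.
transitivity (\int[leb]_(t in I01) - (2 * pi * q t)).
  apply: Rint_open; last exact: measurableT_comp mq.
  by move=> t /G ->.
(* [ge0_FTC_open] applies to nonnegative functions: tau' >= - 4 pi by [ratio_le], so 4 pi is
   added. *)
pose f t := 2 * pi * q t + 4 * pi.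
have f_int : (\int[leb]_(t in I01) (f t)%:E = (4 * pi)%:E)%E.
  have dF (t : R) : 0 < t < 1 -> is_derive t 1 (fun s : R => tau r s + 4 * pi * s) (f t).
    move=> t01; have h1 := tau_deriv r0 t01.
    have h2 : is_derive t 1 (fun s : R => 4 * pi * s) (4 * pi).
      have := is_deriveZ (4 * pi) (is_derive_id t 1).
      by rewrite [_ *: 1]mulr1.
    exact: is_deriveD h1 h2.
  have := @ge0_FTC_open R (fun s => tau r s + 4 * pi * s) f 0 1 ltr01.
  move=> ->; first by rewrite tau_01 mulr0 mulr1 addr0 addrC addKr.
    move=> t; apply: continuousD; first exact: tau_continuous.
    by apply: continuousM; [exact: cst_continuous | exact: cvg_id].
  move=> t t01; split; first exact: dF.
    apply: continuousD; last exact: cst_continuous.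
    exact: q_continuous.
  have := ratio_le r0 t01; rewrite ler_norml => /andP[h _].
  have p0 := pi_gt0 R; rewrite /f.
  have -> : 2 * pi * q t + 4 * pi = 2 * pi * (q t + 2) by ring.
  by rewrite mulr_ge0 ?mulr_ge0 ?(ltW p0) //; lra.
have f_ge0 t : t \in I01 -> (0 <= (f t)%:E)%E.
  rewrite inE /= in_itv /= => t01; rewrite lee_fin.
  have := ratio_le r0 t01; rewrite ler_norml => /andP[h _].
  have p0 := pi_gt0 R; rewrite /f.
  have -> : 2 * pi * q t + 4 * pi = 2 * pi * (q t + 2) by ring.
  by rewrite mulr_ge0 ?mulr_ge0 ?(ltW p0) //; lra.
have mf : measurable_fun I01 f by apply: measurable_funD => //; exact: measurable_cst.
have f_integrable : leb.-integrable I01 (EFin \o f).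
  apply/integrableP; split; first exact/measurable_EFinP.
  under eq_integral => t tI do rewrite gee0_abs ?f_ge0 //.
  by rewrite f_int ltry.
have c_integrable : leb.-integrable I01 (EFin \o (fun=> 4 * pi)).
  apply: (@integrableS _ _ _ leb `[(0 : R), 1]%classic) => //.
    by move=> t /=; rewrite !in_itv /= => /andP[/ltW -> /ltW ->].
  apply: continuous_compact_integrable; first exact: segment_compact.
  by move=> t; exact: cst_continuous.
have -> : \int[leb]_(t in I01) - (2 * pi * q t) =
    \int[leb]_(t in I01) (4 * pi - f t).
  by apply: eq_Rintegral => t _; rewrite /f opprD addrCA subrr addr0.
have c_int : \int[leb]_(t in I01) (4 * pi) = 4 * pi.
  transitivity (4 * pi * fine (leb I01)); last by rewrite l01 mulr1.
  exact: Rintegral_cst.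
by rewrite RintegralB // c_int /Rintegral f_int /= subrr.
Qed.

Lemma path_ccw : ccw_parametrization (path r) (Gamma r).
Proof.
have GE z : Gamma r z <-> curve r z.
  rewrite /Gamma /curve /= !absc_norm lecR; split=> -[h1 h2]; split=> //.
    by case: h1.
  by rewrite -/(phi z) h1.
split.
- exact: path_piecewise_C1.
- by move=> s t; rewrite !in_itv /=; exact: path_inj.
- by rewrite /path tau_01 ycoord_0 ycoord_1.
- apply/seteqP; split=> z /=.
    by move=> [t _ <-]; apply/GE; exact: curve_path.
  move=> /GE/(curve_in_path r0)[t /andP[t0 t1] <-]; exists t => //=.
  by rewrite in_itv /= t0 ltW.
- exact: line_integral_inv.
Qed.

(** (1 - z) z' / z = (tau - i y) (- 2 pi y / tau + 2 pi i) = 2 pi i (tau + y^2 / tau): the complex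
    density pulls back to the real density [dens]. *)
Lemma curve_measure_line (A : set (borelC R)) : measurable A ->
  (fine (curve_measure A))%:C = line_integral (path r)
    (fun z => (\1_(A : set C) z : R)%:C * ((two_pi_i R)^-1 * ((1 - z) / z))).
Proof.
move=> mA; rewrite /line_integral.
have p0 : 2 * pi != 0 :> R by rewrite mulf_neq0 // gt_eqF // pi_gt0.
have tpi : two_pi_i R != 0 by rewrite eq_complex /= eqxx.
have G t : 0 < t < 1 ->
    (\1_(A : set C) (path r t) : R)%:C * ((two_pi_i R)^-1 * ((1 - path r t) / path r t)) *
      velocity (path r) t = ((dens r \_ (path r @^-1` A)) t)%:C.
  move=> t01; have t0 := tau_gt0 r0 t01.
  have E : (two_pi_i R)^-1 * ((1 - path r t) / path r t) * velocity (path r) t =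
      (dens r t)%:C.
    have shuffle (V : C) : two_pi_i R * ((two_pi_i R)^-1 * ((1 - path r t) / path r t) *
        (path r t * V)) = (1 - path r t) * V.
      by rewrite !mulrA mulfV // mul1r divfK.
    apply: (mulfI tpi); rewrite logvel // shuffle.
    have yE : ycoord r t = q t * tau r t by rewrite divfK // gt_eqF.
    rewrite /path /two_pi_i /dens.
    have -> : ycoord r t ^+ 2 / tau r t = q t * ycoord r t by rewrite expr2 mulrAC.
    set Q := q t in yE *.
    apply/eqP; rewrite eq_complex /= yE; apply/andP; split; apply/eqP; ring.
  rewrite -mulrA E -rmorphM; congr (_%:C).
  rewrite indicE patchE /=; have [h|h] := boolP (path r t \in A).
    by rewrite mem_set ?mul1r //; move: h; rewrite inE.
  by rewrite memNset ?mul0r // => h'; move: h; rewrite notin_setE; apply.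
have mP : measurable (path r @^-1` A : set R).
  by rewrite -[X in measurable X]setTI; exact: measurable_arc_path.
have mD : measurable_fun I01 (dens r \_ (path r @^-1` A)).
  by apply/(measurable_restrict (dens r)) => //; apply: measurable_funS (measurable_dens r0).
congr (_ +i* _).
  transitivity (\int[leb]_(t in I01) (dens r \_ (path r @^-1` A)) t); last first.
    by apply/esym/Rint_open => // t /G ->.
  by rewrite -Rintegral_mkcondr.
rewrite (@Rint_open _ (fun=> 0)) ?Rintegral_cst ?mul0r //.
by move=> t /G ->.
Qed.

End Fixed.
End ArcMeasure.
(** * Weak convergence *)

Section Integrals.
Variable R : realType.
Local Notation C := R[i].

Lemma ge0_integral_zero_measure (p : {poly C}) (h : C -> R) :
  measurable_fun [set: borelC R] (h : borelC R -> R) -> (forall z, 0 <= h z) ->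
  (\int[zero_measure p]_z (h z)%:E =
   ((size (zeros p))%:R^-1 * \sum_(z <- zeros p) h z)%:E)%E.
Proof.
move=> mh h0; have mh' : measurable_fun [set: borelC R] (fun z => (h z)%:E).
  exact/measurable_EFinP.
have h0' z : [set: borelC R] z -> (0 <= (h z)%:E)%E by rewrite lee_fin.
rewrite /zero_measure ge0_integral_mscale // ge0_integral_measure_sum //.
rewrite EFinM; congr (_ * _)%E; rewrite (big_nth 0) big_mkord -sumEFin.
by apply: eq_bigr => j _; rewrite integral_dirac // diracT mul1e.
Qed.

Lemma Rintegral_zero_measure (p : {poly C}) (f : C -> R) : continuous f ->
  \int[zero_measure p]_z f z = (size (zeros p))%:R^-1 * \sum_(z <- zeros p) f z.
Proof.
move=> /measurable_test mf; rewrite /Rintegral integralE.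
have maxE : (fun z : borelC R => (f z)%:E)^\+%E = (fun z => (Num.max (f z) 0)%:E).
  by apply/funext => z; rewrite funeposE EFin_max.
have minE : (fun z : borelC R => (f z)%:E)^\-%E = (fun z => (Num.max (- f z) 0)%:E).
  by apply/funext => z; rewrite funenegE EFin_max.
rewrite maxE minE !ge0_integral_zero_measure.
- rewrite /= -mulrBr -sumrB; congr (_ * _); apply: eq_bigr => z _.
  by rewrite /Num.max; case: ltP => h1; case: ltP => h2; lra.
- apply: measurable_maxr; last exact: measurable_cst.
  exact: measurableT_comp mf.
- by move=> z; rewrite le_max lexx orbT.
- by apply: measurable_maxr; last exact: measurable_cst.
- by move=> z; rewrite le_max lexx orbT.
Qed.

Lemma cis_dist_le (a b : R) : `|a - b| <= 1 -> absc (cis a - cis b) <= 2 * `|a - b|.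
Proof.
move=> ab1; set d := a - b.
have -> : cis a - cis b = cis b * (cis d - 1).
  by rewrite mulrBr mulr1 -cisD; congr (cis _ - _); rewrite /d; ring.
rewrite abscM absc_cis mul1r; apply: le_trans (absc_le_ReIm _) _ => /=.
rewrite subr0; have h1 := sin_le_id d.
have h2 : `|cos d - 1| <= d ^+ 2 / 2.
  rewrite distrC ger0_norm ?subr_ge0 ?cos_le1 //.
  by have := cos_ge_quad d; lra.
have : d ^+ 2 <= `|d|.
  by rewrite -real_normK ?num_real // expr2 ler_piMl.
have := normr_ge0 d; lra.
Qed.

Section Riemann.
Variables (r : R) (r0 : 0 <= r).
Local Notation nu := (arc_measure r0).

Let nu_fin (D : set (measurableTypeR R)) : measurable D -> (nu D < +oo)%E.
Proof. by move=> mD; apply: le_lt_trans (probability_le1 nu mD) _; rewrite ltry. Qed.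

Let integrable_bounded (h : R -> R) (B : R) (D : set (measurableTypeR R)) :
  measurable_fun [set: R] h -> (forall t, `|h t| <= B) -> measurable D ->
  (nu : {measure set _ -> \bar R}).-integrable D (EFin \o h).
Proof.
move=> mh hB mD; apply: measurable_bounded_integrable => //.
- exact: nu_fin.
- exact: measurable_funTS.
- by exists B; split; [exact: num_real | move=> x Bx t _; apply: le_trans (hB t) (ltW Bx)].
Qed.

(** The points [ts m] are quantiles of nu, so each cell has mass 1 / M and contributes at most c m /
    M; the complement of [0, 1) is a null set. Lower bounds follow by applying this to - h. *)
Let step_upper (h : R -> R) (B : R) (M : nat) (ts c : nat -> R) :
  measurable_fun [set: R] h -> (forall t, `|h t| <= B) -> (0 < M)%N ->
  ts 0%N = 0 -> ts M = 1 ->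
  (forall m, (m <= M)%N -> 0 <= ts m <= 1 /\ arg_phi r (ts m) = m%:R / M%:R) ->
  (forall m, (m < M)%N -> ts m <= ts m.+1) ->
  (forall m t, (m < M)%N -> ts m <= t < ts m.+1 -> h t <= c m) ->
  \int[nu]_t h t <= (\sum_(m < M) c m) / M%:R.
Proof.
move=> mh hB M0 ts0 tsM hts tsS hc.
have MR : 0 < M%:R :> R by rewrite ltr0n.
have mI (a b : R) : measurable (`[a, b[%classic : set (measurableTypeR R)).
  exact: measurable_itv.
have part m : (m <= M)%N ->
    \int[nu]_(t in `[0, ts m[) h t <= (\sum_(j < m) c j) / M%:R.
  elim: m => [_|m IH mM].
    by rewrite ts0 set_itvco0 Rintegral_set0 big_ord0 mul0r.
  have [/andP[a0 a1] aE] := hts m (ltnW mM); have [/andP[b0 b1] bE] := hts m.+1 mM.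
  have ab := tsS m mM.
  have -> : `[0, ts m.+1[%classic = `[0, ts m[%classic `|` `[ts m, ts m.+1[%classic :> set R.
    apply/seteqP; split=> t /=; rewrite !in_itv /=.
      move=> /andP[t0 tb]; have [ta|ta] := ltP t (ts m); [left|right]; first by rewrite t0.
      by rewrite tb.
    move=> [/andP[-> ta]|/andP[ta ->]] /=; first exact: lt_le_trans ab.
    by rewrite (le_trans a0).
  rewrite Rintegral_setU //; last 2 first.
  - apply: integrable_bounded mh hB _; exact: measurableU.
  - apply/disj_setPS => t /=; rewrite !in_itv /= => -[/andP[_ h1] /andP[h2 _]].
    by have := le_lt_trans h2 h1; rewrite ltxx.
  rewrite big_ord_recr /= mulrDl; apply: lerD; first exact/IH/ltnW.
  apply: (@le_trans _ _ (\int[nu]_(t in `[ts m, ts m.+1[) c m)).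
    apply: le_Rintegral => //.
    - exact: integrable_bounded mh hB _.
    - by apply: (@integrable_bounded (fun=> c m) `|c m|) => //.
    - by move=> t /=; rewrite in_itv /=; exact: hc.
  rewrite Rintegral_cst //.
  rewrite [X in fine X](_ : _ = (arg_phi r (ts m.+1) - arg_phi r (ts m))%:E) /=; last first.
    by apply: arc_measure_itv; rewrite ?a0.
  rewrite aE bE.
  by rewrite -mulrBl -natr1 addrAC subrr add0r mul1r.
have m01 := mI 0 1.
have nuC : nu (~` `[0, 1[%classic) = 0%E.
  rewrite probability_setC // [X in (1 - X)%E](_ : _ = 1%:E) ?subee //.
  have := @arc_measure_itv R r r0 0 1; rewrite lexx ler01 arg_phi_0 arg_phi_1 subr0.
  by apply.
have mC : measurable (~` `[0, 1[%classic : set (measurableTypeR R)) by exact: measurableC.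
have -> : \int[nu]_t h t = \int[nu]_(t in `[0, 1[ `|` ~` `[0, 1[%classic) h t.
  by rewrite setUv.
rewrite Rintegral_setU //; last 2 first.
- by rewrite setUv; exact: integrable_bounded mh hB _.
- by apply/disj_setPS; rewrite setICr.
have h1 : \int[nu]_(t in `[0, 1[) h t <= (\sum_(m < M) c m) / M%:R.
  by have := part M (leqnn M); rewrite tsM.
have h2 : \int[nu]_(t in ~` `[0, 1[%classic) h t <= 0.
  apply: (@le_trans _ _ (\int[nu]_(t in ~` `[0, 1[%classic) B)).
    apply: le_Rintegral => //.
    - exact: integrable_bounded mh hB _.
    - by apply: (@integrable_bounded (fun=> B) `|B|) => //.
    - by move=> t _; apply: le_trans (ler_norm _) (hB t).
  by rewrite Rintegral_cst // [X in fine X](_ : _ = 0%E) ?mulr0 //; exact: nuC.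
by rewrite -[leRHS]addr0; apply: lerD.
Qed.

Lemma arg_phi_grid (M : nat) : (0 < M)%N -> exists ts : nat -> R,
  [/\ ts 0%N = 0, ts M = 1 &
      forall m, (m <= M)%N -> 0 <= ts m <= 1 /\ arg_phi r (ts m) = m%:R / M%:R].
Proof.
move=> M0; have MR : 0 < M%:R :> R by rewrite ltr0n.
have /choice[ts hts] : forall m : nat, exists t : R, [/\ m = 0%N -> t = 0, m = M -> t = 1 &
    (m <= M)%N -> 0 <= t <= 1 /\ arg_phi r t = m%:R / M%:R].
  move=> m; have [->|m0] := eqVneq m 0%N.
    exists 0; split=> // [M00|_]; first by rewrite -M00 in M0.
    by rewrite lexx ler01 arg_phi_0 mul0r.
  have [->|mM] := eqVneq m M.
    exists 1; split=> // [M00|_]; first by rewrite M00 in M0.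
    by rewrite lexx ler01 arg_phi_1 divff // gt_eqF.
  have [mM'|Mm] := leqP m M; last by exists 0; split=> // E; rewrite E eqxx in mM.
  have [||t] := @IVT R (arg_phi r) 0 1 (m%:R / M%:R) ler01.
  - by apply: continuous_subspaceT => x; exact: arg_phi_continuous.
  - rewrite arg_phi_0 arg_phi_1 ge_min le_max divr_ge0 //=.
    by apply/orP; right; rewrite ler_pdivrMr // mul1r ler_nat.
  rewrite in_itv /= => t01 E; exists t; split=> // E'; first by rewrite E' eqxx in m0.
  by rewrite E' eqxx in mM.
exists ts; split; first by have [h _ _] := hts 0%N; exact: h.
  by have [_ h _] := hts M; exact: h.
by move=> m; have [_ _ h] := hts m.
Qed.

(** On a cell between consecutive quantiles arg phi varies by at most 2 pi / M, so
    [curve_inverse_modulus] makes f vary by at most e there. *)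
Lemma curve_measure_riemann (f : C -> R) (B e : R) : continuous f ->
  (forall z, `|f z| <= B) -> 0 < e ->
  exists N : nat, forall M, (N < M)%N -> exists ts : nat -> R,
    (forall m, (m < M)%N -> arg_phi r (ts m) = m%:R / M%:R) /\
    `|\int[curve_measure r0]_z f z - (\sum_(m < M) f (path r (ts m))) / M%:R| <= e.
Proof.
move=> fc fB e0.
have [d /andP[d0 d1] hd] := curve_inverse_modulus r (continuous_ccont fc) e0.
have p0 := pi_gt0 R.
(* This makes 4 pi / M < d, where 4 pi / M is the bound of [cis_dist_le] for an arc of length 2 pi /
   M. *)
exists (Num.trunc (4 * pi / d)) => M NM.
have M0 : (0 < M)%N by exact: leq_ltn_trans NM.
have MR : 0 < M%:R :> R by rewrite ltr0n.
have Md : 4 * pi / d < M%:R.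
  by apply: lt_le_trans (truncnS_gt _) _; rewrite ler_nat.
have Md' : 4 * pi / M%:R < d by rewrite ltr_pdivrMr // [d * _]mulrC -ltr_pdivrMr.
have [ts [ts0 tsM hts]] := arg_phi_grid M0.
exists ts; split; first by move=> m mM; have [] := hts m (ltnW mM).
have tsS m : (m < M)%N -> ts m <= ts m.+1.
  move=> mM; rewrite leNgt; apply/negP => lt.
  have [/andP[a0 a1] aE] := hts m (ltnW mM); have [/andP[b0 b1] bE] := hts m.+1 mM.
  have := @arg_phi_incr R r r0 (ts m.+1) (ts m); rewrite b0 (ltW lt) aE bE => /(_ isT a1).
  by rewrite ler_pM2r ?invr_gt0 // ler_nat ltnn.
pose h t := f (path r t).
have close m t : (m < M)%N -> ts m <= t < ts m.+1 -> `|h t - h (ts m)| <= e.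
  move=> mM /andP[at' tb]; apply/ltW/hd; [exact: curve_path|exact: curve_path|].
  have [/andP[a0 a1] aE] := hts m (ltnW mM); have [/andP[b0 b1] bE] := hts m.+1 mM.
  have t0 : 0 <= t := le_trans a0 at'; have t1 : t <= 1 := le_trans (ltW tb) b1.
  have k1 : arg_phi r (ts m) <= arg_phi r t by apply: arg_phi_incr; rewrite ?a0.
  have k2 : arg_phi r t <= arg_phi r (ts m.+1) by apply: arg_phi_incr; rewrite ?t0 ?(ltW tb).
  have k3 : `|2 * pi * arg_phi r t - 2 * pi * arg_phi r (ts m)| <= 2 * pi / M%:R.
    rewrite -mulrBr normrM ger0_norm; last by rewrite mulr_ge0 // ltW.
    rewrite ler_wpM2l ?mulr_ge0 ?(ltW p0) // ger0_norm ?subr_ge0 //.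
    apply: le_trans (lerB k2 (lexx _)) _.
    by rewrite aE bE -mulrBl -natr1 addrAC subrr add0r mul1r.
  have k4 : 4 * pi / M%:R = 2 * (2 * pi / M%:R) :> R.
    have -> : 4 = 2 * 2 :> R by rewrite -natrM.
    by rewrite -!mulrA.
  rewrite !phi_path // -mulrBr abscM absc_real ger0_norm ?expR_ge0 //.
  apply: le_lt_trans (_ : absc (cis (2 * pi * arg_phi r t) - cis (2 * pi * arg_phi r (ts m))) < d).
    by rewrite ler_piMl ?absc_ge0 // -expR0 ler_expR oppr_le0.
  apply: le_lt_trans (cis_dist_le _) _; lra.
have mh : measurable_fun [set: R] h.
  apply: (@measurableT_comp _ _ _ _ _ _ (f : borelC R -> R)); first exact: measurable_test.
  exact: measurable_path (path_continuous r0).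
have hB t : `|h t| <= B by exact: fB.
have intE : \int[curve_measure r0]_z f z = \int[nu]_t h t.
  rewrite /Rintegral; congr fine.
  apply: (@integral_distribution _ _ _ _ _ nu (arc_path r0) (fun z : borelC R => (f z)%:E)).
  - by apply/measurable_EFinP; exact: measurable_test.
  - exact: integrable_bounded mh hB _.
rewrite intE ler_norml; set A := _ / M%:R.
have up : \int[nu]_t h t <= (\sum_(m < M) (h (ts m) + e)) / M%:R.
  apply: (@step_upper h B M ts (fun m => h (ts m) + e) mh hB M0 ts0 tsM hts tsS) => m t mM /(close m t mM).
  by rewrite ler_norml => /andP[_]; lra.
have lo : \int[nu]_t (-1 * h t) <= (\sum_(m < M) (- h (ts m) + e)) / M%:R.
  apply: (@step_upper (fun t => -1 * h t) B M ts (fun m => - h (ts m) + e) _ _ M0 ts0 tsM hts tsS).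
  - exact: measurable_funM (measurable_cst _) mh.
  - by move=> t; rewrite mulN1r normrN.
  - move=> m t mM /(close m t mM).
    by rewrite mulN1r ler_norml => /andP[lo1 lo2]; clear -lo1 lo2; lra.
have oppE : \int[nu]_t (-1 * h t) = - \int[nu]_t h t.
  rewrite -[RHS]mulN1r; apply: RintegralZl => //; exact: integrable_bounded mh hB _.
rewrite oppE in lo.
have sum_cst : (\sum_(m < M) e) / M%:R = e :> R.
  by rewrite sumr_const card_ord -[e *+ M]mulr_natr mulfK // gt_eqF.
have AE : (\sum_(m < M) h (ts m)) / M%:R = A by [].
move: up lo; rewrite !big_split /= sumrN !mulrDl sum_cst mulNr AE.
by move=> up lo; clear -up lo; apply/andP; split; lra.
Qed.

End Riemann.
End Integrals.

(** * Convergence for finite and for infinite r *)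

Section Convergence.
Variable R : realType.
Local Notation C := R[i].
Variable alpha : nat -> R.
Hypothesis alpha_notin : forall n j : nat, (1 <= j <= n)%N -> alpha n != - j%:R.
Hypothesis alpha_lim : alpha n / n%:R @[n --> \oo] --> (-1 : R).

Let zs n := lagzeros n (alpha n).
Let nu n := zero_measure (laguerre n (alpha n)%:C \Po (n%:R *: 'X)).

Let zs_size n : (0 < n)%N -> size (zs n) = n.
Proof. by move=> n0; exact: size_lagzeros. Qed.

Let zs_neq0 n : (0 < n)%N -> forall z, z \in zs n -> z != 0.
Proof. by move=> n0 z; apply: lagzeros_neq0 => //; exact: alpha_notin. Qed.

Let nu_int (f : C -> R) n : continuous f -> (0 < n)%N ->
  \int[nu n]_z f z = n%:R^-1 * \sum_(z <- zs n) f z.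
Proof.
move=> fc n0; rewrite Rintegral_zero_measure // -/(lagzeros n (alpha n)) -/(zs n).
by rewrite zs_size.
Qed.

(** Both integrals are compared with the average of f over the same M points of the curve, those
    whose images under phi are equally spaced: [mean_limit] for the zeros, [curve_measure_riemann]
    for the limit. M exceeds both thresholds. *)
Lemma weak_star_finite (s : R) (s0 : 0 <= s) :
  distS n (alpha n) `^ n%:R^-1 @[n --> \oo] --> expR (- s) ->
  weak_star_cvg nu (curve_measure s0).
Proof.
move=> hd f fc [B fB]; apply/cvgrPdist_le => e e0; have e2 : 0 < e / 2 by rewrite divr_gt0.
have lower := distS_root_lower alpha_notin hd.
have upper := distS_root_upper alpha_notin hd (lexx _).
have [N1 h1] := mean_limit s0 zs_size zs_neq0 (lagzeros_bounded alpha_lim)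
  (fun m d m0 d0 => lagzeros_means alpha_notin alpha_lim m0 d0)
  (fun d d0 => lagzeros_prod_ge alpha_lim d0 lower)
  (lagzeros_subexp alpha_lim s0 upper) (continuous_ccont fc) fB e2.
have [N2 h2] := curve_measure_riemann s0 fc fB e2.
pose M := (maxn N1 N2).+1.
have [ts [hts h3]] := h2 M (leq_maxr _ _).
have := h1 M (leq_maxl _ _) (fun m => path s (ts m)) (fun m => curve_path s0 (ts m)).
move=> h4; near=> n.
have n0 : (0 < n)%N by near: n; exists 1%N.
have nR : 0 < n%:R :> R by rewrite ltr0n.
have h5 : `|\sum_(z <- zs n) f z - n%:R * ((\sum_(m < M) f (path s (ts m))) / M%:R)| <= e / 2 * n%:R.
  near: n; apply: h4 => m mM.
  rewrite phi_path // mulrA -rmorphM -expRD subrr expR0 mul1r hts // cisX.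
  by congr cis; rewrite mulrCA mulrA [m%:R * _]mulrC -mulrA mulrA.
rewrite nu_int //; set A := _ / M%:R in h3 h5.
set S := \sum_(z <- zs n) f z in h5 *.
have h6 : `|n%:R^-1 * S - A| <= e / 2.
  have E : S - n%:R * A = (n%:R^-1 * S - A) * n%:R by field; rewrite gt_eqF.
  by rewrite -(ler_pM2r nR); move: h5; rewrite E normrM (ger0_norm (ltW nR)).
have -> : \int[curve_measure s0]_z f z - n%:R^-1 * S =
  (\int[curve_measure s0]_z f z - A) - (n%:R^-1 * S - A) by ring.
by apply: le_trans (ler_normB _ _) _; lra.
Unshelve. all: by end_near. Qed.

(** The root limit 0 gives subexponential growth on [outer s] for every s, so all but o(n) zeros lie
    where f is close to f 0; the others contribute at most 2 B each. *)
Lemma weak_star_infinite :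
  distS n (alpha n) `^ n%:R^-1 @[n --> \oo] --> (0 : R) ->
  weak_star_cvg nu (\d_(0 : borelC R) : {measure set (borelC R) -> \bar R}).
Proof.
move=> hd f fc [B fB]; apply/cvgrPdist_le => e e0; have e2 : 0 < e / 2 by rewrite divr_gt0.
have B0 : 0 <= B by apply: le_trans (fB 0).
have sub s : 0 <= s -> subexp_on (outer s) zs.
  move=> s0; apply: lagzeros_subexp => //.
  exact: (distS_root_upper alpha_notin hd (expR_ge0 _)).
have [d d0 hd'] := continuous_ccont fc 0 e2.
have e3 : 0 < e / (4 * (B + 1)) by rewrite divr_gt0 // mulr_gt0 // ltr_wpDl.
have sp := sparse_outer_all sub d0 e3.
set bad := fun z : C => `[< _ >] in sp.
near=> n.
have n0 : (0 < n)%N by near: n; exists 1%N.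
have nR : 0 < n%:R :> R by rewrite ltr0n.
have hc : (count bad (zs n))%:R <= e / (4 * (B + 1)) * n%:R by near: n; exact: sp.
have -> : \int[(\d_(0 : borelC R) : {measure set (borelC R) -> \bar R})]_z f z = f 0.
  rewrite /Rintegral integral_dirac //; last by apply/measurable_EFinP; exact: measurable_test.
  by rewrite diracT mul1e.
rewrite nu_int //.
have fE : n%:R * f 0 = \sum_(z <- zs n) f 0.
  by rewrite big_const_seq count_predT iter_addr_0 zs_size // mulr_natl.
have -> : f 0 - n%:R^-1 * \sum_(z <- zs n) f z = n%:R^-1 * \sum_(z <- zs n) (f 0 - f z).
  by rewrite sumrB -fE mulrBr mulKf // gt_eqF.
rewrite normrM ger0_norm ?invr_ge0 // ler_pdivrMl // mulrC.
apply: le_trans (ler_norm_sum _ _ _) _.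
apply: (@le_trans _ _ (\sum_(z <- zs n) (e / 2 + 2 * B * (bad z)%:R))).
  apply: ler_sum => z _; have [h|h] := boolP (bad z).
    rewrite mulr1; apply: le_trans (ler_normB _ _) _.
    by have := fB 0; have := fB z; lra.
  rewrite mulr0 addr0 distrC ltW // -absc_real rmorphB; apply: hd'; rewrite subr0 ltNge.
  by apply: contra h => h; apply/asboolP.
rewrite big_split /= -[X in _ + X <= _]mulr_sumr sum_nat_of_bool.
rewrite big_const_seq count_predT iter_addr_0 zs_size // -[(e / 2) *+ n]mulr_natr.
have : 2 * B * (count bad (zs n))%:R <= 2 * (B + 1) * (e / (4 * (B + 1)) * n%:R).
  by apply: ler_pM => //; [rewrite mulr_ge0 | rewrite ler_pM2l // lerDl].
have -> : 2 * (B + 1) * (e / (4 * (B + 1)) * n%:R) = e / 2 * n%:R.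
  by field; rewrite gt_eqF // ltr_wpDl.
lra.
Unshelve. all: by end_near. Qed.

End Convergence.

Theorem theorem1 (R : realType) (alpha : nat -> R) (r : \bar R)
  (alpha_notin : forall n j : nat, (1 <= j <= n)%N -> alpha n != - j%:R)
  (alpha_lim : alpha n / n%:R @[n --> \oo] --> (-1 : R))
  (r_ge0 : (0 <= r)%E)
  (dist_lim : (distS n (alpha n) `^ n%:R^-1)%:E @[n --> \oo] --> expeR (- r)) :
  exists2 mu : probability (borelC R) R, is_mu r mu &
    weak_star_cvg
      (fun n => zero_measure (laguerre n (alpha n)%:C \Po (n%:R *: 'X))) mu.
Proof.
case: r r_ge0 dist_lim => [s|_|//].
  rewrite lee_fin => s0 /fine_cvgP[_ hd].
  exists (curve_measure s0); last exact: weak_star_finite.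
  by exists (path s); [exact: path_ccw | exact: curve_measure_line].
move=> /fine_cvgP[_ hd].
exists (\d_(0 : borelC R)); last exact: weak_star_infinite.
by [].
Qed.
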